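(* Let $K$ be an algebraically closed field, $X$ a non-singular, irreducible, projective variety over $K$, and $\phi:X\to X$ a morphism over $K$ such that $\phi^n$ is non-degenerate for every $n\ge1$. If $P \in X(K)$ is a fixed point of $\phi$, then the sequence $\{a_P(n)\}$, indexed by the $n \in \mathbb{N}$ with $\operatorname{char} K \nmid n$, is bounded.
   Context: $\phi^n$ is non-degenerate if the graph $\Gamma_n$ of $\phi^n$ and the diagonal $\Delta$ in $X\times X$ intersect properly; then $a_P(n)$ is the intersection multiplicity of $\Gamma_n$ and $\Delta$ at $(P,P)$. The condition $\operatorname{char}K\nmid n$ means $n\neq 0$ in $K$. *)

(* Defs.v *)
From HB Require Import structures.
From mathcomp Require Import all_boot all_order all_algebra.
From mathcomp Require Import boolp classical_sets functions.
From mathcomp Require Import mpoly.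

Set Implicit Arguments.
Unset Strict Implicit.
Unset Printing Implicit Defensive.

Import GRing.Theory.
Local Open Scope classical_set_scope.
Local Open Scope ring_scope.
Local Open Scope quotient_scope.

(* The supremum of the lengths of the chains C 0 < ... < C l of sets satisfying
   Q is attained and equal to l.  It yields the dimension of a space
   (irreducible closed sets), the Krull dimension of a ring (prime ideals) and
   the length of a module (submodules). *)
Definition has_chain T (Q : set T -> Prop) (l : nat) : Prop :=
  exists C : nat -> set T,
    (forall i, (i <= l)%N -> Q (C i)) /\
    (forall i, (i < l)%N -> C i `<` C i.+1).

Definition max_chain T (Q : set T -> Prop) (l : nat) : Prop :=
  has_chain Q l /\ (forall k, has_chain Q k -> (k <= l)%N).

Section CommutativeAlgebra.
Variable A : comPzRingType.

Definition is_ideal (I : set A) : Prop :=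
  [/\ I 0, (forall a b, I a -> I b -> I (a + b))
    & (forall c a, I a -> I (c * a))].

Definition is_prime_ideal (I : set A) : Prop :=
  [/\ is_ideal I, ~ I 1 & forall a b, I (a * b) -> I a \/ I b].

Definition krull_dim (N : nat) : Prop := max_chain is_prime_ideal N.

Definition noetherian : Prop :=
  forall I, is_ideal I -> exists k, exists t : 'I_k -> A,
    I = [set a | exists c : 'I_k -> A, a = \sum_(i < k) c i * t i].

Definition nonunits : set A := [set a | ~ exists b, a * b = 1].

Definition is_local : Prop := is_ideal nonunits.

Definition ideal_sqr (I : set A) : set A :=
  [set a | exists k, exists u v : 'I_k -> A,
     (forall i, I (u i) /\ I (v i)) /\ a = \sum_(i < k) u i * v i].

(* The classes of t form a basis of m / m^2 over A / m, for m := nonunits. *)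
Definition cotangent_dim (N : nat) : Prop :=
  exists t : 'I_N -> A,
    [/\ forall i, nonunits (t i),
        forall a, nonunits a -> exists c : 'I_N -> A,
          ideal_sqr nonunits (a - \sum_(i < N) c i * t i)
      & forall c : 'I_N -> A, ideal_sqr nonunits (\sum_(i < N) c i * t i) ->
          forall i, nonunits (c i)].

Definition regular_local_ring : Prop :=
  [/\ noetherian, is_local
    & exists N, krull_dim N /\ cotangent_dim N].

(* Elements of A^r are row vectors and a matrix acts on the right:
     ... -> A^(r 2) --d 1--> A^(r 1) --d 0--> A^(r 0) --e--> A / I -> 0. *)
Definition free_resolution (I : set A) (r : nat -> nat)
    (d : forall i, 'M[A]_(r i.+1, r i)) (e : 'cV[A]_(r 0%N)) : Prop :=
  [/\ forall a : A, exists v : 'rV_(r 0%N), I (a - (v *m e) 0 0),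
      forall v : 'rV_(r 0%N), I ((v *m e) 0 0) <-> exists w, v = w *m d 0%N
    & forall i (v : 'rV_(r i.+1)), v *m d i = 0 <-> exists w, v = w *m d i.+1].

Definition is_submodule k (M : set 'rV[A]_k) : Prop :=
  [/\ M 0, (forall u v, M u -> M v -> M (u + v))
    & (forall c u, M u -> M (c *: u))].

(* The kernel and the image computing the homology at A^(r i) of the complex
   tensored with A / J, both as submodules of A^(r i) containing J^(r i). *)
Definition tor_cycles (J : set A) (r : nat -> nat)
    (d : forall i, 'M[A]_(r i.+1, r i)) (i : nat) : set 'rV[A]_(r i) :=
  match i return set 'rV[A]_(r i) with
  | 0 => setT
  | i'.+1 => [set v | forall j, J ((v *m d i') 0 j)]
  end.

Definition tor_boundaries (J : set A) (r : nat -> nat)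
    (d : forall i, 'M[A]_(r i.+1, r i)) (i : nat) : set 'rV[A]_(r i) :=
  [set v | exists w : 'rV_(r i.+1), forall j, J ((v - w *m d i) 0 j)].

Arguments tor_cycles J [r] d i.
Arguments tor_boundaries J [r] d i.

(* Tor_i(A / I, A / J), computed from the resolution (r, d) of A / I, has
   finite length l. *)
Definition tor_length (J : set A) (r : nat -> nat)
    (d : forall i, 'M[A]_(r i.+1, r i)) (i l : nat) : Prop :=
  max_chain
    (fun M : set 'rV[A]_(r i) => [/\ is_submodule M, tor_boundaries J d i `<=` M
      & M `<=` tor_cycles J d i]) l.

(* Serre's formula m = sum_i (-1)^i length (Tor_i(A / I, A / J)).  Tor does not
   depend on the resolution, so m is determined by I and J. *)
Definition serre_multiplicity (I J : set A) (m : int) : Prop :=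
  exists (r : nat -> nat) (d : forall i, 'M[A]_(r i.+1, r i))
         (e : 'cV[A]_(r 0%N)) (l : nat -> nat) (s : nat),
    [/\ free_resolution I d e,
        forall i, tor_length J d i (l i),
        forall i, (s <= i)%N -> l i = 0%N
      & m = \sum_(i < s) (-1) ^+ i * (l i)%:Z].

End CommutativeAlgebra.

Section ProjectiveSpace.
Variable K : fieldType.

(* The projective space P^(n-1) of lines in K^n. *)
Definition proj (n : nat) : Type := {L : {vspace 'rV[K]_n} | \dim L == 1%N}.

(* Homogeneous coordinates of a point. *)
Definition coords n (x : proj n) : 'rV[K]_n := vpick (sval x).

Definition heval n (p : {mpoly K[n]}) (x : proj n) : K := p.@[coords x 0].

Definition zclosed n (Z : set (proj n)) : Prop :=
  exists S : set {mpoly K[n]},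
    (forall p, S p -> exists d, p \is d.-homog) /\
    Z = [set x | forall p, S p -> heval p x = 0].

Definition zopen n (U : set (proj n)) : Prop := zclosed (~` U).

Definition irreducible n (Z : set (proj n)) : Prop :=
  Z !=set0 /\
  (forall F G, zclosed F -> zclosed G -> Z `<=` F `|` G ->
     Z `<=` F \/ Z `<=` G).

Definition projective_variety n (X : set (proj n)) : Prop :=
  zclosed X /\ irreducible X.

Definition has_dim n (Z : set (proj n)) (d : nat) : Prop :=
  max_chain (fun C => [/\ zclosed C, irreducible C & C `<=` Z]) d.

Definition irreducible_component n (S Z : set (proj n)) : Prop :=
  [/\ zclosed Z, irreducible Z, Z `<=` S
    & forall Z', zclosed Z' -> irreducible Z' -> Z' `<=` S -> Z `<=` Z' ->
        Z' = Z].

Definition has_codim n (Y V : set (proj n)) (c : nat) : Prop :=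
  exists y v, [/\ has_dim Y y, has_dim V v & y = (c + v)%N].

Definition intersect_properly n (Y V W : set (proj n)) : Prop :=
  forall Z, irreducible_component (V `&` W) Z ->
    exists a b, [/\ has_codim Y V a, has_codim Y W b & has_codim Y Z (a + b)].

(* Functions on a subset X are represented by functions on the whole ambient
   space; only their values on X matter. *)
Definition regular_at n (X : set (proj n)) (x : proj n) (f : proj n -> K)
    : Prop :=
  exists U, [/\ zopen U, U x
    & exists d (F G : {mpoly K[n]}), [/\ F \is d.-homog, G \is d.-homog
      & forall y, X y -> U y -> heval G y != 0 /\ f y = heval F y / heval G y]].

Definition is_morphism n m (X : set (proj n)) (Y : set (proj m))
    (phi : proj n -> proj m) : Prop :=
  [/\ forall x, X x -> Y (phi x),
      forall Z, zclosed Z ->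
        exists2 Z', zclosed Z' & X `&` phi @^-1` Z = X `&` Z'
    & forall V f, zopen V -> (forall y, Y y -> V y -> regular_at Y y f) ->
        forall x, X x -> V (phi x) -> regular_at X x (f \o phi)].

Definition eq_near n (X : set (proj n)) (x : proj n) (f g : proj n -> K)
    : Prop :=
  exists U, [/\ zopen U, U x & forall y, X y -> U y -> f y = g y].

Lemma zopenT n : zopen [set: proj n].
Proof.
exists [set 1]; split=> [p ->|]; first by exists 0%N; rewrite dhomog1.
by rewrite setCT eqEsubset; split=> x //= /(_ 1 erefl)/eqP;
  rewrite /heval meval1 oner_eq0.
Qed.

Lemma zopenI n (U V : set (proj n)) : zopen U -> zopen V -> zopen (U `&` V).
Proof.
move=> [S [hS eS]] [T [hT eT]].
exists [set p | exists q r, [/\ S q, T r & p = q * r]]; split.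
  move=> p [q [r [Sq Tr ->]]]; have [d hd] := hS q Sq; have [e he] := hT r Tr.
  by exists (d + e)%N; rewrite dhomogM.
rewrite setCI eS eT eqEsubset; split=> x /=.
  by case=> h p [q [r [Sq Tr ->]]]; rewrite /heval mevalM;
    [rewrite [q.@[_]]h ?mul0r | rewrite [r.@[_]]h ?mulr0].
move=> h; case: (pselect (forall p, S p -> heval p x = 0)) => [|nS].
  by left.
right=> r Tr; have /existsNP[q /not_implyP[Sq /eqP q0]] := nS.
have /eqP : heval (q * r) x = 0 by apply: h; exists q, r.
by rewrite /heval mevalM mulf_eq0 (negPf q0) /= => /eqP.
Qed.

Section LocalRing.
Variables (n : nat) (X : set (proj n)) (x : proj n).

Definition regular_pred : {pred proj n -> K} :=
  fun f => `[< regular_at X x f >].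

Lemma regular_cst (c : K) : regular_at X x (fun=> c).
Proof.
exists setT; split=> //; first exact: zopenT.
exists 0%N, (c *: 1), 1; split=> [||y _ _].
- by rewrite rpredZ // dhomog1.
- by rewrite dhomog1.
- by rewrite /heval mevalZ meval1 mulr1 divr1 oner_eq0.
Qed.

Lemma regular_subring : subring_closed regular_pred.
Proof.
split=> [|f g /asboolP[U [oU Ux [d [F [G [hF hG fE]]]]]]
           /asboolP[V [oV Vx [e [F' [G' [hF' hG' gE]]]]]]
        |f g /asboolP[U [oU Ux [d [F [G [hF hG fE]]]]]]
           /asboolP[V [oV Vx [e [F' [G' [hF' hG' gE]]]]]]];
  apply/asboolP; first exact: regular_cst.
- exists (U `&` V); split=> //; first exact: zopenI.
  exists (d + e)%N, (F * G' - F' * G), (G * G'); split.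
  + by apply: rpredB; [exact: dhomogM | rewrite addnC; exact: dhomogM].
  + exact: dhomogM.
  move=> y Xy [Uy Vy]; have [G0 fy] := fE y Xy Uy.
  have [G'0 gy] := gE y Xy Vy.
  rewrite /heval !(mevalB, mevalM) mulf_neq0 //; split=> //.
  by rewrite -[LHS]/(f y - g y) fy gy -mulNr addf_div // mulNr.
- exists (U `&` V); split=> //; first exact: zopenI.
  exists (d + e)%N, (F * F'), (G * G'); split; rewrite ?dhomogM //.
  move=> y Xy [Uy Vy]; have [G0 fy] := fE y Xy Uy.
  have [G'0 gy] := gE y Xy Vy.
  rewrite /heval !mevalM mulf_neq0 //; split=> //.
  by rewrite -[LHS]/(f y * g y) fy gy mulf_div.
Qed.

HB.instance Definition _ :=
  GRing.isSubringClosed.Build (proj n -> K) regular_pred regular_subring.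

Record regfun := RegFun
  { regfun_val :> proj n -> K; _ : regfun_val \in regular_pred }.

HB.instance Definition _ := [isSub for regfun_val].
HB.instance Definition _ := [Choice of regfun by <:].
HB.instance Definition _ := GRing.SubChoice_isSubComPzRing.Build
  (proj n -> K) regular_pred regfun regular_subring.

Definition germ_eq : rel regfun := fun f g => `[< eq_near X x f g >].

Lemma germ_eq_refl : reflexive germ_eq.
Proof. by move=> f; apply/asboolP; exists setT; split=> //; exact: zopenT. Qed.

Lemma germ_eq_sym : ssrbool.symmetric germ_eq.
Proof.
by move=> f g; apply/asboolP/asboolP => -[U [oU Ux h]]; exists U; split=> // y
  Xy Uy; rewrite h.
Qed.

Lemma germ_eq_trans : transitive germ_eq.
Proof.
move=> g f h /asboolP[U [oU Ux fg]] /asboolP[V [oV Vx gh]]; apply/asboolP.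
exists (U `&` V); split=> // [|y Xy [Uy Vy]]; first exact: zopenI.
by rewrite fg // gh.
Qed.

Canonical germ_equiv := EquivRel germ_eq germ_eq_refl germ_eq_sym germ_eq_trans.

(* The local ring of X at x: germs at x of regular functions on X. *)
Definition local_ring := {eq_quot germ_equiv}.
HB.instance Definition _ := Choice.on local_ring.
HB.instance Definition _ := EqQuotient.on local_ring.

Definition germ (f : regfun) : local_ring := \pi_local_ring f.

Definition germ0 : local_ring := lift_cst local_ring 0.
Definition germ1 : local_ring := lift_cst local_ring 1.
Definition germ_opp := lift_op1 local_ring -%R.
Definition germ_add := lift_op2 local_ring +%R.
Definition germ_mul := lift_op2 local_ring *%R.

Canonical pi_germ0 := PiConst germ0.
Canonical pi_germ1 := PiConst germ1.

Lemma germ_reprP (f : regfun) : germ_eq (repr (germ f)) f.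
Proof. by rewrite -[germ_eq _ _]eqmodE reprK. Qed.

Lemma pi_germ_opp : {morph \pi_local_ring : f / - f >-> germ_opp f}.
Proof.
move=> f; unlock germ_opp; apply/eqP; rewrite eqmodE; apply/asboolP.
have /asboolP[U [oU Ux h]] := germ_reprP f; exists U; split=> // y Xy Uy.
by congr (- _); exact/esym/h.
Qed.
Canonical pi_germ_opp_morph := PiMorph1 pi_germ_opp.

Lemma pi_germ_add : {morph \pi_local_ring : f g / f + g >-> germ_add f g}.
Proof.
move=> f g; unlock germ_add; apply/eqP; rewrite eqmodE; apply/asboolP.
have /asboolP[U [oU Ux h]] := germ_reprP f.
have /asboolP[V [oV Vx k]] := germ_reprP g.
exists (U `&` V); split=> // [|y Xy [Uy Vy]]; first exact: zopenI.
by congr (_ + _); [exact/esym/h | exact/esym/k].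
Qed.
Canonical pi_germ_add_morph := PiMorph2 pi_germ_add.

Lemma pi_germ_mul : {morph \pi_local_ring : f g / f * g >-> germ_mul f g}.
Proof.
move=> f g; unlock germ_mul; apply/eqP; rewrite eqmodE; apply/asboolP.
have /asboolP[U [oU Ux h]] := germ_reprP f.
have /asboolP[V [oV Vx k]] := germ_reprP g.
exists (U `&` V); split=> // [|y Xy [Uy Vy]]; first exact: zopenI.
by congr (_ * _); [exact/esym/h | exact/esym/k].
Qed.
Canonical pi_germ_mul_morph := PiMorph2 pi_germ_mul.

Lemma germ_addA : associative germ_add.
Proof. by move=> a b c; rewrite -[a]reprK -[b]reprK -[c]reprK !piE addrA. Qed.

Lemma germ_addC : commutative germ_add.
Proof. by move=> a b; rewrite -[a]reprK -[b]reprK !piE addrC. Qed.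

Lemma germ_add0 : left_id germ0 germ_add.
Proof. by move=> a; rewrite -[a]reprK !piE add0r. Qed.

Lemma germ_addN : left_inverse germ0 germ_opp germ_add.
Proof. by move=> a; rewrite -[a]reprK !piE addNr. Qed.

HB.instance Definition _ := GRing.isZmodule.Build local_ring
  germ_addA germ_addC germ_add0 germ_addN.

Lemma germ_mulA : associative germ_mul.
Proof. by move=> a b c; rewrite -[a]reprK -[b]reprK -[c]reprK !piE mulrA. Qed.

Lemma germ_mulC : commutative germ_mul.
Proof. by move=> a b; rewrite -[a]reprK -[b]reprK !piE mulrC. Qed.

Lemma germ_mul1 : left_id germ1 germ_mul.
Proof. by move=> a; rewrite -[a]reprK !piE mul1r. Qed.

Lemma germ_mulDl : left_distributive germ_mul germ_add.
Proof. by move=> a b c; rewrite -[a]reprK -[b]reprK -[c]reprK !piE mulrDl. Qed.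

HB.instance Definition _ := GRing.Zmodule_isComPzRing.Build local_ring
  germ_mulA germ_mulC germ_mul1 germ_mulDl.

(* The germs vanishing on V near x. *)
Definition local_ideal (V : set (proj n)) : set local_ring :=
  [set a | exists2 f : regfun, a = germ f & eq_near V x f (fun=> 0)].

End LocalRing.

Arguments local_ideal [n] X x V.

Definition nonsingular n (X : set (proj n)) : Prop :=
  forall x, X x -> regular_local_ring (local_ring X x).

Definition intersection_multiplicity n (Y V W : set (proj n)) (x : proj n)
    (m : int) : Prop :=
  serre_multiplicity (local_ideal Y x V) (local_ideal Y x W) m.

Lemma segre_subproof n m (x : proj n) (y : proj m) :
  \dim <[mxvec ((coords x)^T *m coords y)]> == 1%N.
Proof.
have nz k (z : proj k) : coords z != 0.
  by rewrite /coords vpick0 -dimv_eq0 (eqP (svalP z)).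
rewrite dim_vline mxvec_eq0.
have /rV0Pn[i xi] := nz _ x; have /rV0Pn[j yj] := nz _ y.
suff -> : (coords x)^T *m coords y != 0 by [].
apply/eqP => /matrixP/(_ i j)/eqP.
by rewrite !mxE big_ord1 !mxE mulf_eq0 (negPf xi) (negPf yj).
Qed.

(* The Segre embedding (x, y) |-> (x_i y_j)_(i, j). *)
Definition segre n m (x : proj n) (y : proj m) : proj (n * m) :=
  exist _ <[mxvec ((coords x)^T *m coords y)]>%VS (segre_subproof x y).

Definition product n m (X : set (proj n)) (Y : set (proj m))
    : set (proj (n * m)) :=
  [set z | exists x y, [/\ X x, Y y & z = segre x y]].

Definition graph n m (X : set (proj n)) (phi : proj n -> proj m)
    : set (proj (n * m)) :=
  [set segre x (phi x) | x in X].

Definition diagonal n (X : set (proj n)) : set (proj (n * n)) :=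
  [set segre x x | x in X].

Definition nondegenerate_map n (X : set (proj n))
    (phi : proj n -> proj n) : Prop :=
  intersect_properly (product X X) (graph X phi) (diagonal X).

(* a_P(phi, k) = m *)
Definition fixed_point_multiplicity n (X : set (proj n))
    (phi : proj n -> proj n) (P : proj n) (k : nat) (m : int) : Prop :=
  intersection_multiplicity (product X X) (graph X (iter k phi)) (diagonal X)
    (segre P P) m.

End ProjectiveSpace.

(* Main.v *)
Require Import Defs.
From HB Require Import structures.
From mathcomp Require Import all_boot all_order all_algebra.
From mathcomp Require Import boolp classical_sets functions.
From mathcomp Require Import mpoly ring.

Set Implicit Arguments.
Unset Strict Implicit.
Unset Printing Implicit Defensive.

Import GRing.Theory Num.Theory.
Local Open Scope classical_set_scope.
Local Open Scope ring_scope.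

(** Let B and A be the local rings of X at P and of X x X at (P, P), let
    x_1, ..., x_d be parameters of B, and put t_i = 1 (x) x_i - phi^n* x_i (x) 1.
    The t_i generate the ideal of the graph of phi^n and, together with the
    x_i (x) 1, the maximal ideal of A.  As A is a localization of B (x) B and the x_i
    form a regular sequence, so do the x_i (x) 1 followed by the t_i; by Nakayama's
    lemma the Koszul complex of the t_i alone is then acyclic, and it resolves A / (t).
    Modulo the diagonal it becomes the Koszul complex of the displacements
    x_i - phi^n* x_i over B, whose homology is finite-dimensional because P is an
    isolated fixed point of phi^n.

    Boundedness is the argument of Shub and Sullivan.  If D is the linear part of
    phi* at P, then modulo m I the displacements of phi^(kq) are obtained from those
    of phi^k, which generate I, by applying sum_(j < q) D^(kj).  For k = gcd(n, L), where
    L kills all the eigenvalues of D that are roots of unity, and q = n / k, this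
    matrix is invertible as soon as n is nonzero in K.  Hence the graph ideal of
    phi^n has generators that agree modulo the diagonal with those of the graph
    ideal of phi^k, and the multiplicity depends only on the divisor k of L.

    The regularity of x_1, ..., x_d is derived from the dimension as follows: if some
    nonzero form of degree s in the x_i had order > s, then B / m^N would have length
    O(N^(d-1)), whereas a chain of d + 1 primes and the Artin-Rees lemma yield
    binomial(n, d) independent elements modulo m^(qn+1) for a fixed q. *)

(** * Ideals and submodules *)

(** Serre's formula is stated with some free resolution, so that a bound needs, for each n, one
    resolution whose Tor lengths can be controlled. A Koszul complex is one if its elements form a
    regular sequence; but nonsingularity only says that a basis of the cotangent space has as many
    elements as the Krull dimension, hence the detour through growth of lengths. Nothing is assumed
    about the local ring A of X x X: regular sequences in A are obtained from B, by comparing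
    coefficients after clearing denominators, and Nakayama's lemma, stated without quotient modules,
    does the work of permuting a regular sequence. Lengths are bounded by dimensions over K, which
    is the residue field. Finally, properness of an intersection is a global statement on dimensions
    of closed sets, whereas finiteness of the homology is local; they are linked by turning a prime
    of B into an irreducible closed set through P, which takes the Nullstellensatz. *)

Section Spans.
Variables (A : comPzRingType) (V : lmodType A).

(** Over [A^o] this is convertible to [is_ideal] and over row vectors to [is_submodule], so that the
    same lemmas serve for both. *)
Definition submod (M : set V) : Prop :=
  [/\ M 0, (forall u v, M u -> M v -> M (u + v)) & (forall c u, M u -> M (c *: u))].

(** Generators are sequences on all of [nat] cut off at [k], so that initial segments and
    concatenations need no casts. *)
Definition spn (N : set V) (t : nat -> V) (k : nat) : set V :=
  [set v | exists c : nat -> A, exists2 n, N n & v = \sum_(i < k) c i *: t i + n].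

Lemma submodN (M : set V) u : submod M -> M u -> M (- u).
Proof. by case=> _ _ h /(h (-1)); rewrite scaleN1r. Qed.

Lemma submodB (M : set V) u v : submod M -> M u -> M v -> M (u - v).
Proof. by move=> h Mu Mv; have [_ hD _] := h; apply: hD => //; exact: submodN. Qed.

Lemma submod_sum (M : set V) (I : Type) (r : seq I) (P : pred I) (F : I -> V) :
  submod M -> (forall i, P i -> M (F i)) -> M (\sum_(i <- r | P i) F i).
Proof. by case=> h0 hD _ h; elim/big_ind: _. Qed.

Lemma submod0 : submod [set 0].
Proof. by split=> [//|u v -> ->|c u ->]; rewrite ?addr0 ?scaler0. Qed.

Lemma spn_submod N t k : submod N -> submod (spn N t k).
Proof.
move=> [N0 ND NZ]; split.
- by exists (fun=> 0), 0; rewrite // addr0 big1 // => i _; rewrite scale0r.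
- move=> u v [c [n Nn ->]] [d [m Nm ->]]; exists (fun i => c i + d i), (n + m); first exact: ND.
  by under [in RHS]eq_bigr do rewrite scalerDl; rewrite big_split /= addrACA.
- move=> a u [c [n Nn ->]]; exists (fun i => a * c i), (a *: n); first exact: NZ.
  by rewrite scalerDr scaler_sumr; under [in RHS]eq_bigr do rewrite -scalerA.
Qed.

Lemma spn_base N t k : N `<=` spn N t k.
Proof.
move=> n Nn; exists (fun=> 0), n => //.
by rewrite big1 ?add0r // => i _; rewrite scale0r.
Qed.

Lemma spn_gen (N : set V) t k i : N 0 -> (i < k)%N -> spn N t k (t i).
Proof.
move=> N0 ik; exists (fun j => (j == i)%:R), 0; rewrite // addr0.
rewrite (bigD1 (Ordinal ik)) //= eqxx scale1r big1 ?addr0 // => j.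
by rewrite -val_eqE /= => /negbTE ->; rewrite scale0r.
Qed.

Lemma spn_min (N M : set V) t k :
  submod M -> N `<=` M -> (forall i, (i < k)%N -> M (t i)) -> spn N t k `<=` M.
Proof.
move=> hM NM ht v [c [n Nn ->]]; have [_ MD MZ] := hM.
by apply: MD (NM _ Nn); apply: submod_sum => // i _; apply: MZ; apply: ht.
Qed.

Lemma spn0 N t : spn N t 0 `<=` N.
Proof. by move=> v [c [n Nn ->]]; rewrite big_ord0 add0r. Qed.

Lemma spnS N t k v :
  spn N t k.+1 v <-> exists c, spn N t k (v - c *: t k).
Proof.
split=> [[c [n Nn ->]]|[a [c [n Nn e]]]].
  exists (c k); exists c, n => //.
  by rewrite big_ord_recr /= addrAC addrK.
exists (fun i => if i == k then a else c i), n => //.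
rewrite big_ord_recr /= eqxx -[v](subrK (a *: t k)) e addrAC; congr (_ + _ + _).
by apply: eq_bigr => i _; rewrite ltn_eqF.
Qed.

Lemma spn_cat N t1 k1 t2 k2 :
  exists t, (forall i, (i < k1 + k2)%N ->
      (exists2 j, (j < k1)%N & t i = t1 j) \/ (exists2 j, (j < k2)%N & t i = t2 j)) /\
    spn (spn N t1 k1) t2 k2 `<=` spn N t (k1 + k2).
Proof.
exists (fun i => if (i < k1)%N then t1 i else t2 (i - k1)%N); split.
  move=> i ik; case: ifP => [h|/negbT]; first by left; exists i.
  by rewrite -leqNgt => h; right; exists (i - k1)%N => //; rewrite ltn_subLR.
move=> v [c [u [d [n Nn ->]] ->]].
exists (fun i => if (i < k1)%N then d i else c (i - k1)%N), n => //.
rewrite big_split_ord /= addrA [X in X + _]addrC; congr (_ + _ + _).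
  by apply: eq_bigr => i _; rewrite ltn_ord.
by apply: eq_bigr => i _; rewrite ltnNge leq_addr /= addKn.
Qed.

Definition fg_mod (M N : set V) : Prop :=
  exists k t, (forall i, (i < k)%N -> M (t i)) /\ M `<=` spn N t k.

Lemma fg_mod_trans (M N L : set V) : N `<=` M -> fg_mod M N -> fg_mod N L -> fg_mod M L.
Proof.
move=> NM [k [t [ht Mt]]] [l [u [hu Nu]]].
have [w [hw wP]] := spn_cat L u l t k.
exists (l + k)%N, w; split.
  by move=> i /hw[[j jl ->]|[j jk ->]]; [apply: NM; exact: hu|exact: ht].
move=> v /Mt[c [n /Nu Nn ->]]; apply: wP; by exists c, n.
Qed.

End Spans.

Section Ideals.
Variable A : comPzRingType.
Implicit Types I E : set A.

Definition idl (Q : set A) (z : nat -> A) (k : nat) : set A :=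
  [set a | exists c : nat -> A, exists2 q, Q q & a = \sum_(i < k) c i * z i + q].

Lemma idealB I a b : is_ideal I -> I a -> I b -> I (a - b).
Proof. by move=> h; exact: (@submodB A A^o). Qed.

Lemma idealMr I a c : is_ideal I -> I a -> I (a * c).
Proof. by move=> [_ _ h] /(h c); rewrite mulrC. Qed.

Lemma ideal_sum I (T : Type) (r : seq T) (P : pred T) (F : T -> A) :
  is_ideal I -> (forall i, P i -> I (F i)) -> I (\sum_(i <- r | P i) F i).
Proof. exact: (@submod_sum A A^o). Qed.

Lemma ideal0 : is_ideal [set (0 : A)].
Proof. exact: (@submod0 A A^o). Qed.

Lemma idl_ideal Q z k : is_ideal Q -> is_ideal (idl Q z k).
Proof. exact: (@spn_submod A A^o). Qed.

Lemma idl_base Q z k : Q `<=` idl Q z k.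
Proof. exact: (@spn_base A A^o). Qed.

Lemma idl_gen (Q : set A) z k i : Q 0 -> (i < k)%N -> idl Q z k (z i).
Proof. exact: (@spn_gen A A^o). Qed.

Lemma idl_min Q I z k : is_ideal I -> Q `<=` I -> (forall i, (i < k)%N -> I (z i)) ->
  idl Q z k `<=` I.
Proof. exact: (@spn_min A A^o). Qed.

Lemma idlS Q z k a : idl Q z k.+1 a <-> exists c, idl Q z k (a - c * z k).
Proof. exact: (@spnS A A^o). Qed.

Lemma noetherian_fg I : noetherian A -> is_ideal I ->
  exists k z, (forall i, (i < k)%N -> I (z i)) /\ I `<=` idl [set 0] z k.
Proof.
move=> nA hI; have [k [t It]] := nA _ hI.
exists k, (fun i => if insub i is Some j then t j else 0); split.
  move=> i ik; rewrite insubT It; exists (fun j => (j == Ordinal ik)%:R).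
  rewrite (bigD1 (Ordinal ik)) //= eqxx mul1r big1 ?addr0 // => j /negbTE ->.
  by rewrite mul0r.
move=> a; rewrite {1}It => -[c ->].
exists (fun i => if insub i is Some j then c j else 0), 0 => //.
by rewrite addr0; apply: eq_bigr => i _; rewrite valK.
Qed.

Lemma fg_noetherian :
  (forall I, is_ideal I -> exists k z,
     (forall i, (i < k)%N -> I (z i)) /\ I `<=` idl [set 0] z k) -> noetherian A.
Proof.
move=> h I hI; have [k [z [hz Iz]]] := h _ hI; exists k, (fun i => z i).
apply/seteqP; split=> a /=; first by move=> /Iz[c [q -> ->]]; exists c; rewrite addr0.
move=> [c ->]; apply: ideal_sum => // i _; have [_ _ hM] := hI.
by apply: hM; apply: hz.
Qed.

(** Without a maximal member a choice function would enlarge every member strictly; the union of the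
    resulting chain is finitely generated, hence reached at a finite stage. *)
Lemma noetherian_max (F : set (set A)) : noetherian A -> F `<=` @is_ideal A ->
  F !=set0 -> exists2 E, F E & forall E', F E' -> E `<=` E' -> E' `<=` E.
Proof.
move=> nA hF [E0 FE0]; apply: contrapT => nmax.
have /choice[f hf] : forall E, exists E', F E -> [/\ F E', E `<=` E' & ~ (E' `<=` E)].
  move=> E; case: (pselect (F E)) => [FE|]; last by exists E.
  apply: contrapT => /forallNP h; apply: nmax; exists E => // E' FE' sub.
  by apply: contrapT => ns; apply: (h E').
pose C n := iter n f E0.
have FC n : F (C n) by elim: n => //= n ih; case: (hf _ ih).
have CS n : C n `<=` C n.+1 by case: (hf _ (FC n)).
have Cmono n m : (n <= m)%N -> C n `<=` C m.
  move=> nm; rewrite -(subnK nm); elim: (m - n)%N => // k ih.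
  by move=> a /ih; rewrite addSn; exact: CS.
pose U := [set a | exists n, C n a].
have hU : is_ideal U.
  split; first by exists 0%N; case: (hF _ FE0).
    move=> a b [n na] [m mb]; exists (maxn n m); have [_ hD _] := hF _ (FC (maxn n m)).
    by apply: hD; [exact: (Cmono n) (leq_maxl _ _) _ na|exact: (Cmono m) (leq_maxr _ _) _ mb].
  by move=> c a [n na]; exists n; have [_ _ hM] := hF _ (FC n); exact: hM.
have [k [z [hz Uz]]] := noetherian_fg nA hU.
have [n hn] : exists n, forall i, (i < k)%N -> C n (z i).
  elim: k hz {Uz} => [|k ih] hz; first by exists 0%N.
  have [n hn] := ih (fun i ik => hz i (ltnW ik)); have [m hm] := hz k (leqnn _).
  exists (maxn n m) => i; rewrite ltnS leq_eqVlt => /orP[/eqP ->|ik].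
    exact: Cmono (leq_maxr _ _) _ hm.
  by apply: Cmono (leq_maxl _ _) _ (hn _ ik).
have [_ _] := hf _ (FC n); apply => a ha.
have /Uz : U a by exists n.+1.
have hCn := hF _ (FC n); apply: (idl_min hCn _ hn).
by move=> _ ->; case: hCn.
Qed.

(** [H] need not be an ideal, and the generators come from [H] itself, which matters when [H]
    consists of forms. An ideal maximal among those generated by finitely many elements of [H]
    absorbs every further one. *)
Lemma noetherian_gens (H : set A) : noetherian A ->
  exists k z, (forall i, (i < k)%N -> H (z i)) /\ H `<=` idl [set 0] z k.
Proof.
move=> nA; pose F : set (set A) := [set E | exists k z, (forall i, (i < k)%N -> H (z i)) /\
  E = idl [set 0] z k].
have [||_ [k [z [hz ->]]] hmax] := @noetherian_max F nA.
- by move=> _ [k [z [_ ->]]]; apply: idl_ideal; exact: ideal0.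
- by exists (idl [set 0] (fun=> 0) 0), 0%N, (fun=> 0).
exists k, z; split=> // h Hh.
pose z' i := if i == k then h else z i.
have zz' i : (i < k)%N -> z' i = z i by move=> ik; rewrite /z' ltn_eqF.
apply: (hmax (idl [set 0] z' k.+1)).
- exists k.+1, z'; split=> // i; rewrite ltnS leq_eqVlt => /orP[/eqP ->|ik].
    by rewrite /z' eqxx.
  by rewrite zz' //; exact: hz.
- move=> a [c [q q0 ->]]; apply/idlS; exists 0; exists c, q => //.
  by rewrite mul0r subr0; congr (_ + _); apply: eq_bigr => i _; rewrite zz'.
- have := @idl_gen [set 0] z' k.+1 k erefl (leqnn _).
  by rewrite /z' eqxx.
Qed.

(** Filter [M] by the number of leading zero coordinates: in each layer the first possibly nonzero
    coordinates form an ideal, and lifts of its generators suffice modulo the next layer. *)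
Lemma noetherian_rV k (M : set 'rV[A]_k) : noetherian A -> submod M -> fg_mod M [set 0].
Proof.
move=> nA hM; pose Mj j := [set v : 'rV[A]_k | M v /\ forall i : 'I_k, (i < j)%N -> v 0 i = 0].
have hMj j : submod (Mj j).
  have [M0 MD MZ] := hM; split.
  - by split=> // i _; rewrite mxE.
  - move=> u v [Mu u0] [Mv v0]; split; first exact: MD.
    by move=> i ij; rewrite mxE u0 // v0 // addr0.
  - by move=> c u [Mu u0]; split; [exact: MZ|move=> i ij; rewrite mxE u0 // mulr0].
suff h : forall j, (j <= k)%N -> fg_mod (Mj (k - j)%N) [set 0].
  have [e [t [ht Mt]]] := h k (leqnn _); exists e, t; split=> [i /ht[]//|v Mv].
  by apply: Mt; rewrite subnn.
elim=> [_|j ih jk].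
  exists 0%N, (fun=> 0); split=> // v [_ v0]; suff -> : v = 0 by apply: spn_base.
  by apply/rowP => i; rewrite v0 ?mxE // subn0 ltn_ord.
have lj : (k - j.+1 < k)%N by rewrite ltn_subrL /=; apply: leq_trans jk.
pose i0 := Ordinal lj; set l := (k - j.+1)%N.
have lS : (k - j = l.+1)%N by rewrite /l -subSn // subSS.
apply: fg_mod_trans (ih (ltnW jk)).
  by move=> v [Mv h]; split=> // i il; apply: h; rewrite lS ltnW.
pose I := [set a | exists2 v, Mj l v & v 0 i0 = a].
have hI : is_ideal I.
  have [M0 MD MZ] := hMj l; split.
  - by exists 0; rewrite ?mxE.
  - by move=> _ _ [u Mu <-] [v Mv <-]; exists (u + v); [exact: MD|rewrite mxE].
  - by move=> c _ [u Mu <-]; exists (c *: u); [exact: MZ|rewrite mxE].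
have [e [z [hz Iz]]] := noetherian_fg nA hI.
have /choice[t ht] : forall i, exists t, (i < e)%N -> Mj l t /\ t 0 i0 = z i.
  move=> i; case: (boolP (i < e)%N) => [/hz[t Mt tz]|_]; first by exists t.
  by exists 0.
exists e, t; split=> [i /ht[]//|v Mv].
have /Iz[c [q -> vz]] : I (v 0 i0) by exists v.
exists c, (v - \sum_(i < e) c i *: t i); last by rewrite addrC subrK.
have : Mj l (v - \sum_(i < e) c i *: t i).
  apply: submodB => //; apply: submod_sum => // i _; have [_ _ MZ] := hMj l; apply: MZ.
  by case: (ht i).
move=> [Mw w0]; split=> // i; rewrite lS ltnS leq_eqVlt => /orP[/eqP il|]; last exact: w0.
have -> : i = i0 by apply: val_inj.
rewrite !mxE summxE vz addr0; apply/eqP; rewrite subr_eq0; apply/eqP/eq_bigr => l' _.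
by rewrite mxE; have [//|_ ->] := ht l'.
Qed.

End Ideals.

(** * Nakayama's lemma *)

Section Nakayama.
Variables (A : comPzRingType) (m : set A).
Hypotheses (hm : is_ideal m) (mjac : forall a, m a -> exists b, (1 - a) * b = 1).

(* The last hypothesis says that Z is contained in B + m Z. *)
Lemma nakayama (V : lmodType A) (B Z : set V) : submod B -> fg_mod Z [set 0] ->
  (forall N, submod N -> B `<=` N -> (forall x u, m x -> Z u -> N (x *: u)) -> Z `<=` N) ->
  Z `<=` B.
Proof.
move=> hB [k [t [ht Zt0]]] H; have [B0 BD BZ] := hB.
have Zt : Z `<=` spn B t k.
  by move=> v /Zt0[c [_ -> ->]]; exists c, 0.
elim: k ht Zt {Zt0} => [_ Zt|k ih ht Zt]; first by move=> v /Zt /spn0.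
apply: ih => [i ik|]; first by apply: ht; exact: ltnW.
have [S0 SD SZ] := @spn_submod _ _ B t k hB.
(* With [t k] in [N], some (1 - mu) t_k lies in the span of the other generators, and 1 - mu is
   invertible, so that the last generator is redundant. *)
pose N : set V := [set w | exists2 mu, m mu & spn B t k (w - mu *: t k)].
have [m0 mD mM] := hm.
have tN : N (t k).
  apply: (H N) => //; last exact: ht.
  - split; first by exists 0; rewrite // scale0r subr0.
    + move=> u v [a ma ua] [b mb vb]; exists (a + b); first exact: mD.
      by rewrite scalerDl opprD addrACA; exact: SD.
    + move=> c u [a ma ua]; exists (c * a); first exact: mM.
      by rewrite -scalerA -scalerBr; exact: SZ.
  - by move=> b Bb; exists 0; rewrite // scale0r subr0; exact: spn_base.
  - move=> x u mx /Zt/spnS[c hc]; exists (x * c); first by rewrite mulrC; exact: mM.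
    by rewrite -scalerA -scalerBr; exact: SZ.
have [mu mmu tk] := tN; have [b hb] := mjac mmu.
have {tk}tk : spn B t k (t k).
  have /(SZ b) := tk; rewrite -[X in X - _]scale1r -scalerBl scalerA mulrC.
  by rewrite hb scale1r.
move=> v /Zt/spnS[c hc]; rewrite -[v](subrK (c *: t k)); apply: SD => //.
exact: SZ.
Qed.

Lemma nakayama_ideal (B Z : set A) : noetherian A -> is_ideal B -> is_ideal Z ->
  (forall N, is_ideal N -> B `<=` N -> (forall x u, m x -> Z u -> N (x * u)) -> Z `<=` N) ->
  Z `<=` B.
Proof.
move=> nA hB hZ H; apply: (@nakayama A^o) => //.
by have [k [z hz]] := noetherian_fg nA hZ; exists k, z.
Qed.

End Nakayama.

Lemma rmorph_ker_ideal (R S : comPzRingType) (f : {rmorphism R -> S}) : is_ideal [set a | f a = 0].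
Proof.
split=> [|a b ha hb|c a ha] /=; first exact: rmorph0.
  by rewrite rmorphD ha hb addr0.
by rewrite rmorphM ha mulr0.
Qed.

(** The matrix of coordinates has more rows than columns, hence a nonzero left kernel. This replaces
    the notion of dimension over [K]. *)
Lemma overfull_dependent (K : fieldType) (A : comPzRingType) (kap : {rmorphism K -> A})
    (V : lmodType A) (T : finType) (B : set V) (w : T -> V) l (u : 'I_l -> V) :
  submod B -> (#|T| < l)%N ->
  (forall i, exists c : T -> K, B (u i - \sum_t kap (c t) *: w t)) ->
  exists2 e : 'rV[K]_l, e != 0 & B (\sum_i kap (e 0 i) *: u i).
Proof.
move=> hB lt /choice[c hc].
pose M := \matrix_(i < l, j < #|T|) c i (enum_val j).
have : kermx M != 0.
  rewrite kermx_eq0 /row_free; apply/eqP => rM.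
  by have := rank_leq_col M; rewrite rM leqNgt lt.
move=> /rowV0Pn[e /sub_kermxP eM e0]; exists e => //.
suff -> : \sum_i kap (e 0 i) *: u i = \sum_i kap (e 0 i) *: (u i - \sum_t kap (c i t) *: w t).
  by apply: submod_sum => // i _; have [_ _ BZ] := hB; apply: BZ; exact: hc.
under [RHS]eq_bigr do rewrite scalerBr scaler_sumr.
rewrite sumrB exchange_big /= [X in _ - X]big1 ?subr0 // => t _.
under eq_bigr do rewrite scalerA -rmorphM.
have u0 : \sum_(i < l) e 0 i * c i t = 0.
  move/rowP: eM => /(_ (enum_rank t)); rewrite !mxE => h; apply: etrans h.
  by apply: eq_bigr => j _; rewrite mxE enum_rankK.
by rewrite -scaler_suml -rmorph_sum u0 rmorph0 scale0r.
Qed.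

(** * The Hilbert basis theorem and the Artin-Rees lemma *)

Section HilbertBasis.
Variables (R S : comNzRingType) (f : {rmorphism R -> S}) (z : S).

Let ev (p : {poly R}) : S := (map_poly f p).[z].

(** Stated for any ring generated by one element over the image of [R], so that it applies to
    polynomials in n + 1 variables without an isomorphism of rings. As usual, leading coefficients
    lower the degree; below the bound [N] the polynomials are row vectors and [noetherian_rV]
    applies. *)
Lemma noetherian_poly_image :
  noetherian R -> (forall s, exists p : {poly R}, s = (map_poly f p).[z]) -> noetherian S.
Proof.
move=> nR surj; apply: fg_noetherian => I hI; have [I0 ID IM] := hI.
have evD p q : ev (p + q) = ev p + ev q by rewrite /ev rmorphD hornerD.
have evM p q : ev (p * q) = ev p * ev q by rewrite /ev rmorphM hornerM.
have evC c : ev c%:P = f c by rewrite /ev map_polyC hornerC.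
have evZ c p : ev (c *: p) = f c * ev p by rewrite -mul_polyC evM evC.
have ev0 : ev 0 = 0 by rewrite /ev rmorph0 horner0.
have evS (T : Type) (r : seq T) (F : T -> {poly R}) :
    ev (\sum_(i <- r) F i) = \sum_(i <- r) ev (F i).
  exact: (big_morph ev evD ev0).
pose L := [set r | exists n (p : {poly R}), [/\ (size p <= n.+1)%N, p`_n = r & I (ev p)]].
have [k [y [hy Ly]]] := noetherian_gens L nR.
have /choice[g hg] : forall i, exists np : nat * {poly R}, (i < k)%N ->
    [/\ (size np.2 <= np.1.+1)%N, np.2`_np.1 = y i & I (ev np.2)].
  move=> i; case: (boolP (i < k)%N) => [/hy[n [p h]]|_]; first by exists (n, p).
  by exists (0%N, 0).
pose N := (\max_(i < k) (g i).1)%N.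
pose M := [set v : 'rV[R]_N | I (ev (rVpoly v))].
have hM : submod M.
  split.
  - by rewrite /M /= linear0 ev0.
  - by move=> u v Mu Mv; rewrite /M /= linearD evD; exact: ID.
  - by move=> c u Mu; rewrite /M /= linearZ evZ; exact: IM.
have [e [t [ht Mt]]] := noetherian_rV nR hM.
pose w i := if (i < k)%N then ev (g i).2 else ev (rVpoly (t (i - k)%N)).
have hw i : (i < k + e)%N -> I (w i).
  rewrite /w; case: ifP => [ik _|/negbT]; first by case: (hg i ik).
  by rewrite -leqNgt => ki ie; apply: ht; rewrite ltn_subLR.
exists (k + e)%N, w; split=> // s Is.
have hE := @idl_ideal _ [set 0] w (k + e) (@ideal0 S); set E := idl _ _ _ in hE *.
have [E0 ED EM] := hE.
have Eg i : (i < k)%N -> E (ev (g i).2).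
  by move=> ik; have := @idl_gen _ [set 0] w (k + e) i erefl (ltn_addr _ ik); rewrite /w ik.
have Et i : (i < e)%N -> E (ev (rVpoly (t i))).
  move=> ie; have := @idl_gen _ [set 0] w (k + e) (k + i) erefl.
  by rewrite ltn_add2l /w [(k + i < k)%N]ltnNge leq_addr addKn; apply.
have [p ps] := surj s; move: Is; rewrite {}ps -/(ev p) {s}.
elim: (size p) {-2}p (leqnn (size p)) => [|n ih] {}p.
  by rewrite size_poly_leq0 => /eqP -> _; rewrite ev0.
move=> sp Ip; case: (leqP (size p) N) => [pN|Np].
  have /Mt : M (poly_rV p) by rewrite /M /= poly_rV_K.
  move=> [c [_ -> /(congr1 (ev \o rVpoly))]] /=; rewrite poly_rV_K // => ->.
  rewrite addr0 linear_sum evS; apply: ideal_sum => // i _.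
  by rewrite linearZ evZ; apply: EM; apply: Et.
have Nn : (N <= n)%N by rewrite -ltnS; apply: leq_trans sp.
have /Ly[c [_ -> pn]] : L p`_n by exists n, p.
pose q := \sum_(i < k) c i *: ('X^(n - (g i).1) * (g i).2).
have gn (i : 'I_k) : ((g i).1 <= n)%N.
  by apply: leq_trans Nn; rewrite /N; exact: (leq_bigmax i).
have Eq : E (ev q).
  rewrite evS; apply: ideal_sum => // i _; rewrite evZ evM mulrA; apply: (EM).
  exact: Eg.
have EI : E `<=` I by apply: idl_min => // _ ->.
rewrite -[p](subrK q) evD; apply: ED => //; apply: ih.
  apply/leq_sizeP => j; rewrite leq_eqVlt coefB => /orP[/eqP <-|nj].
    rewrite pn addr0 coef_sum; apply/eqP; rewrite subr_eq0; apply/eqP/eq_bigr => i _.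
    by rewrite coefZ coefXnM ltnNge leq_subr /= subKn //; have [_ ->] := hg i (ltn_ord i).
  rewrite (leq_sizeP _ _ sp) // coef_sum sub0r big1 ?oppr0 // => i _.
  rewrite coefZ coefXnM; case: ltnP => _; first by rewrite mulr0.
  have [+ _ _] := hg i (ltn_ord i) => /leq_sizeP ->; first by rewrite mulr0.
  by rewrite ltn_subRL subnK.
rewrite evD -scaleN1r evZ; apply: ID => //; apply: IM; exact: EI.
Qed.

End HilbertBasis.

Lemma mpoly_as_poly n (R : comNzRingType) (q : {mpoly R[n.+1]}) :
  exists p : {poly {mpoly R[n]}}, q = (map_poly (@mwiden n R) p).['X_ord_max].
Proof.
pose ev p := (map_poly (@mwiden n R) p).['X_ord_max].
have evD p r : ev (p + r) = ev p + ev r by rewrite /ev rmorphD hornerD.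
have evM p r : ev (p * r) = ev p * ev r by rewrite /ev rmorphM hornerM.
have evC c : ev c%:P = mwiden c by rewrite /ev map_polyC hornerC.
elim/mpolyind: q => [|c m q _ _ [p ->]].
  by exists 0; rewrite rmorph0 horner0.
have [r hr] : exists r, ev r = 'X_[m].
  rewrite mpolyXE_id; elim/big_ind: _ => [|_ _ [r <-] [s <-]|i _].
  - by exists 1; rewrite /ev rmorph1 hornerC.
  - by exists (r * s); rewrite evM.
  have [r hr] : exists r, ev r = 'X_i.
    case: (unliftP ord_max i) => [j ->|->].
      exists ('X_j)%:P; rewrite evC mwidenX mnmwiden1; congr ('X_[U_(_)]).
      by apply: val_inj; rewrite /= /bump leqNgt ltn_ord.
    by exists 'X; rewrite /ev map_polyX hornerX.
  exists (r ^+ m i); elim: (m i) => [|k ih]; first by rewrite /ev rmorph1 hornerC.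
  by rewrite !exprS evM hr ih.
exists ((c%:MP)%:P * r + p); rewrite -[RHS]/(ev _) evD evM evC hr mwidenC.
by rewrite mul_mpolyC.
Qed.

Lemma noetherian_mpoly n (R : comNzRingType) : noetherian R -> noetherian {mpoly R[n]}.
Proof.
move=> nR; elim: n => [|n ih].
  apply: (@noetherian_poly_image _ _ (@mpolyC 0 R) 0 nR) => s.
  exists (s@_0)%:P; rewrite map_polyC hornerC; exact: nvar0_mpolyC.
exact: (@noetherian_poly_image _ _ (@mwiden n R) 'X_ord_max ih (@mpoly_as_poly n R)).
Qed.

Section PowersOfIdeal.
Variables (R : comNzRingType) (x : nat -> R) (d : nat).

Definition mev (F : {mpoly R[d]}) : R := F.@[fun i => x i].

(** The [s]-th power of the ideal generated by [x 0], ..., [x d.-1]. *)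
Fixpoint mpow (s : nat) : set R :=
  if s is s'.+1 then
    [set b | exists2 a : nat -> R, (forall i, (i < d)%N -> mpow s' (a i))
                                 & b = \sum_(i < d) x i * a i]
  else setT.

Lemma mpow_ideal s : is_ideal (mpow s).
Proof.
elim: s => [|s [h0 hD hM]] //=; split.
- by exists (fun=> 0) => //; rewrite big1 // => i _; rewrite mulr0.
- move=> _ _ [a ha ->] [b hb ->]; exists (fun i => a i + b i); first by move=> i ik; apply: hD; auto.
  by under [in RHS]eq_bigr do rewrite mulrDr; rewrite big_split.
- move=> c _ [a ha ->]; exists (fun i => c * a i); first by move=> i ik; apply: hM; auto.
  by rewrite mulr_sumr; apply: eq_bigr => i _; rewrite mulrCA.
Qed.

Lemma mpowS s : mpow s.+1 `<=` mpow s.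
Proof.
elim: s => [|s ih] b //= [a ha ->]; exists a => // i ik; apply: ih; exact: ha.
Qed.

Lemma mpow_le s t : (s <= t)%N -> mpow t `<=` mpow s.
Proof.
move=> st; rewrite -(subnK st); elim: (t - s)%N => // k ih b.
by rewrite addSn => /mpowS/ih.
Qed.

Lemma mpowM s t a b : mpow s a -> mpow t b -> mpow (s + t) (a * b).
Proof.
elim: s a => [|s ih] a; first by move=> _ hb; case: (mpow_ideal t) => _ _; apply.
move=> [c hc ->] hb; exists (fun i => c i * b); first by move=> i /hc h; exact: ih.
by rewrite mulr_suml; apply: eq_bigr => i _; rewrite mulrA.
Qed.

Lemma mpow1 i : (i < d)%N -> mpow 1 (x i).
Proof.
move=> id; exists (fun j => (j == i)%:R) => //.
rewrite (bigD1 (Ordinal id)) //= eqxx mulr1 big1 ?addr0 // => j.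
by rewrite -val_eqE /= => /negbTE ->; rewrite mulr0.
Qed.

Lemma mpow_monom (m : 'X_{1..d}) : mpow (mdeg m) (\prod_(i < d) x i ^+ m i).
Proof.
rewrite mdegE; elim/big_rec2: _ => // i a b _ h; apply: mpowM => //.
elim: (m i) => // k ih; rewrite exprS -add1n; apply: mpowM => //; exact: mpow1.
Qed.

Lemma mpow_mev s (F : {mpoly R[d]}) : F \is s.-homog -> mpow s (mev F).
Proof.
move=> /dhomogP hF; rewrite /mev mevalE big_seq; apply: ideal_sum; first exact: mpow_ideal.
move=> m /hF hm; case: (mpow_ideal s) => _ _; apply; rewrite -hm; exact: mpow_monom.
Qed.

Lemma mevD F G : mev (F + G) = mev F + mev G. Proof. exact: mevalD. Qed.
Lemma mevM F G : mev (F * G) = mev F * mev G. Proof. exact: mevalM. Qed.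

Lemma mev_sum (T : Type) (r : seq T) (F : T -> {mpoly R[d]}) :
  mev (\sum_(i <- r) F i) = \sum_(i <- r) mev (F i).
Proof. by apply: (big_morph mev mevD); rewrite /mev meval0. Qed.

Lemma mpow_form s b : mpow s b -> exists2 F : {mpoly R[d]}, F \is s.-homog & mev F = b.
Proof.
elim: s b => [|s ih] b.
  move=> _; exists b%:MP; last by rewrite /mev mevalC.
  apply/dhomogP => m; rewrite msuppC; case: ifP => // _.
  by rewrite inE => /eqP ->; rewrite /= mdeg0.
move=> [a ha ->].
have /choice[G hG] : forall i : 'I_d, exists G : {mpoly R[d]}, G \is s.-homog /\ mev G = a i.
  by move=> i; have [G h1 h2] := ih _ (ha i (ltn_ord i)); exists G.
exists (\sum_(i < d) 'X_i * G i).
  apply: rpred_sum => i _; rewrite -add1n; apply: dhomogM; last by case: (hG i).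
  by rewrite dhomogX /= mdeg1.
rewrite mev_sum; apply: eq_bigr => i _; rewrite mevM /mev mevalXU -/(mev _).
by have [_ ->] := hG i.
Qed.

Lemma pihomogM_homog n k (G F : {mpoly R[d]}) : F \is k.-homog -> (k <= n)%N ->
  pihomog mdeg n (G * F) = pihomog mdeg (n - k) G * F.
Proof.
move=> hF kn; elim/mpolyind: G => [|c m G _ _ ih].
  by rewrite mul0r !linear0 mul0r.
rewrite mulrDl !linearD /= ih [RHS]mulrDl; congr (_ + _).
rewrite -scalerAl !linearZ /= -scalerAl; congr (_ *: _).
have hX : 'X_[R, m] * F \is (mdeg m + k).-homog by apply: dhomogM; rewrite // dhomogX.
rewrite pihomogX; case: eqP => [e|/eqP e].
  by rewrite pihomog_dE // -[n](subnK kn) -e.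
rewrite mul0r (pihomog_ne0 _ hX) //; apply: contra e => /eqP <-.
by rewrite addnK.
Qed.

(** Forms over [R] stand in for the Rees algebra: those with value in [E] have finitely many
    generators among themselves, and [c] is the largest degree of these. An element of order n is
    the value of a form of degree n, and the coefficients of its expansion may be replaced by their
    components of complementary degree. *)
Lemma artin_rees (E : set R) : noetherian R -> is_ideal E ->
  exists c k e, (forall i, (i < k)%N -> E (e i)) /\
    forall n b, (c <= n)%N -> E b -> mpow n b ->
      exists2 u, (forall i, (i < k)%N -> mpow (n - c) (u i)) & b = \sum_(i < k) u i * e i.
Proof.
move=> nR hE; pose H := [set F : {mpoly R[d]} | E (mev F) /\ exists n, F \is n.-homog].
have [k [F [hF HF]]] := noetherian_gens H (@noetherian_mpoly d _ nR).
have /choice[l hl] : forall i, exists n, (i < k)%N -> F i \is n.-homog.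
  move=> i; case: (boolP (i < k)%N) => [/hF[_ [n h]]|_]; first by exists n.
  by exists 0%N.
exists (\max_(i < k) l i)%N, k, (fun i => mev (F i)); split; first by move=> i /hF[].
move=> n b cn Eb /mpow_form[G hG Gb].
have /HF[c [_ -> GE]] : H G by split; [rewrite Gb|exists n].
have ln (i : 'I_k) : (l i <= n)%N by apply: leq_trans cn; exact: (leq_bigmax i).
have lc (i : 'I_k) : (l i <= \max_(i < k) l i)%N by exact: (leq_bigmax i).
exists (fun i => mev (pihomog mdeg (n - l i) (c i))).
  move=> i ik; apply: (@mpow_le _ (n - l i)).
    by apply: leq_sub2l; exact: (lc (Ordinal ik)).
  by apply: mpow_mev; exact: pihomogP.
rewrite -Gb -(pihomog_dE hG) GE addr0 linear_sum /= mev_sum; apply: eq_bigr => i _.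
by rewrite (pihomogM_homog _ (hl i (ltn_ord i))) // mevM.
Qed.

Hypothesis x_jac : forall a, mpow 1 a -> exists b, (1 - a) * b = 1.

(** Artin-Rees for the ideal I + (b), applied to an element b - i of order c + 1, gives b in I + m
    b; then 1 - mu is inverted. *)
Lemma krull_intersection (I : set R) b : noetherian R -> is_ideal I ->
  (forall s, exists2 i, I i & mpow s (b - i)) -> I b.
Proof.
move=> nR hI hb; have [I0 ID IM] := hI.
have [c [k [e [he AR]]]] := artin_rees nR (@idl_ideal _ I (fun=> b) 1 hI).
have [i Ii hi] := hb c.+1.
have [||//|u hu bE] := AR c.+1 (b - i); first exact: leqnSn.
  by exists (fun=> 1), (- i); [exact: (@submodN R R^o)|rewrite big_ord1 mul1r].
have {}he j : (j < k)%N -> exists r, I (e j - r * b).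
  by move=> /he[r [q Iq ->]]; exists (r 0%N); rewrite big_ord1 addrC addKr.
have [mu mmu Imu] : exists2 mu, mpow 1 mu & I (\sum_(j < k) u j * e j - mu * b).
  elim/big_ind: _ => [|y z [m1 h1 i1] [m2 h2 i2]|j _].
  - by exists 0; [have [] := mpow_ideal 1|rewrite mul0r subr0].
  - exists (m1 + m2); first by have [_ h _] := mpow_ideal 1; exact: h.
    by rewrite mulrDl opprD addrACA; apply: ID.
  - have [r Ir] := he j (ltn_ord j); exists (u j * r).
      by apply: (idealMr _ (mpow_ideal 1)); have := hu j (ltn_ord j); rewrite subSnn.
    by rewrite -mulrA -mulrBr; apply: IM.
have [v hv] := x_jac mmu.
have : I ((b - mu * b)).
  by have -> : b - mu * b = b - i - mu * b + i; [rewrite addrAC subrK|rewrite bE; exact: ID].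
by move=> /(IM v); rewrite -[X in X - _]mul1r -mulrBl mulrA [v * _]mulrC hv mul1r.
Qed.

End PowersOfIdeal.

(** * Regular local rings *)

Section RegularLocal.
Variables (K : fieldType) (R : comNzRingType) (kap : {rmorphism K -> R}).
Variables (x : nat -> R) (d : nat).
Notation m := (mpow x d 1).
Notation mpow := (mpow x d).
Hypothesis noethR : noetherian R.
Hypothesis residue : forall a, exists c, m (a - kap c).
Hypothesis m_jac : forall a, m a -> exists b, (1 - a) * b = 1.
Hypothesis m_proper : ~ m 1.

Let kev (F : {mpoly K[d]}) : R := mev x (map_mpoly kap F).
Let mon (b : 'X_{1..d}) : R := \prod_(i < d) x i ^+ b i.

Lemma kap_m c : m (kap c) -> c = 0.
Proof.
move=> mc; apply/eqP/negPn/negP => c0; apply: m_proper.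
have [_ _ h] := mpow_ideal x d 1.
by have := h (kap c^-1) _ mc; rewrite -rmorphM mulVf // rmorph1.
Qed.

Lemma kevD F G : kev (F + G) = kev F + kev G.
Proof. by rewrite /kev rmorphD mevD. Qed.

Lemma kev0 : kev 0 = 0.
Proof. by rewrite /kev rmorph0 /mev meval0. Qed.

Lemma kevN F : kev (- F) = - kev F.
Proof. by rewrite /kev rmorphN /mev mevalN. Qed.

Lemma kevM F G : kev (F * G) = kev F * kev G.
Proof. by rewrite /kev rmorphM mevM. Qed.

Lemma kevXU i : kev 'X_i = x i.
Proof. by rewrite /kev map_mpolyX /mev mevalXU. Qed.

Lemma kev_sum F : kev F = \sum_(b <- msupp F) kap F@_b * mon b.
Proof.
rewrite {1}[F]mpolyE (big_morph kev kevD kev0); apply: eq_bigr => b _.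
by rewrite -mul_mpolyC kevM /kev map_mpolyC map_mpolyX /mev mevalC mevalX.
Qed.

Lemma mpow_kev s F : F \is s.-homog -> mpow s (kev F).
Proof.
move=> /dhomogP hF; rewrite kev_sum big_seq; apply: ideal_sum; first exact: mpow_ideal.
move=> b /hF <-; have [_ _ h] := mpow_ideal x d (mdeg b); apply: h; exact: mpow_monom.
Qed.

Lemma mpow_kform s b : mpow s b -> exists2 F : {mpoly K[d]}, F \is s.-homog & mpow s.+1 (b - kev F).
Proof.
elim: s b => [|s ih] b.
  move=> _; have [c hc] := residue b; exists c%:MP; last by rewrite /kev map_mpolyC /mev mevalC.
  apply/dhomogP => a; rewrite msuppC; case: ifP => // _.
  by rewrite inE => /eqP ->; rewrite /= mdeg0.
move=> [a ha ->].
have /choice[G hG] : forall i : 'I_d, exists G : {mpoly K[d]},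
    G \is s.-homog /\ mpow s.+1 (a i - kev G).
  by move=> i; have [G h1 h2] := ih _ (ha i (ltn_ord i)); exists G.
exists (\sum_(i < d) 'X_i * G i).
  apply: rpred_sum => i _; rewrite -add1n; apply: dhomogM; last by case: (hG i).
  by rewrite dhomogX /= mdeg1.
have -> : kev (\sum_(i < d) 'X_i * G i) = \sum_(i < d) x i * kev (G i).
  by rewrite (big_morph kev kevD kev0); apply: eq_bigr => i _; rewrite kevM kevXU.
rewrite -sumrB; apply: ideal_sum; first exact: mpow_ideal.
move=> i _; rewrite -mulrBr -[s.+2]add1n; apply: mpowM; first exact: mpow1.
by have [_] := hG i.
Qed.

Definition ideal_plus (I : set R) (s : nat) : set R := [set b | exists2 i, I i & mpow s (b - i)].

Lemma ideal_plus_ideal I s : is_ideal I -> is_ideal (ideal_plus I s).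
Proof.
move=> [I0 ID IM]; have [M0 MD MM] := mpow_ideal x d s; split.
- by exists 0; rewrite ?subr0.
- move=> a b [i Ii hi] [j Ij hj]; exists (i + j); first exact: ID.
  by rewrite opprD addrACA; exact: MD.
- by move=> c a [i Ii hi]; exists (c * i); [exact: IM|rewrite -mulrBr; exact: MM].
Qed.

Lemma ideal_plus_l (I : set R) s : I `<=` ideal_plus I s.
Proof. by move=> i Ii; exists i => //; rewrite subrr; case: (mpow_ideal x d s). Qed.

Lemma ideal_plus_r (I : set R) s : is_ideal I -> mpow s `<=` ideal_plus I s.
Proof. by move=> [I0 _ _] a ma; exists 0; rewrite ?subr0. Qed.

Lemma ideal_plus_le (I J : set R) s t : I `<=` J -> (t <= s)%N -> ideal_plus I s `<=` ideal_plus J t.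
Proof. by move=> IJ ts a [i /IJ Ji h]; exists i => //; exact: mpow_le h. Qed.

(** For an ideal [W], this says that R / W has dimension at least [D] over [K]. *)
Definition indep (W : set R) (D : nat) : Prop :=
  exists v : nat -> R, forall c : nat -> K, W (\sum_(i < D) kap (c i) * v i) ->
    forall i, (i < D)%N -> c i = 0.

Lemma indep_sub (W W' : set R) D : W `<=` W' -> indep W' D -> indep W D.
Proof. by move=> WW' [v hv]; exists v => c /WW'; exact: hv. Qed.

(** Multiplication by [y] embeds R / (W : y) into U / W, and (W : y) lies in [V]; so the dimension
    of R / W is at least the sum of those of R / U and R / V. *)
Lemma indep_add (W U V : set R) y D E : is_ideal U -> W `<=` U -> U y ->
  (forall a, W (y * a) -> V a) -> indep U D -> indep V E -> indep W (E + D).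
Proof.
move=> hU WU Uy WV [v hv] [w hw].
exists (fun i => if (i < E)%N then y * w i else v (i - E)%N) => c.
rewrite big_split_ord /=.
under eq_bigr do rewrite ltn_ord mulrCA.
under [X in _ + X]eq_bigr do rewrite ltnNge leq_addr /= addKn.
rewrite -mulr_sumr => h.
have cv i : (i < D)%N -> c (E + i)%N = 0.
  apply: (hv (fun i => c (E + i)%N)).
  have := idealB hU (WU _ h) (idealMr (\sum_(i < E) kap (c i) * w i) hU Uy).
  by rewrite [X in U X]addrC addKr.
have cw i : (i < E)%N -> c i = 0.
  apply: hw; apply: WV; move: h; rewrite [X in _ + X]big1 ?addr0 // => j _.
  by rewrite cv // rmorph0 mul0r.
move=> i iED; case: (ltnP i E) => [/cw //|Ei].
by rewrite -(subnKC Ei); apply: cv; rewrite ltn_subLR.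
Qed.

Lemma prime_sub_m (P : set R) : is_prime_ideal P -> P `<=` m.
Proof.
move=> [[P0 PD PM] P1 _] a Pa; have [c hc] := residue a.
have [M0 MD MM] := mpow_ideal x d 1.
case: (eqVneq c 0) => [c0|c0]; first by move: hc; rewrite c0 rmorph0 subr0.
case: P1; have : m (- (kap c^-1 * (a - kap c))).
  by have := MM (- kap c^-1) _ hc; rewrite mulNr.
move=> /m_jac[b]; rewrite mulrBr -rmorphM mulVf // rmorph1 opprK addrC subrK => h.
by rewrite -h mulrC; do 2!apply: (PM).
Qed.

(** Take y in P_1 outside P_0. It is a nonzerodivisor modulo P_0, so by Artin-Rees division by y
    lowers the order modulo P_0 by at most some c. With q = q1 + c, where q1 belongs to the chain
    from P_1 on, [indep_add] becomes Pascal's rule for the binomial coefficients. *)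
Lemma prime_chain_indep e (P : nat -> set R) :
  (forall i, (i <= e)%N -> is_prime_ideal (P i)) ->
  (forall i, (i < e)%N -> P i `<` P i.+1) ->
  exists q, forall n, indep (ideal_plus (P 0%N) (q * n).+1) 'C(n, e).
Proof.
elim: e P => [|e ih] P hP hlt.
  exists 0%N => n; rewrite bin0 mul0n; exists (fun=> 1) => c + [] //.
  rewrite big_ord1 mulr1 => -[p /(prime_sub_m (hP 0%N isT)) mp h] _.
  apply: kap_m; rewrite -[kap _](subrK p); have [_ MD _] := mpow_ideal x d 1; exact: MD.
have [q1 hq1] := ih (fun i => P i.+1) (fun i => hP i.+1) (fun i => hlt i.+1).
have P0 := hP 0%N isT; have [I0 _ Pmul] := P0; have [Q0 QD QM] := I0.
have [sub01 /nonsubset[y [P1y P0y]]] := hlt 0%N isT.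
have I1 : is_ideal (P 1%N) by case: (hP 1%N isT).
have hE := @idl_ideal _ (P 0%N) (fun=> y) 1 I0.
have [c [k [f [hf AR]]]] := artin_rees x d noethR hE.
have /choice[r hr] : forall i, exists r, (i < k)%N -> P 0%N (f i - r * y).
  move=> i; case: (boolP (i < k)%N) => [/hf[r [p Pp ->]]|_]; last by exists 0.
  by exists (r 0%N); rewrite big_ord1 addrC addKr.
have colon n a : ideal_plus (P 0%N) (n + c) (y * a) -> ideal_plus (P 0%N) n a.
  move=> [p Pp h].
  have [|u hu uE] := AR (n + c)%N (y * a - p) (leq_addl _ _) _ h.
    exists (fun=> a), (- p); first exact: (@submodN R R^o).
    by rewrite big_ord1 mulrC.
  rewrite addnK in hu.
  exists (a - \sum_(i < k) u i * r i); last first.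
    rewrite subKr; apply: ideal_sum; first exact: mpow_ideal.
    by move=> i _; apply: (idealMr _ (mpow_ideal x d n)); exact: hu.
  suff : P 0%N (y * (a - \sum_(i < k) u i * r i)) by move=> /Pmul[].
  rewrite mulrBr -[y * a](subrK p) uE addrAC; apply: QD => //.
  rewrite mulr_sumr -sumrB; apply: ideal_sum => // i _.
  by rewrite [y * _]mulrC -mulrA -mulrBr; apply: QM; exact: hr.
exists (q1 + c)%N; elim=> [|n ihn]; first by rewrite bin0n; exists (fun=> 0) => ? _ [].
rewrite binS; apply: (@indep_add _ (ideal_plus (P 1%N) ((q1 + c) * n.+1).+1) _ y _ _ _ _ _ _ _ ihn).
- exact: ideal_plus_ideal.
- exact: ideal_plus_le.
- by apply: ideal_plus_l.
- move=> a; have -> : (((q1 + c) * n.+1).+1 = ((q1 + c) * n).+1 + q1 + c)%N.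
    by rewrite mulnS addnC -addSn addnA.
  by move=> /colon; apply: ideal_plus_le => //; exact: leq_addr.
- apply: indep_sub (hq1 n); apply: ideal_plus_le => //; rewrite ltnS.
  by rewrite mulnDl mulnS; apply: leq_trans (leq_addr _ _); exact: leq_addl.
Qed.

Definition kspan (T : finType) (W : set R) (v : T -> R) : set R :=
  [set b | exists c : T -> K, W (b - \sum_t kap (c t) * v t)].

Lemma kspan_sum (T : finType) (W : set R) (v : T -> R) (I : Type) (r : seq I) (Q : pred I)
    (F : I -> R) : is_ideal W -> (forall i, Q i -> kspan W v (F i)) ->
  kspan W v (\sum_(i <- r | Q i) F i).
Proof.
move=> [W0 WD WM] h; elim/big_ind: _ => // [|a b [c hc] [e he]].
  by exists (fun=> 0); rewrite big1 ?subr0 // => t _; rewrite rmorph0 mul0r.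
exists (fun t => c t + e t).
under eq_bigr do rewrite rmorphD mulrDl.
by rewrite big_split /= opprD addrACA; exact: WD.
Qed.

Lemma kspan_scale (T : finType) (W : set R) (v : T -> R) k b :
  is_ideal W -> kspan W v b -> kspan W v (kap k * b).
Proof.
move=> [W0 WD WM] [c hc]; exists (fun t => k * c t).
under eq_bigr do rewrite rmorphM -mulrA.
by rewrite -mulr_sumr -mulrBr; exact: WM.
Qed.

Lemma kspan_sub (T : finType) (W : set R) (v : T -> R) : W `<=` kspan W v.
Proof.
move=> b Wb; exists (fun=> 0); rewrite big1 ?subr0 // => t _.
by rewrite rmorph0 mul0r.
Qed.

Lemma kspan_gen (T : finType) (W : set R) (v : T -> R) t : W 0 -> kspan W v (v t).
Proof.
move=> W0; exists (fun u => (u == t)%:R).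
rewrite (bigD1 t) //= eqxx rmorph1 mul1r big1 ?addr0 ?subrr // => u /negbTE ->.
by rewrite rmorph0 mul0r.
Qed.

Lemma indep_kspan (T : finType) (W : set R) (v : T -> R) D :
  is_ideal W -> (forall b, kspan W v b) -> indep W D -> (D <= #|T|)%N.
Proof.
move=> hW sp [w hw]; rewrite leqNgt; apply/negP => lt.
have [e /rV0Pn[i /eqP e0] h] := @overfull_dependent K R kap R^o T W v D (fun i => w i) hW lt (fun i => sp (w i)).
apply: e0; have := hw (fun j => if insub j is Some j' then e 0 j' else 0) _ i (ltn_ord i).
by rewrite valK; apply; under eq_bigr do rewrite valK.
Qed.

(** The initial forms of the [x i] are algebraically independent over [K]: the associated graded
    ring is a polynomial ring. *)
Definition quasi_regular : Prop :=
  forall s (F : {mpoly K[d]}), F \is s.-homog -> mpow s.+1 (kev F) -> F = 0.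

Lemma monM a b : mon (a + b)%MM = mon a * mon b.
Proof. by rewrite /mon -big_split; apply: eq_bigr => i _; rewrite mnmDE exprD. Qed.

(* If F(x) vanishes to excessive order, the monomials divisible by the leading one of F
   are redundant; the others have some exponent below s, so they are indexed by T. *)
Lemma not_quasi_regular_indep s (F : {mpoly K[d]}) N D :
  F \is s.-homog -> mpow s.+1 (kev F) -> F != 0 -> indep (mpow N) D ->
  (D <= d * s * N ^ d.-1)%N.
Proof.
move=> hF Fs F0 hD.
pose T : finType := ('I_d * 'I_s * {ffun 'I_d.-1 -> 'I_N})%type.
pose bt (t : T) : 'X_{1..d} :=
  [multinom if unlift t.1.1 k is Some l then t.2 l : nat else t.1.2 : nat | k < d].
have -> : (d * s * N ^ d.-1 = #|{: T}|)%N.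
  by rewrite !card_prod !card_ord card_ffun !card_ord.
apply: (@indep_kspan _ _ (fun t => mon (bt t)) _ (mpow_ideal x d N) _ hD).
set Sp := kspan _ _.
have SpD a b : Sp a -> Sp b -> Sp (a + b).
  move=> ha hb; have := @kspan_sum T _ (fun t => mon (bt t)) bool (index_enum bool) predT
    (fun i => if i then a else b) (mpow_ideal x d N).
  by rewrite big_bool /=; apply; case.
have mpow_mon a : mpow (mdeg a) (mon a) by exact: mpow_monom.
(* Descending induction on the order [k], with [j] bounding its distance to [N]; within one order
   the induction follows the monomial order. *)
suff main j : forall k, (N <= k + j)%N -> mpow k `<=` Sp by move=> b; apply: (main N 0%N).
elim: j => [|j ih] k Nkj; first by move=> b /mpow_le h; apply: kspan_sub; apply: h; rewrite addn0 in Nkj.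
have {}ih : mpow k.+1 `<=` Sp by apply: ih; rewrite addSnnS.
suff monSp b : mdeg b = k -> Sp (mon b).
  move=> b /mpow_kform[G /dhomogP hG /ih h]; rewrite -[b](subrK (kev G)); apply: SpD => //.
  rewrite kev_sum big_seq; apply: kspan_sum; first exact: mpow_ideal.
  by move=> a /hG ha; apply: kspan_scale; [exact: mpow_ideal|exact: monSp].
elim/(@ltmwf d): b => b wih bk.
case: (leqP N k) => [Nk|kN].
  by apply: kspan_sub; apply: mpow_le Nk _ _; rewrite -bk.
have hlead := mlead_supp F0.
have sa : mdeg (mlead F) = s by have /dhomogP := hF; apply.
case: (boolP (mlead F <= b)%MM) => [ab|/mnm_lepP].
  set g := (b - mlead F)%MM; have bE : b = (g + mlead F)%MM by rewrite /g submK.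
  have gk : (mdeg g + s = k)%N by rewrite -bk bE mdegD sa.
  have l0 : F@_(mlead F) != 0 by rewrite -mcoeff_msupp.
  (* F(x) is solved for its leading monomial and multiplied by [mon g]: the first term has order
     above [k], the others are smaller monomials of the same degree. *)
  have e : mon b = kap (F@_(mlead F))^-1 * (mon g * kev F) +
      \sum_(a <- rem (mlead F) (msupp F)) kap (- (F@_(mlead F))^-1 * F@_a) * mon (g + a)%MM.
    rewrite kev_sum (big_rem _ hlead) /= !mulrDr -addrA.
    rewrite [X in _ + X](_ : _ = 0) ?addr0.
      by rewrite bE monM [mon g * (_ * _)]mulrCA !mulrA -rmorphM mulVf // rmorph1 mul1r.
    rewrite !mulr_sumr -big_split big1 // => a _ /=.
    by rewrite monM mulNr rmorphN rmorphM mulNr [mon g * _]mulrCA !mulrA subrr.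
  rewrite e; apply: SpD.
    apply: kspan_scale; first exact: mpow_ideal.
    by apply: ih; rewrite -gk -addnS; apply: mpowM.
  rewrite big_seq; apply: kspan_sum; first exact: mpow_ideal.
  move=> a; rewrite mem_rem_uniq ?msupp_uniq // inE => /andP[ane asupp].
  apply: kspan_scale; first exact: mpow_ideal.
  have am : mdeg a = s by have /dhomogP := hF; apply.
  apply: wih; last by rewrite mdegD am.
  by rewrite bE ltmc_add2r Order.POrderTheory.lt_neqAle ane; exact: msupp_le_mlead.
move=> /forallP; rewrite negb_forall => /existsP[i]; rewrite -ltnNge => lt.
have bs : (b i < s)%N by apply: leq_trans lt _; rewrite -sa mdegE (bigD1 i) //= leq_addr.
have bN l : (b l < N)%N by apply: leq_ltn_trans kN; rewrite -bk mdegE (bigD1 l) //= leq_addr.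
pose t : T := (i, Ordinal bs, [ffun l => Ordinal (bN (lift i l))]).
suff <- : bt t = b by apply: kspan_gen; case: (mpow_ideal x d N).
apply/mnmP => l; rewrite mnmE /=; case: (unliftP i l) => [j' ->|->] //=.
by rewrite ffunE.
Qed.


Lemma quasi_regular_of_chain : has_chain (@is_prime_ideal R) d -> quasi_regular.
Proof.
move=> [P [hP hlt]] s F hF Fs; apply/eqP/negPn/negP => F0.
have [q hq] := prime_chain_indep hP hlt.
have P0m : ideal_plus (P 0%N) 1 `<=` m.
  have [_ MD _] := mpow_ideal x d 1.
  move=> a [p /(prime_sub_m (hP 0%N isT)) mp h]; rewrite -[a](subrK p); exact: MD.
have key n : ('C(n, d) <= d * s * (q * n).+1 ^ d.-1)%N.
  apply: (not_quasi_regular_indep hF Fs F0); apply: indep_sub (hq n).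
  by apply: ideal_plus_r; have [[]] := hP 0%N isT.
case: (posnP d) => [d0|d_gt0].
  by have := key 0%N; rewrite d0 bin0.
(* At n = d (C + 1) the binomial coefficient is at least (C + 1)^d, whereas [key] bounds it by C (C
   + 1)^(d - 1). *)
set C := (d * s * (q * d).+1 ^ d.-1)%N.
have lb t : (t ^ d <= 'C(d * t, d))%N.
  rewrite -(leq_pmul2r (fact_gt0 d)) bin_ffact -ffactnn !ffact_prod.
  rewrite -[X in (t ^ X)%N]card_ord -prod_nat_const -big_split /=.
  apply: leq_prod => i _; case: t => [//|t].
  by rewrite mulnBr [(t.+1 * d)%N]mulnC leq_sub2l // leq_pmull.
have ub : ('C(d * C.+1, d) <= C * C.+1 ^ d.-1)%N.
  have h : ((q * (d * C.+1)).+1 ^ d.-1 <= (q * d).+1 ^ d.-1 * C.+1 ^ d.-1)%N.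
    rewrite -expnMn; case: d.-1 => // e.
    by rewrite leq_exp2r // mulSn mulnA addSn ltnS leq_addl.
  by apply: leq_trans (key _) (leq_trans (leq_mul (leqnn _) h) _); rewrite mulnA.
have := leq_trans (lb C.+1) ub; rewrite -[X in (_ ^ X <= _)%N](prednK d_gt0) expnS.
by rewrite leq_pmul2r ?ltnn // expn_gt0.
Qed.

(** Contrary to what the name suggests, this says that [F] lies in the ideal of the first [k]
    variables: no monomial of [F] avoids all of them. *)
Definition free_of_vars k (F : {mpoly K[d]}) : Prop :=
  forall b : 'X_{1..d}, (forall i : 'I_d, (i < k)%N -> b i = 0%N) -> F@_b = 0.

Lemma free_of_vars_idl k F : free_of_vars k F -> idl [set 0] x k (kev F).
Proof.
move=> hF; rewrite kev_sum; have hI := @idl_ideal _ [set 0] x k (@ideal0 R).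
apply: ideal_sum => // b _; have [I0 _ IM] := hI.
case: (pselect (forall i : 'I_d, (i < k)%N -> b i = 0%N)) => [/hF ->|].
  by rewrite rmorph0 mul0r.
move=> /existsNP[i /not_implyP[ik /eqP bi]]; apply: IM.
have -> : b = (U_(i) + (b - U_(i)))%MM.
  by rewrite addmC submK //; apply/mnm_lepP => j; rewrite mnm1E; case: eqP => // <-; rewrite lt0n.
rewrite monM; apply: (idealMr _ hI).
have -> : mon U_(i)%MM = x i by rewrite -[LHS]mevalX /= mevalXU.
exact: idl_gen.
Qed.

Lemma mcoeffMX_free k (F : {mpoly K[d]}) (i : 'I_d) : i = k :> nat ->
  free_of_vars k (F * 'X_i) -> free_of_vars k F.
Proof.
move=> ik h b hb; rewrite -(mcoeffMX F U_(i)); apply: h => j jk.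
by rewrite mnmDE mnm1E hb // addn0 -val_eqE /= ik gtn_eqF.
Qed.

Lemma mcoeffMX0 (F : {mpoly K[d]}) (i : 'I_d) (b : 'X_{1..d}) : b i = 0%N -> (F * 'X_i)@_b = 0.
Proof.
move=> bi; apply/eqP; rewrite -[_ == _]negbK -mcoeff_msupp (perm_mem (msuppMX _ _)).
by apply/mapP => -[b' _ e]; move: bi; rewrite e mnmDE mnm1E eqxx.
Qed.

Hypothesis qreg : quasi_regular.

(** Quasi-regularity of the remaining parameters in the quotient by the first [k], expressed without
    forming that quotient. *)
Definition quasi_regular_mod k : Prop := forall s (F : {mpoly K[d]}), F \is s.-homog ->
  ideal_plus (idl [set 0] x k) s.+1 (kev F) -> free_of_vars k F.

Lemma idl0_ideal k : is_ideal (idl [set 0] x k).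
Proof. by apply: idl_ideal; exact: ideal0. Qed.

(** Let G be the initial form of [a] in degree [r]. The order of a x_k forces G X_k into the ideal
    of the first [k] variables; since X_k is a nonzerodivisor modulo that ideal, G lies in it
    too. *)
Lemma order_bump k (kd : (k < d)%N) r a : quasi_regular_mod k ->
  ideal_plus (idl [set 0] x k) r.+2 (a * x k) -> ideal_plus (idl [set 0] x k) r a ->
  ideal_plus (idl [set 0] x k) r.+1 a.
Proof.
move=> qk h [i Ii /mpow_kform[G hG hb]].
have hI := idl0_ideal k; have hP := ideal_plus_ideal r.+2 hI.
have [_ ID IM] := hI.
have hGX : G * 'X_(Ordinal kd) \is r.+1.-homog.
  by rewrite -addn1; apply: dhomogM => //; rewrite dhomogX /= mdeg1.
have fG : free_of_vars k G.
  apply: (@mcoeffMX_free _ _ (Ordinal kd)) => //; apply: qk hGX _.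
  rewrite kevM kevXU /=.
  have -> : kev G * x k = a * x k - (i * x k + (a - i - kev G) * x k).
    by ring.
  apply: idealB => //; have [_ PD _] := hP; apply: PD.
    by apply: ideal_plus_l; exact: (idealMr _ hI).
  apply: ideal_plus_r => //; rewrite -[r.+2]addn1; apply: mpowM => //; exact: mpow1.
exists (i + kev G); last by rewrite opprD addrA.
by apply: ID => //; exact: free_of_vars_idl.
Qed.

(** Modulo the first [k] parameters F(x) is c x_k up to higher order. By [order_bump] the order of c
    reaches deg F - 1, so that c has a form G of that degree, and the case [k] applies to F - G
    X_k. *)
Lemma quasi_regular_modP k : (k <= d)%N -> quasi_regular_mod k.
Proof.
elim: k => [_|k ih kd] s F hF.
  move=> [i [c [_ -> ->]]]; rewrite big_ord0 addr0 subr0 => /(qreg hF) -> b _.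
  by rewrite mcoeff0.
have {}ih := ih (ltnW kd).
have hI := idl0_ideal k; have [I0 ID IM] := hI.
case: s hF => [|s] hF.
  move=> [i Ii hi]; suff /(qreg hF) -> : m (kev F) by move=> b _; rewrite mcoeff0.
  have [M0 MD MM] := mpow_ideal x d 1.
  rewrite -[kev F](subrK i); apply: MD => //; move: i Ii {hi}.
  apply: idl_min; [exact: mpow_ideal|by move=> _ ->|].
  by move=> i ik; apply: mpow1; apply: leq_trans ik kd.
move=> [i /idlS[c Ic] hi].
have cx : ideal_plus (idl [set 0] x k) s.+1 (c * x k).
  have -> : c * x k = kev F - ((i - c * x k) + (kev F - i)).
    by ring.
  have hP := ideal_plus_ideal s.+1 hI.
  apply: idealB => //; first by apply: ideal_plus_r => //; exact: mpow_kev.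
  have [_ PD _] := hP; apply: PD; first exact: ideal_plus_l.
  by apply: ideal_plus_r => //; apply: mpow_le hi.
have cr : forall r, (r <= s)%N -> ideal_plus (idl [set 0] x k) r c.
  elim=> [_|r ihr rs]; first exact: ideal_plus_r.
  apply: (order_bump kd ih _ (ihr (ltnW rs))).
  by apply: ideal_plus_le cx.
have [j Ij /mpow_kform[G hG hj]] := cr s (leqnn _).
have hGX : G * 'X_(Ordinal kd) \is s.+1.-homog.
  by rewrite -addn1; apply: dhomogM => //; rewrite dhomogX /= mdeg1.
have : free_of_vars k (F - G * 'X_(Ordinal kd)).
  apply: (ih s.+1); first exact: rpredB.
  rewrite kevD kevN kevM kevXU /=.
  exists ((i - c * x k) + j * x k); first by apply: ID => //; exact: (idealMr _ hI).
  have -> : kev F - kev G * x k - (i - c * x k + j * x k) = (kev F - i) + (c - j - kev G) * x k.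
    by ring.
  have [_ MD _] := mpow_ideal x d s.+2; apply: MD => //.
  by rewrite -[s.+2]addn1; apply: mpowM => //; exact: mpow1.
move=> h b hb; have := h b (fun i ik => hb i (ltnW ik)).
by rewrite mcoeffB mcoeffMX0 ?subr0 //; apply: hb => /=.
Qed.

(** As a x_k has infinite order modulo the first [k] parameters, [order_bump] raises the order of
    [a] without end, and Krull's intersection theorem concludes. *)
Lemma regular_sequence k a : (k < d)%N -> idl [set 0] x k (a * x k) -> idl [set 0] x k a.
Proof.
move=> kd h; have qk := quasi_regular_modP (ltnW kd).
apply: (@krull_intersection _ x d m_jac) => //; first exact: idl0_ideal.
suff main r : ideal_plus (idl [set 0] x k) r a by move=> s; have [i] := main s; exists i.
elim: r => [|r ih]; first by apply: ideal_plus_r => //; exact: idl0_ideal.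
by apply: order_bump ih => //; exact: ideal_plus_l.
Qed.

End RegularLocal.

(** * Koszul complexes *)

Section Koszul.
Variable A : comPzRingType.
Implicit Types (z : nat -> A) (Q J : set A).

(* The mapping cone of multiplication by y on a complex (r, d):
   (a, b) |-> (a d + y b, - b d). *)
Definition cone_rk (r : nat -> nat) (i : nat) : nat :=
  if i is i'.+1 then (r i'.+1 + r i')%N else r 0%N.

Definition cone_df (r : nat -> nat) (d : forall i, 'M[A]_(r i.+1, r i)) (y : A) (i : nat) :
    'M[A]_(cone_rk r i.+1, cone_rk r i) :=
  match i with
  | 0 => col_mx (d 0%N) y%:M
  | j.+1 => block_mx (d j.+1) 0 y%:M (- d j)
  end.

(** The ranks follow the iterated cones instead of the closed form binomial(n, i), so that the block
    matrices are well typed by computation. *)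
Fixpoint krk (n : nat) : nat -> nat :=
  if n is n'.+1 then cone_rk (krk n') else fun i => (i == 0%N).

(* The differentials of the Koszul complex of z 0, ..., z n.-1. *)
Fixpoint kdf z (n : nat) : forall i, 'M[A]_(krk n i.+1, krk n i) :=
  match n with
  | 0 => fun i => 0
  | n'.+1 => cone_df (kdf z n') (z n')
  end.

Definition mxin Q p q (M : 'M[A]_(p, q)) : Prop := forall i j, Q (M i j).

Lemma mxin0 Q p q : is_ideal Q -> mxin Q (0 : 'M_(p, q)).
Proof. by move=> [Q0 _ _] i j; rewrite mxE. Qed.

Lemma mxinD Q p q (M N : 'M_(p, q)) : is_ideal Q -> mxin Q M -> mxin Q N -> mxin Q (M + N).
Proof. by move=> [_ QD _] hM hN i j; rewrite mxE; exact: QD. Qed.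

Lemma mxinB Q p q (M N : 'M_(p, q)) : is_ideal Q -> mxin Q M -> mxin Q N -> mxin Q (M - N).
Proof. by move=> hQ hM hN i j; rewrite !mxE; exact: idealB. Qed.

Lemma mxinN Q p q (M : 'M_(p, q)) : is_ideal Q -> mxin Q M -> mxin Q (- M).
Proof. by move=> hQ hM; rewrite -sub0r; apply: mxinB => //; exact: mxin0. Qed.

Lemma mxinZ Q p q (M : 'M_(p, q)) c : is_ideal Q -> mxin Q M -> mxin Q (c *: M).
Proof. by move=> [_ _ QM] hM i j; rewrite mxE; exact: QM. Qed.

Lemma mxinMl Q p q s (M : 'M_(p, q)) (N : 'M_(q, s)) : is_ideal Q -> mxin Q M -> mxin Q (M *m N).
Proof.
move=> hQ hM i j; rewrite mxE; apply: ideal_sum => // l _.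
by apply: (idealMr _ hQ); exact: hM.
Qed.

Lemma mxinMr Q p q s (M : 'M_(p, q)) (N : 'M_(q, s)) : is_ideal Q -> mxin Q N -> mxin Q (M *m N).
Proof.
move=> hQ hM i j; rewrite mxE; apply: ideal_sum => // l _.
by have [_ _ QM] := hQ; apply: QM; exact: hM.
Qed.

Lemma mxin_row Q p q s (M : 'M_(p, q)) (N : 'M_(p, s)) : mxin Q (row_mx M N) <-> mxin Q M /\ mxin Q N.
Proof.
split=> [h|[hM hN] i j]; first split=> i j.
- by have := h i (lshift s j); rewrite row_mxEl.
- by have := h i (rshift q j); rewrite row_mxEr.
- by rewrite mxE; case: fintype.split => k.
Qed.

Lemma mxin_zero p q (M : 'M_(p, q)) : mxin [set 0] M <-> M = 0.
Proof.
by split=> [h|-> i j]; [apply/matrixP => i j; rewrite mxE; exact: h|rewrite mxE].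
Qed.

Section Cone.
Variables (r : nat -> nat) (d : forall i, 'M[A]_(r i.+1, r i)).

Definition is_complex := forall i, d i.+1 *m d i = 0.

(** A homotopy survives reduction modulo any ideal; this is how the elements of a Koszul complex are
    seen to kill its homology with coefficients. *)
Definition null_homotopic (a : A) := exists h : forall i, 'M[A]_(r i, r i.+1),
  h 0%N *m d 0%N = a%:M /\ forall i, d i *m h i + h i.+1 *m d i.+1 = a%:M.

(** Vanishing in positive degrees of the homology of the complex tensored with A / Q. *)
Definition acyclic_mod Q := forall i (v : 'rV_(r i.+1)), mxin Q (v *m d i) ->
  exists w : 'rV_(r i.+2), mxin Q (v - w *m d i.+1).

Lemma cone_complex y : is_complex -> forall i, cone_df d y i.+1 *m cone_df d y i = 0.
Proof.
move=> dd [|i] /=.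
  rewrite mul_block_col mul0mx addr0 dd mulNmx mul_scalar_mx mul_mx_scalar subrr.
  by rewrite col_mx0.
rewrite mulmx_block !mul0mx !mulmx0 !addr0 !add0r !mulNmx !mulmxN opprK !dd.
by rewrite mul_scalar_mx mul_mx_scalar subrr block_mx0.
Qed.

End Cone.

(** The homotopy moves the unshifted summand to the shifted one: (a, b) |-> (0, a). *)
Lemma cone_null_homotopic r (d : forall i, 'M[A]_(r i.+1, r i)) y : null_homotopic (cone_df d y) y.
Proof.
exists (fun i => match i return 'M[A]_(cone_rk r i, cone_rk r i.+1) with
  | 0 => row_mx 0 1%:M
  | j.+1 => block_mx 0 1%:M 0 0
  end); split=> [|[|i]] /=.
- by rewrite mul_row_col mul0mx add0r mul1mx.
- rewrite mul_col_row mulmx_block !mulmx0 !mul0mx !mulmx1 !mul1mx add_block_mx.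
  by rewrite !(addr0, add0r, addrN) [RHS]scalar_mx_block.
- rewrite !mulmx_block !mulmx0 !mul0mx !mulmx1 !mul1mx add_block_mx.
  by rewrite !(addr0, add0r, addrN) [RHS]scalar_mx_block.
Qed.

Lemma cone_null_homotopic_lift r (d : forall i, 'M[A]_(r i.+1, r i)) y a :
  null_homotopic d a -> null_homotopic (cone_df d y) a.
Proof.
move=> [h [h0 hS]].
exists (fun i => match i return 'M[A]_(cone_rk r i, cone_rk r i.+1) with
  | 0 => row_mx (h 0%N) 0
  | j.+1 => block_mx (h j.+1) 0 0 (- h j)
  end); split=> [|[|i]] /=.
- by rewrite mul_row_col mul0mx addr0.
- rewrite mul_col_row mulmx_block !mulmx0 !mul0mx add_block_mx.
  rewrite !(mulNmx, mulmxN) opprK mul_scalar_mx mul_mx_scalar.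
  by rewrite !(addr0, add0r, addrN) h0 hS [RHS]scalar_mx_block.
- rewrite !mulmx_block !mulmx0 !mul0mx add_block_mx.
  rewrite !(mulNmx, mulmxN) !opprK mul_scalar_mx mul_mx_scalar.
  by rewrite !(addr0, add0r, addrN) !hS [RHS]scalar_mx_block.
Qed.

(** The long exact sequence of the cone by hand. For a cycle (a, b) the component b is a boundary w
    d, by injectivity of [y] on H_0 in the lowest degree and by acyclicity above; then a + y w is a
    cycle. *)
Lemma cone_acyclic r (d : forall i, 'M[A]_(r i.+1, r i)) y Q : is_ideal Q ->
  (forall b : 'rV_(r 0%N), (exists w, mxin Q (y *: b - w *m d 0%N)) -> exists w, mxin Q (b - w *m d 0%N)) ->
  acyclic_mod d Q -> acyclic_mod (cone_df d y) Q.
Proof.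
move=> hQ reg ac.
have step i (a : 'rV_(r i.+1)) b w : mxin Q (a *m d i + y *: b) -> mxin Q (b - w *m d i) ->
    exists w', mxin Q (row_mx a b - row_mx (w' *m d i.+1 - y *: w) (w *m d i)).
  move=> h1 h2; have [|w' hw'] := ac i (a + y *: w).
    have -> : (a + y *: w) *m d i = (a *m d i + y *: b) - y *: (b - w *m d i).
      by rewrite mulmxDl -scalemxAl scalerBr opprB [_ - y *: b]addrC addrA addrK.
    by apply: mxinB => //; exact: mxinZ.
  exists w'; rewrite opp_row_mx add_row_mx; apply/mxin_row; split=> //.
  by rewrite opprB addrA.
case=> [|i] /= v; rewrite -[v]hsubmxK.
  set a := lsubmx v; set b := rsubmx v.
  rewrite mul_row_col mul_mx_scalar => h.
  have [|w hw] := reg b.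
    by exists (- a); rewrite mulNmx opprK addrC.
  have [w' hw'] := step _ _ _ _ h hw; exists (row_mx w' (- w)).
  rewrite mul_row_block mulmx0 add0r mul_mx_scalar mulNmx mulmxN opprK.
  by rewrite scalerN.
set a := lsubmx v; set b := rsubmx v.
rewrite mul_row_block mulmx0 add0r mul_mx_scalar mulmxN => /mxin_row[h /(mxinN hQ)].
rewrite opprK => /ac[w hw]; have [w' hw'] := step _ _ _ _ h hw; exists (row_mx w' (- w)).
by rewrite mul_row_block mulmx0 add0r mul_mx_scalar mulNmx mulmxN opprK scalerN.
Qed.

Lemma kdf_complex z n : is_complex (kdf z n).
Proof. by elim: n => [|n ih] i /=; [rewrite mul0mx|exact: cone_complex]. Qed.

Lemma kdf_null_homotopic z n i : (i < n)%N -> null_homotopic (kdf z n) (z i).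
Proof.
elim: n => // n ih; rewrite ltnS leq_eqVlt => /orP[/eqP ->|/ih h].
  exact: cone_null_homotopic.
exact: cone_null_homotopic_lift.
Qed.

Lemma kdf0_image z n Q (b : 'rV_(krk n 0)) : is_ideal Q ->
  (exists w, mxin Q (b - w *m kdf z n 0)) <-> forall j, idl Q z n (b 0 j).
Proof.
move=> hQ; elim: n b => [|n ih] b /=.
  split=> [[w h] j|h].
    exists (fun=> 0), (b 0 j); last by rewrite big_ord0 add0r.
    by have := h 0 j; rewrite mulmx0 subr0.
  exists 0 => i j; rewrite mul0mx subr0 ord1.
  by have [c [q Qq ->]] := h j; rewrite big_ord0 add0r.
split=> [[w h] j|h].
  rewrite -[w]hsubmxK mul_row_col mul_mx_scalar opprD addrA addrAC in h.
  apply/idlS; exists (rsubmx w 0 j).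
  have /ih/(_ j) : exists w', mxin Q (b - z n *: rsubmx w - w' *m kdf z n 0) by exists (lsubmx w).
  by rewrite !mxE mulrC.
have /choice[c hc] : forall j, exists c, idl Q z n (b 0 j - c * z n).
  by move=> j; apply/idlS.
have /ih[w hw] : forall j, idl Q z n ((b - z n *: \row_j c j) 0 j).
  by move=> j; rewrite !mxE mulrC.
exists (row_mx w (\row_j c j)).
by rewrite mul_row_col mul_mx_scalar opprD addrA addrAC.
Qed.

Lemma kdf_acyclic z n Q : is_ideal Q ->
  (forall k a, (k < n)%N -> idl Q z k (a * z k) -> idl Q z k a) -> acyclic_mod (kdf z n) Q.
Proof.
move=> hQ; elim: n => [|n ih] reg.
  by move=> i v _; exists 0 => j k; rewrite mul0mx subr0; case: k.
apply: cone_acyclic => //; last by apply: ih => k a kn; apply: reg; exact: ltnW.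
move=> b /(kdf0_image _ _ hQ) h; apply/kdf0_image => // j; apply: reg => //.
by have := h j; rewrite mxE mulrC.
Qed.

(* H_i(C / Q) = y H_i(C / Q), because the homology of C / (Q + y) vanishes. *)
Lemma acyclic_mod_nakayama (m : set A) r (d : forall i, 'M[A]_(r i.+1, r i)) y Q Q' :
  is_ideal m -> (forall a, m a -> exists b, (1 - a) * b = 1) -> noetherian A ->
  is_complex d -> is_ideal Q -> m y -> (forall a, Q (a * y) -> Q a) ->
  Q `<=` Q' -> (forall a, Q' a -> exists c, Q (a - c * y)) ->
  acyclic_mod d Q' -> acyclic_mod d Q.
Proof.
move=> hm mjac nA dd hQ my reg QQ' Q'y ac i.
have [Q0 QD QM] := hQ.
pose Z := [set v : 'rV[A]_(r i.+1) | mxin Q (v *m d i)].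
pose B := [set v : 'rV[A]_(r i.+1) | exists w, mxin Q (v - w *m d i.+1)].
have hZ : submod Z.
  split; rewrite /Z /=.
  - by rewrite mul0mx; exact: mxin0.
  - by move=> u v hu hv; rewrite mulmxDl; exact: mxinD.
  - by move=> c u hu; rewrite -scalemxAl; exact: mxinZ.
have hB : submod B.
  split; rewrite /B /=.
  - by exists 0; rewrite mul0mx subr0; exact: mxin0.
  - by move=> u v [a ha] [b hb]; exists (a + b); rewrite mulmxDl opprD addrACA; exact: mxinD.
  - by move=> c u [a ha]; exists (c *: a); rewrite -scalemxAl -scalerBr; exact: mxinZ.
suff : Z `<=` B by move=> h v /h.
apply: (nakayama hm mjac hB (noetherian_rV nA hZ)) => N hN BN mN v Zv.
have [|w hw] := ac i v; first by move=> j k; apply: QQ'; exact: Zv.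
have /choice[c hc] : forall j, exists c, Q ((v - w *m d i.+1) 0 j - c * y).
  by move=> j; apply: Q'y; exact: hw.
pose u := \row_j c j.
have hu : mxin Q (v - w *m d i.+1 - y *: u).
  by move=> j k; rewrite ord1; have := hc k; rewrite !mxE [y * _]mulrC.
have Zu : Z u.
  move=> j k; apply: reg.
  have : mxin Q ((v - w *m d i.+1 - y *: u) *m d i) by exact: mxinMl.
  rewrite !mulmxBl -mulmxA dd mulmx0 subr0 => h.
  have := mxinB hQ Zv h; rewrite subKr -scalemxAl => /(_ j k).
  by rewrite mxE mulrC.
rewrite -[v](subrK (y *: u)); have [_ ND _] := hN; apply: ND; last exact: mN.
by apply: BN; exists w; rewrite addrAC.
Qed.

Lemma kdf_congr z z' n J i : is_ideal J -> (forall i, (i < n)%N -> J (z i - z' i)) ->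
  mxin J (kdf z n i - kdf z' n i).
Proof.
move=> hJ; elim: n i => [|n ih] i h; first by rewrite subrr; exact: mxin0.
have {}ih j : mxin J (kdf z n j - kdf z' n j) by apply: ih => k kn; apply: h; exact: ltnW.
have hs p : mxin J ((z n)%:M - (z' n)%:M : 'M_p).
  move=> j k; rewrite -raddfB mxE; case: (j == k); rewrite ?mulr1n ?mulr0n; first exact: h.
  by case: hJ.
case: i => [|i] /=.
  rewrite opp_col_mx add_col_mx => j k; rewrite mxE; case: fintype.split => l; [exact: ih|exact: hs].
rewrite opp_block_mx add_block_mx -opprD => j k; rewrite mxE; case: fintype.split => l; rewrite mxE; case: fintype.split => p.
- exact: ih.
- by rewrite subr0 mxE; case: hJ.
- exact: hs.
- by apply: mxinN (ih i) _ _.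
Qed.

Lemma krk0 n : krk n 0 = 1%N.
Proof. by elim: n. Qed.

Lemma krk_gt n i : (n < i)%N -> krk n i = 0%N.
Proof.
elim: n i => [|n ih] [|i] //= ni.
by rewrite (ih i) // (ih i.+1) // ltnW.
Qed.

Lemma kdf_free_resolution z n : acyclic_mod (kdf z n) [set 0] ->
  free_resolution (idl [set 0] z n) (kdf z n) (const_mx 1).
Proof.
(* The rank [krk n 0] is equal to 1 but not convertible to it for variable [n]; hence the
   augmentation is a constant matrix and the equality is passed as an argument. *)
move=> ac; have h1 p (e : p = 1%N) (P : A -> Prop) (v : 'rV_p) :
    P ((v *m (const_mx 1 : 'cV_p)) 0 0) <-> forall j, P (v 0 j).
  subst p; rewrite mxE big_ord1 mxE mulr1.
  by split=> [? j|]; [rewrite ord1|exact].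
split.
- move=> a; exists (const_mx a).
  apply: (h1 _ (krk0 n) (fun b => idl [set 0] z n (a - b)) _).2 => j.
  by rewrite mxE subrr; apply: idl_base.
- move=> v; split.
    move=> /(h1 _ (krk0 n))/(kdf0_image _ _ (@ideal0 A))[w /mxin_zero/eqP].
    by rewrite subr_eq0 => /eqP ->; exists w.
  move=> [w ->]; apply: (h1 _ (krk0 n) (idl [set 0] z n) _).2.
  by apply/kdf0_image; [exact: ideal0|exists w; rewrite subrr; exact/mxin_zero].
- move=> i v; split=> [/mxin_zero/ac[w /mxin_zero/eqP]|[w ->]].
    by rewrite subr_eq0 => /eqP ->; exists w.
  by rewrite -mulmxA kdf_complex mulmx0.
Qed.

End Koszul.

(** * Lengths of the Tor modules computed from a Koszul complex *)

Section TorLength.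
Variables (K : fieldType) (A : comPzRingType) (kap : {rmorphism K -> A}).
Implicit Types (z : nat -> A) (J : set A).

(** Take one new vector from each step of a chain that is too long. They are dependent modulo [B],
    and the last one with nonzero coefficient would already lie in the smaller submodule. *)
Lemma chain_length_le (V : lmodType A) (T : finType) (B Z : set V) (w : T -> V) l :
  submod B -> (forall v, Z v -> exists c : T -> K, B (v - \sum_t kap (c t) *: w t)) ->
  has_chain (fun M : set V => [/\ submod M, B `<=` M & M `<=` Z]) l -> (l <= #|T|)%N.
Proof.
move=> hB sp [C [hC hlt]]; rewrite leqNgt; apply/negP => lt.
have /choice[u hu] : forall i : 'I_l, exists u, C i.+1 u /\ ~ C i u.
  by move=> i; have [_ /nonsubset[u [h1 h2]]] := hlt i (ltn_ord i); exists u.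
have mono i j : (i <= j)%N -> (j <= l)%N -> C i `<=` C j.
  move=> ij jl; rewrite -(subnK ij); have : (j - i + i <= l)%N by rewrite subnK.
  elim: (j - i)%N => [|k ih]; [by move=> _ a|rewrite addSn => kl a Ca].
  by have [+ _] := hlt _ kl; apply; apply: ih => //; exact: ltnW.
have [e /rV0Pn[i0' ei0] Be] := overfull_dependent hB lt (fun i => sp (u i)
  (let: And3 _ _ CZ := hC i.+1 (ltn_ord i) in CZ _ (hu i).1)).
pose i0 := [arg max_(i > i0' | e 0%R i != 0%R) (i : nat)]%N.
have [ei imax] : e 0 i0 != 0 /\ forall i : 'I_l, e 0 i != 0 -> (i <= i0)%N.
  by rewrite /i0; case: arg_maxnP.
have [_ +] := hu i0; apply.
have [[C0 CD CZ] BC _] := hC i0 (ltnW (ltn_ord i0)).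
have hM : submod (C i0) by split.
move: (BC _ Be); rewrite (bigD1 i0) //= => /(fun h => submodB hM h) Bu.
have : C i0 (kap (e 0 i0) *: u i0).
  have := Bu (\sum_(i < l | i != i0) kap (e 0 i) *: u i); rewrite addrK; apply.
  apply: submod_sum => // i ii0; case: (eqVneq (e 0 i) 0) => [->|nz].
    by rewrite rmorph0 scale0r.
  apply: CZ; have lti : (i < i0)%N by rewrite ltn_neqAle imax ?andbT.
  by apply: (mono i.+1) => //; [exact: ltnW|case: (hu i)].
move=> /(CZ (kap (e 0 i0)^-1)).
by rewrite scalerA -rmorphM mulVf // rmorph1 scale1r.
Qed.

Lemma max_chain_exists (V : Type) (Q : set V -> Prop) D :
  has_chain Q 0 -> (forall l, has_chain Q l -> (l <= D)%N) -> exists l, max_chain Q l.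
Proof.
move=> h0 hD; have ex : exists l, `[< has_chain Q l >] by exists 0%N; apply/asboolP.
have ub l : `[< has_chain Q l >] -> (l <= D)%N by move=> /asboolP; exact: hD.
case: (ex_maxnP ex ub) => l /asboolP hl lmax; exists l; split=> // k hk.
by apply: lmax; apply/asboolP.
Qed.

Hypothesis noethA : noetherian A.

(** The homology is finitely generated and killed both by [J] and, thanks to the homotopies, by the
    [z k]; hence it is finite over a quotient of finite dimension over [K]. *)
Lemma koszul_tor_length z n J : is_ideal J ->
  (exists (T : finType) (v : T -> A), forall a, exists c : T -> K,
     idl J z n (a - \sum_t kap (c t) * v t)) ->
  forall i, exists l, tor_length J (kdf z n) i l.
Proof.
move=> hJ [T [v hv]] i.
set Z := @tor_cycles A J (krk n) (kdf z n) i; set B := @tor_boundaries A J (krk n) (kdf z n) i.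
have BE w : B w <-> exists u, mxin J (w - u *m kdf z n i).
  split=> [[u h]|[u h]]; exists u; first by move=> a b; rewrite ord1; exact: h.
  by move=> b; exact: h.
have hB : submod B.
  split; rewrite /B.
  - by apply/BE; exists 0; rewrite mul0mx subr0; exact: mxin0.
  - move=> a b /BE[u hu] /BE[w hw]; apply/BE; exists (u + w).
    by rewrite mulmxDl opprD addrACA; exact: mxinD.
  - move=> c a /BE[u hu]; apply/BE; exists (c *: u).
    by rewrite -scalemxAl -scalerBr; exact: mxinZ.
have JB w : mxin J w -> B w by move=> h; apply/BE; exists 0; rewrite mul0mx subr0.
have [hZ BZ zZ] : [/\ submod Z, B `<=` Z & forall k w, (k < n)%N -> Z w -> B (z k *: w)].
  move: BE JB; rewrite /Z /B; clear hB Z B; case: i => [|i] BE JB /=.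
    split=> // k w kn _; have [h [h0 _]] := kdf_null_homotopic z kn.
    apply/BE; exists (w *m h 0%N); rewrite -mulmxA h0 mul_mx_scalar subrr; exact: mxin0.
  have ZE (w : 'rV[A]_(krk n i.+1)) : (forall j, J ((w *m kdf z n i) 0 j)) <-> mxin J (w *m kdf z n i).
    by split=> [h a b|h b]; [rewrite ord1; exact: h|exact: h].
  split.
  - split; rewrite /=.
    + by apply/ZE; rewrite mul0mx; exact: mxin0.
    + by move=> a b /ZE ha /ZE hb; apply/ZE; rewrite mulmxDl; exact: mxinD.
    + by move=> c a /ZE ha; apply/ZE; rewrite -scalemxAl; exact: mxinZ.
  - move=> w /BE[u hu]; apply/ZE.
    have := @mxinMl _ _ _ _ _ _ (kdf z n i) hJ hu.
    by rewrite mulmxBl -mulmxA kdf_complex mulmx0 subr0.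
  - move=> k w kn /ZE hw; have [h [_ hS]] := kdf_null_homotopic z kn.
    apply/BE; exists (w *m h i.+1).
    rewrite -mul_mx_scalar -(hS i) mulmxDr !mulmxA addrK.
    exact: mxinMl.
have idlB a w : idl J z n a -> Z w -> B (a *: w).
  move=> [c [j Jj ->]] Zw; rewrite scalerDl; have [_ BD BM] := hB; apply: BD.
    rewrite scaler_suml; apply: submod_sum => // k _; rewrite -scalerA; apply: BM; exact: zZ.
  by apply: JB => k l; rewrite mxE; apply: (idealMr _ hJ).
have [e [g [hg Zg]]] := noetherian_rV noethA hZ.
have sp w : Z w -> exists c : T * 'I_e -> K, B (w - \sum_t kap (c t) *: (v t.1 *: g t.2)).
  move=> /Zg[a [_ -> ->]]; rewrite addr0.
  have /choice[c hc] : forall j, exists c : T -> K, idl J z n (a j - \sum_t kap (c t) * v t).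
    by move=> j; exact: hv.
  exists (fun p : T * 'I_e => c p.2 p.1).
  rewrite -(pair_bigA _ (fun (t : T) (j : 'I_e) => kap (c j t) *: (v t *: g j))) exchange_big /= -sumrB.
  apply: submod_sum => // j _.
  under eq_bigr do rewrite scalerA.
  rewrite -scaler_suml -scalerBl; apply: idlB; [exact: hc|exact: hg].
apply: (@max_chain_exists _ _ #|{: T * 'I_e}|).
  by exists (fun=> B); split=> // j _; split.
by move=> l; apply: chain_length_le hB sp.
Qed.

(** Modulo [J] the two differentials agree, so that cycles and boundaries are the very same sets. *)
Lemma koszul_tor_length_congr z z' n J i l : is_ideal J ->
  (forall k, (k < n)%N -> J (z k - z' k)) ->
  tor_length J (kdf z n) i l -> tor_length J (kdf z' n) i l.
Proof.
move=> hJ hz; have zz' k : mxin J (kdf z n k - kdf z' n k) by exact: kdf_congr.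
have z'z k : mxin J (kdf z' n k - kdf z n k).
  by rewrite -opprB; apply: mxinN.
have EB : @tor_boundaries A J (krk n) (kdf z n) i = @tor_boundaries A J (krk n) (kdf z' n) i.
  apply/seteqP; split=> w [u hu]; exists u => j.
    have -> : w - u *m kdf z' n i = (w - u *m kdf z n i) + u *m (kdf z n i - kdf z' n i).
      by rewrite mulmxBr addrA subrK.
    by rewrite mxE; have [_ JD _] := hJ; apply: JD => //; apply: mxinMr.
  have -> : w - u *m kdf z n i = (w - u *m kdf z' n i) + u *m (kdf z' n i - kdf z n i).
    by rewrite mulmxBr addrA subrK.
  by rewrite mxE; have [_ JD _] := hJ; apply: JD => //; apply: mxinMr.
have EZ : @tor_cycles A J (krk n) (kdf z n) i = @tor_cycles A J (krk n) (kdf z' n) i.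
  case: i {EB} => //= i; apply/seteqP; split=> w /= hw j.
    have -> : w *m kdf z' n i = w *m kdf z n i + w *m (kdf z' n i - kdf z n i).
      by rewrite mulmxBr addrC subrK.
    by rewrite mxE; have [_ JD _] := hJ; apply: JD => //; apply: mxinMr.
  have -> : w *m kdf z n i = w *m kdf z' n i + w *m (kdf z n i - kdf z' n i).
    by rewrite mulmxBr addrC subrK.
  by rewrite mxE; have [_ JD _] := hJ; apply: JD => //; apply: mxinMr.
by rewrite /tor_length EB EZ.
Qed.

Lemma koszul_tor_length_gt z n J i l : (n < i)%N -> tor_length J (kdf z n) i l -> l = 0%N.
Proof.
move=> ni [[C [hC hlt]] _]; case: l hC hlt => // l hC hlt.
have [_ /nonsubset[u [Cu nCu]]] := hlt 0%N isT; case: nCu.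
have [[C0 _ _] _ _] := hC 0%N isT.
suff -> : u = 0 by [].
by apply/rowP => j; have := ltn_ord j; rewrite [X in (_ < X)%N]krk_gt.
Qed.

(** The order of the quantifiers is the point: [m] is chosen from [z] alone and serves every acyclic
    [z'] with the same residues modulo [J], whatever ideal [z'] generates. *)
Lemma koszul_serre_multiplicity z n J : is_ideal J ->
  (exists (T : finType) (v : T -> A), forall a, exists c : T -> K,
     idl J z n (a - \sum_t kap (c t) * v t)) ->
  exists m : int, forall z', (forall k, (k < n)%N -> J (z k - z' k)) ->
    acyclic_mod (kdf z' n) [set 0] -> serre_multiplicity (idl [set 0] z' n) J m.
Proof.
move=> hJ fin; have /choice[l hl] := koszul_tor_length hJ fin.
exists (\sum_(i < n.+1) (-1) ^+ i * (l i)%:Z) => z' hz ac.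
exists (krk n), (kdf z' n), (const_mx 1), l, n.+1; split=> //.
- exact: kdf_free_resolution.
- by move=> i; apply: koszul_tor_length_congr (hl i).
- by move=> i ni; apply: koszul_tor_length_gt (hl i).
Qed.

End TorLength.

(** * Displacement ideals of iterated endomorphisms *)

Lemma expr_gcdn1 (R : pzRingType) (c : R) n l :
  (0 < n)%N -> c ^+ n = 1 -> c ^+ l = 1 -> c ^+ gcdn n l = 1.
Proof.
move=> n0 cn cl; case: (egcdnP l n0) => u v e _.
have := congr1 (GRing.exp c) e.
by rewrite exprD mulnC exprM cn expr1n mulnC exprM cl expr1n mul1r => <-.
Qed.

(* The eigenvalues of the sum are sum_j lambda^(k j); if one vanishes, then
   lambda^n = 1, so lambda^L = 1, so lambda^k = 1 and the sum is n / k. *)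
Lemma geometric_sum_unitmx (K : closedFieldType) d (M : 'M[K]_d) :
  exists2 L, (0 < L)%N & forall n, (0 < n)%N -> n%:R != 0 :> K ->
    \sum_(j < n %/ gcdn n L) M ^+ (gcdn n L * j) \in unitmx.
Proof.
case: d M => [|d] M.
  by exists 1%N => // n _ _; rewrite unitmxE det_mx00 unitr1.
have [r rP] := closed_field_poly_normal (char_poly M).
(* [o c] is an exponent killing [c] when [c] is a root of unity, and a dummy positive value
   otherwise; [L] is its product over the eigenvalues. *)
have /choice[o ho] : forall c : K, exists o, (0 < o)%N /\
    forall n, (0 < n)%N -> c ^+ n = 1 -> c ^+ o = 1.
  move=> c; case: (pselect (exists2 n, (0 < n)%N & c ^+ n = 1)) => [[n n0 cn]|h].
    by exists n.
  by exists 1%N; split=> // n n0 cn; case: h; exists n.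
exists (\prod_(c <- r) o c)%N.
  by rewrite prodn_gt0 // => c; case: (ho c).
move=> n n0 nK; set L := (\prod_(c <- r) o c)%N; set k := gcdn n L; set q := (n %/ k)%N.
have nE : n = (k * q)%N by rewrite mulnC divnK // dvdn_gcdl.
pose p : {poly K} := \sum_(j < q) 'X^(k * j).
have -> : \sum_(j < q) M ^+ (k * j) = horner_mx M p.
  by rewrite raddf_sum; apply: eq_bigr => j _; rewrite /= rmorphXn /= horner_mx_X.
have pq c : c ^+ k = 1 -> p.[c] = q%:R.
  move=> ck; rewrite horner_sum; under eq_bigr do rewrite hornerXn exprM ck expr1n.
  by rewrite sumr_const card_ord.
have pk c : (c ^+ k - 1) * p.[c] = c ^+ n - 1.
  rewrite nE exprM [RHS]subrX1 horner_sum; congr (_ * _).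
  by apply: eq_bigr => j _; rewrite hornerXn exprM.
have qK : q%:R != 0 :> K by move: nK; rewrite nE natrM mulf_eq0 negb_or => /andP[].
have p0 : p != 0 by apply: contra qK => /eqP p0; rewrite -(pq 1 (expr1n _ _)) p0 horner0.
have nroot c : eigenvalue M c -> ~~ root p c.
  rewrite eigenvalue_root_char {1}rP rootZ ?root_prod_XsubC => [cr|]; last first.
    by rewrite lead_coef_eq0 monic_neq0 // char_poly_monic.
  apply/negP => /eqP pc.
  have cn : c ^+ n = 1 by apply/eqP; rewrite -subr_eq0 -pk pc mulr0.
  have cL : c ^+ L = 1.
    rewrite /L (big_rem c cr) /= exprM; have [_ h] := ho c.
    by rewrite (h n) // expr1n.
  have := pq c (expr_gcdn1 n0 cn cL); rewrite pc => /eqP; rewrite eq_sym.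
  by rewrite (negbTE qK).
(* No root of [p] is an eigenvalue of [M], so each linear factor of [p] is invertible at [M]. *)
have [s sP] := closed_field_poly_normal p.
have hs c : c \in s -> ~~ eigenvalue M c.
  move=> cs; apply: contraL (_ : root p c) => [/nroot//|].
  by rewrite sP rootZ ?root_prod_XsubC // lead_coef_eq0.
rewrite sP linearZ /= -mul_scalar_mx unitmx_mul unitmxE det_scalar unitrX ?unitfE ?lead_coef_eq0 //=.
elim: s hs {sP} => [|c s ih] hs; first by rewrite big_nil rmorph1 unitmx1.
rewrite big_cons rmorphM unitmx_mul ih ?andbT => [|e es]; last by apply: hs; rewrite inE es orbT.
rewrite rmorphB /= horner_mx_X horner_mx_C -row_free_unit -kermx_eq0.
by have := hs c (mem_head _ _); rewrite /eigenvalue /eigenspace negbK.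
Qed.

Section IteratedLinearPart.
Variables (K B : comNzRingType) (kap : {rmorphism K -> B}) (chi : {rmorphism B -> B}) (I : set B).
Hypotheses (hI : is_ideal I) (chi_kap : forall c, chi (kap c) = kap c).
Hypothesis chi_I : forall b, I b -> I (chi b).

Lemma map_mx_endo p q r (N : 'M[K]_(p, q)) (v : 'M[B]_(q, r)) :
  map_mx chi (map_mx kap N *m v) = map_mx kap N *m map_mx chi v.
Proof.
rewrite map_mxM; congr (_ *m _); apply/matrixP => a b; rewrite !mxE; exact: chi_kap.
Qed.

Lemma iter_linear_part d (M : 'M[K]_d) (v : 'cV[B]_d) j :
  mxin I (map_mx chi v - map_mx kap M *m v) ->
  mxin I (map_mx (iter j chi) v - map_mx kap (M ^+ j) *m v).
Proof.
move=> hv; elim: j => [|j ih].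
  have -> : map_mx (iter 0 chi) v = v by apply/matrixP => p q; rewrite !mxE.
  have -> : map_mx kap (M ^+ 0) = 1%:M by rewrite expr0; exact: map_mx1.
  by rewrite mul1mx subrr; exact: mxin0.
have -> : map_mx (iter j.+1 chi) v - map_mx kap (M ^+ j.+1) *m v =
    map_mx chi (map_mx (iter j chi) v - map_mx kap (M ^+ j) *m v) +
    map_mx kap (M ^+ j) *m (map_mx chi v - map_mx kap M *m v).
  rewrite map_mxB map_mx_endo mulmxBr mulmxA -map_mxM exprSr addrA subrK.
  by congr (_ - _); apply/matrixP => p q; rewrite !mxE.
apply: mxinD => //; last exact: mxinMr.
by move=> p q; rewrite mxE; apply: chi_I; exact: ih.
Qed.

End IteratedLinearPart.

Section Endomorphism.
Variables (K : closedFieldType) (B : comNzRingType) (kap : {rmorphism K -> B}) (ev : {rmorphism B -> K}).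
Hypothesis evK : forall c, ev (kap c) = c.
Hypothesis ev_unit : forall b, ev b != 0 -> exists b', b * b' = 1.
Hypothesis noethB : noetherian B.
Variables (x : nat -> B) (d : nat).
Hypothesis ev_x : forall i, ev (x i) = 0.
Hypothesis x_gen : forall b, ev b = 0 -> idl [set 0] x d b.

Definition evker : set B := [set b | ev b = 0].

Lemma evker_ideal : is_ideal evker. Proof. exact: rmorph_ker_ideal. Qed.

Lemma evker_jac a : evker a -> exists b, (1 - a) * b = 1.
Proof.
by move=> ha; apply: ev_unit; rewrite rmorphB rmorph1 ha subr0 oner_neq0.
Qed.

Lemma ev_kap_sub b : evker (b - kap (ev b)).
Proof. by rewrite /evker /= rmorphB evK subrr. Qed.

(** The product of the maximal ideal with the ideal generated by [g 0], ..., [g d.-1]. *)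
Definition midl (g : nat -> B) : set B :=
  [set b | exists2 e : nat -> B, (forall i, ev (e i) = 0) & b = \sum_(i < d) e i * g i].

Lemma midl_ideal g : is_ideal (midl g).
Proof.
split.
- by exists (fun=> 0) => [i|]; [rewrite rmorph0|rewrite big1 // => i _; rewrite mul0r].
- move=> _ _ [a ha ->] [b hb ->]; exists (fun i => a i + b i) => [i|].
    by rewrite rmorphD ha hb addr0.
  by under [RHS]eq_bigr do rewrite mulrDl; rewrite big_split.
- move=> c _ [a ha ->]; exists (fun i => c * a i) => [i|].
    by rewrite rmorphM ha mulr0.
  by rewrite mulr_sumr; apply: eq_bigr => i _; rewrite mulrA.
Qed.

Lemma midlM g u b : ev u = 0 -> idl [set 0] g d b -> midl g (u * b).
Proof.
move=> hu [c [_ -> ->]]; exists (fun i => u * c i) => [i|]; first by rewrite rmorphM hu mul0r.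
by rewrite addr0 mulr_sumr; apply: eq_bigr => i _; rewrite mulrA.
Qed.

Lemma midl_min g (I : set B) : is_ideal I ->
  (forall u i, ev u = 0 -> (i < d)%N -> I (u * g i)) -> midl g `<=` I.
Proof. by move=> hI h _ [e he ->]; apply: ideal_sum => // i _; apply: h. Qed.

Let X : 'cV[B]_d := \col_i x i.

Section OneEndomorphism.
Variable chi : {rmorphism B -> B}.
Hypothesis chi_kap : forall c, chi (kap c) = kap c.
Hypothesis ev_chi : forall b, ev (chi b) = ev b.

Definition disp (i : nat) : B := x i - chi (x i).
Let g := disp.
Let I := idl [set 0] g d.

Let hI : is_ideal I. Proof. by apply: idl_ideal; exact: ideal0. Qed.

(** Up to a constant b is a combination of the x_i, and c x - chi(c x) = c (x - chi x) + chi(x) (c -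
    chi c). So the ideal [Z] of all displacements lies in that of the [disp i] plus m [Z], and
    Nakayama applies. *)
Lemma sub_endo_idl b : idl [set 0] disp d (b - chi b).
Proof.
pose Z := [set a : B | forall E, is_ideal E -> (forall b, E (b - chi b)) -> E a].
have hZ : is_ideal Z.
  split.
  - by move=> E [].
  - by move=> u v hu hv E hE h; have [_ ED _] := hE; apply: ED; [exact: hu|exact: hv].
  - by move=> c u hu E hE h; have [_ _ EM] := hE; apply: EM; exact: hu.
suff ZI : Z `<=` I by apply: ZI => E hE h; exact: h.
apply: (nakayama_ideal evker_ideal evker_jac noethB) => // N hN IN mN.
move=> a Za; apply: Za => // b'; have [N0 ND NM] := hN.
have [c [_ -> hc]] := x_gen (ev_kap_sub b').
have -> : b' - chi b' = \sum_(i < d) (c i * disp i + chi (x i) * (c i - chi (c i))).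
  rewrite -[b'](subrK (kap (ev b'))) hc addr0 rmorphD chi_kap rmorph_sum.
  rewrite opprD addrACA subrr addr0 -sumrB; apply: eq_bigr => i _.
  by rewrite rmorphM /disp; ring.
apply: ideal_sum => // i _; apply: ND.
  by apply: NM; apply: IN; exact: idl_gen.
by apply: mN; [rewrite /evker /= ev_chi|move=> E hE h; exact: h].
Qed.

(** The same product rule; both terms now have a factor in the maximal ideal. *)
Lemma sub_endo_midl u : mpow x d 2 u -> midl disp (u - chi u).
Proof.
move=> [a ha ->]; rewrite rmorph_sum -sumrB; apply: ideal_sum; first exact: midl_ideal.
move=> i _; have -> : x i * a i - chi (x i * a i) = a i * disp i + chi (x i) * (a i - chi (a i)).
  by rewrite rmorphM /disp; ring.
have [_ MD _] := midl_ideal disp; apply: MD.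
  apply: midlM; last exact: idl_gen.
  have [c _ ->] := ha i (ltn_ord i); rewrite rmorph_sum big1 // => j _.
  by rewrite rmorphM ev_x mul0r.
by apply: midlM; [rewrite ev_chi|exact: sub_endo_idl].
Qed.

Lemma endo_midl u : midl disp u -> midl disp (chi u).
Proof.
move=> [e he ->]; rewrite rmorph_sum; apply: ideal_sum; first exact: midl_ideal.
move=> i _; rewrite rmorphM; apply: midlM; first by rewrite ev_chi.
rewrite -[chi _]opprK -[- chi _](addrK (disp i)) opprB; apply: idealB => //.
  exact: idl_gen.
by rewrite addrC; exact: sub_endo_idl.
Qed.

Variable M : 'M[K]_d.
Hypothesis chiX : mxin (mpow x d 2) (map_mx chi X - map_mx kap M *m X).

Let G : 'cV[B]_d := \col_i disp i.

(** For j = 1 the error is the displacement of chi X - M X, because G = X - chi X and [chi] fixes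
    the entries of [M]; as chi X - M X has entries in m^2, [sub_endo_midl] applies. *)
Lemma endo_disp j : mxin (midl disp) (map_mx (iter j chi) G - map_mx kap (M ^+ j) *m G).
Proof.
apply: (iter_linear_part (midl_ideal disp) chi_kap endo_midl).
have -> : map_mx chi G - map_mx kap M *m G =
    (map_mx chi X - map_mx kap M *m X) - map_mx chi (map_mx chi X - map_mx kap M *m X).
  have -> : G = X - map_mx chi X by apply/matrixP => p q; rewrite !mxE.
  rewrite !map_mxB mulmxBr (map_mx_endo chi_kap) !opprB addrACA [RHS]addrACA.
  by congr (_ + _); exact: addrC.
move: chiX; move: (map_mx chi X - map_mx kap M *m X) => Y hY p q.
by rewrite !mxE; apply: sub_endo_midl; exact: hY.
Qed.

(* x - chi^q x is the sum of the chi^j (x - chi x) for j < q. *)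
Lemma disp_iter q : \sum_(j < q) M ^+ j \in unitmx ->
  exists2 W : nat -> nat -> B,
    (forall i l : 'I_d, ev (W i l) = invmx (\sum_(j < q) M ^+ j) i l) &
    (forall i : 'I_d, disp i = \sum_(l < d) W i l * (x l - iter q chi (x l))).
Proof.
set S := \sum_(j < q) M ^+ j => Su.
pose f l := x l - iter q chi (x l); pose F : 'cV[B]_d := \col_l f l.
have hm := midl_ideal disp.
have fE l : f l = \sum_(j < q) iter j chi (disp l).
  rewrite /f; elim: q {S Su F f} => [|q ih]; first by rewrite subrr big_ord0.
  rewrite big_ord_recr -ih.
  have -> : iter q chi (disp l) = iter q chi (x l) - iter q.+1 chi (x l).
    rewrite iterSr /disp; elim: q {ih} => //= q ->; by rewrite rmorphB.
  by rewrite /= addrA subrK.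
have FS : mxin (midl disp) (F - map_mx kap S *m G).
  have -> : F - map_mx kap S *m G =
      \sum_(j < q) (map_mx (iter j chi) G - map_mx kap (M ^+ j) *m G).
    rewrite sumrB /S raddf_sum /= mulmx_suml; congr (_ - _).
    by apply/matrixP => p r; rewrite summxE mxE fE; apply: eq_bigr => j _; rewrite !mxE.
  by elim/big_ind: _ => [|a b|j _]; [exact: mxin0|exact: mxinD|exact: endo_disp].
have GF : mxin (midl disp) (G - map_mx kap (invmx S) *m F).
  have -> : G - map_mx kap (invmx S) *m F = - (map_mx kap (invmx S) *m (F - map_mx kap S *m G)).
    by rewrite mulmxBr mulmxA -map_mxM mulVmx // map_mx1 mul1mx opprB.
  by apply: mxinN => //; exact: mxinMr.
(* By Nakayama the displacements of the iterate generate [I] too: [GF] recovers the old ones from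
   them up to m [I]. *)
have If : I `<=` idl [set 0] f d.
  have hf := @idl_ideal _ [set 0] f d (@ideal0 B).
  apply: (nakayama_ideal evker_ideal evker_jac noethB) => // N hN fN mN.
  apply: idl_min => // [_ ->|i id]; first by case: hN.
  have := GF (Ordinal id) 0; rewrite !mxE => /(midl_min hN _) h.
  have {}h : N (disp i - \sum_(l < d) map_mx kap (invmx S) (Ordinal id) l * F l 0).
    by apply: h => u l hu ld; apply: mN => //; exact: idl_gen.
  rewrite -[g i](subrK (\sum_(l < d) map_mx kap (invmx S) (Ordinal id) l * F l 0)).
  have [_ ND NM] := hN; apply: ND => //; apply: ideal_sum => // l _; apply: NM.
  by rewrite mxE; apply: fN; exact: idl_gen.
(* Now the error lies in m times the ideal of the new displacements, so that it can be absorbed into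
   the coefficients without changing their values at the point. *)
have mgf : midl disp `<=` midl f.
  apply: midl_min; first exact: midl_ideal.
  by move=> u i hu id; apply: midlM => //; apply: If; exact: idl_gen.
have /choice[e he] : forall i : 'I_d, exists e : nat -> B, (forall l, ev (e l) = 0) /\
    disp i = \sum_(l < d) (kap (invmx S i l) + e l) * f l.
  move=> i; have := mgf _ (GF i 0); rewrite !mxE => -[e he eq]; exists e; split=> //.
  under eq_bigr do rewrite mulrDl.
  rewrite big_split /= -eq addrC -[LHS](subrK (\sum_(l < d) map_mx kap (invmx S) i l * F l 0)).
  by congr (_ + _); apply: eq_bigr => l _; rewrite !mxE.
exists (fun i l => if insub i is Some i' then
          if insub l is Some l' then kap (invmx S i' l') + e i' l else 0 else 0) => [i l|i].
  by rewrite !valK rmorphD evK; have [-> _] := he i; rewrite addr0.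
by have [_ ->] := he i; apply: eq_bigr => l _; rewrite !valK.
Qed.

End OneEndomorphism.

Lemma endo_linear_part (chi : {rmorphism B -> B}) : (forall b, ev (chi b) = ev b) ->
  exists M : 'M[K]_d, mxin (mpow x d 2) (map_mx chi X - map_mx kap M *m X).
Proof.
move=> ev_chi; have hx i : exists c : nat -> B, chi (x i) = \sum_(j < d) c j * x j.
  by have [|c [_ -> ->]] := @x_gen (chi (x i)); [rewrite ev_chi|exists c; rewrite addr0].
have /choice[c hc] := hx.
exists (\matrix_(i, j) ev (c i j)) => i k; rewrite !mxE hc -sumrB.
apply: ideal_sum; first exact: mpow_ideal.
move=> j _; rewrite !mxE -mulrBl; rewrite -[2%N]/(1 + 1)%N; apply: mpowM; last exact: mpow1.
have [a [_ -> ->]] := x_gen (ev_kap_sub (c i j)); rewrite addr0.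
by exists a => //; apply: eq_bigr => l _; rewrite mulrC.
Qed.

Lemma endo_linear_part_iter (chi : {rmorphism B -> B}) (M : 'M[K]_d) k :
  (forall c, chi (kap c) = kap c) -> (forall b, ev (chi b) = ev b) ->
  mxin (mpow x d 2) (map_mx chi X - map_mx kap M *m X) ->
  mxin (mpow x d 2) (map_mx (iter k chi) X - map_mx kap (M ^+ k) *m X).
Proof.
move=> chi_kap ev_chi; apply: iter_linear_part => //; first exact: mpow_ideal.
have m1 b : ev b = 0 -> mpow x d 1 b.
  move=> /x_gen[a [_ -> ->]]; rewrite addr0; exists a => //.
  by apply: eq_bigr => l _; rewrite mulrC.
have m1' b : mpow x d 1 b -> ev b = 0.
  by move=> [a _ ->]; rewrite rmorph_sum big1 // => i _; rewrite rmorphM ev_x mul0r.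
move=> _ [a ha ->]; rewrite rmorph_sum; apply: ideal_sum => [|i _]; first exact: mpow_ideal.
rewrite rmorphM -[2%N]/(1 + 1)%N; apply: mpowM; apply: m1; rewrite ev_chi //.
by apply: m1'; exact: ha.
Qed.

End Endomorphism.

(** * Multiplicities of graphs against the diagonal *)

Section Core.
Variables (K : closedFieldType) (A B : comNzRingType).
Variables (kap : {rmorphism K -> B}) (ev : {rmorphism B -> K}).
Variables (rho1 rho2 : {rmorphism B -> A}) (iota delta : {rmorphism A -> B}).
Variables (psi : nat -> {rmorphism B -> B}) (gam : nat -> {rmorphism A -> B}).
Hypothesis evK : forall c, ev (kap c) = c.
Hypothesis ev_unit : forall b, ev b != 0 -> exists b', b * b' = 1.
Hypothesis evd_unit : forall a, ev (delta a) != 0 -> exists a', a * a' = 1.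
Hypothesis rho_kap : forall c, rho1 (kap c) = rho2 (kap c).
Hypothesis iota_rho1 : forall b, iota (rho1 b) = kap (ev b).
Hypothesis iota_rho2 : forall b, iota (rho2 b) = b.
Hypothesis delta_rho1 : forall b, delta (rho1 b) = b.
Hypothesis delta_rho2 : forall b, delta (rho2 b) = b.
Hypothesis gam_rho1 : forall n b, gam n (rho1 b) = b.
Hypothesis gam_rho2 : forall n b, gam n (rho2 b) = psi n b.
Hypothesis ev_iota : forall a, ev (iota a) = ev (delta a).
Hypothesis ev_gam : forall n a, ev (gam n a) = ev (delta a).
Hypothesis psi_kap : forall n c, psi n (kap c) = kap c.
Hypothesis psi_iter : forall n b, psi n b = iter n (psi 1%N) b.
Hypotheses (noethA : noetherian A) (noethB : noetherian B).

(** The image of B (x) B. In the application [rho1] and [rho2] are the pullbacks along the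
    projections, [iota], [delta] and [gam n] those along y |-> (P, y), y |-> (y, y) and y |-> (y,
    phi^n y), and [psi n] is the pullback along phi^n. The tensor product is never formed:
    [tens_loc] and [tens_inj] replace it. *)
Definition tens : set A :=
  [set a | exists n (b c : nat -> B), a = \sum_(i < n) rho1 (b i) * rho2 (c i)].

(* A is a localization of the tensor product of B with itself over K. *)
Hypothesis tens_loc : forall a, exists h, [/\ tens h, ev (delta h) != 0 & tens (h * a)].

Definition kindep (n : nat) (c : nat -> B) : Prop :=
  forall k : nat -> K, \sum_(i < n) kap (k i) * c i = 0 -> forall i, (i < n)%N -> k i = 0.

Hypothesis tens_inj : forall n (b c : nat -> B), kindep n c ->
  \sum_(i < n) rho1 (b i) * rho2 (c i) = 0 -> forall i, (i < n)%N -> b i = 0.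

Variables (x : nat -> B) (d : nat).
Hypothesis ev_x : forall i, ev (x i) = 0.
Hypothesis x_gen : forall b, ev b = 0 -> idl [set 0] x d b.
Hypothesis B_chain : has_chain (@is_prime_ideal B) d.

Hypothesis fin_quot : forall n, (0 < n)%N ->
  exists (T : finType) (v : T -> B), forall b, exists c : T -> K,
    idl [set 0] (fun i => x i - psi n (x i)) d (b - \sum_t kap (c t) * v t).

Lemma ev_psi n b : ev (psi n b) = ev b.
Proof. by rewrite -gam_rho2 ev_gam delta_rho2. Qed.

(** Any [d] generators of the maximal ideal will do, because the chain of primes does not depend on
    them; besides [x] this is applied to linear changes of [x]. *)
Lemma generators_regular (y : nat -> B) : (forall i, (i < d)%N -> ev (y i) = 0) ->
  (forall b, ev b = 0 -> idl [set 0] y d b) ->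
  forall k b, (k < d)%N -> idl [set 0] y k (b * y k) -> idl [set 0] y k b.
Proof.
move=> ev_y y_gen.
have mE b : mpow y d 1 b <-> ev b = 0.
  split=> [[c _ ->]|/y_gen[c [_ -> ->]]].
    by rewrite rmorph_sum big1 // => i _; rewrite rmorphM ev_y ?mul0r.
  by rewrite addr0; exists c => //; apply: eq_bigr => i _; rewrite mulrC.
have res b : exists c, mpow y d 1 (b - kap c).
  by exists (ev b); apply/mE; exact: (ev_kap_sub evK b).
have jac b : mpow y d 1 b -> exists b', (1 - b) * b' = 1.
  by move=> /mE hb; apply: (evker_jac ev_unit).
have prop : ~ mpow y d 1 1 by move=> /mE/eqP; rewrite rmorph1 oner_eq0.
move=> k b; apply: (regular_sequence noethB res jac).
exact: (quasi_regular_of_chain noethB res jac prop).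
Qed.

(** Once the second factors are fixed and independent, [tens_inj] allows comparison of the first
    factors one by one. *)
Definition rep n (c : nat -> B) : set A :=
  [set a | exists b : nat -> B, a = \sum_(i < n) rho1 (b i) * rho2 (c i)].

Lemma rep_cat n c n' c' : exists c'', rep n c `<=` rep (n + n') c'' /\ rep n' c' `<=` rep (n + n') c''.
Proof.
exists (fun i => if (i < n)%N then c i else c' (i - n)%N); split=> a [b ->].
  exists (fun i => if (i < n)%N then b i else 0); rewrite big_split_ord /=.
  rewrite [X in _ = _ + X]big1 ?addr0 => [|i _]; last by rewrite ltnNge leq_addr rmorph0 mul0r.
  by apply: eq_bigr => i _; rewrite ltn_ord.
exists (fun i => if (i < n)%N then 0 else b (i - n)%N); rewrite big_split_ord /=.
rewrite [X in _ = X + _]big1 ?add0r => [|i _]; last by rewrite ltn_ord rmorph0 mul0r.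
by apply: eq_bigr => i _; rewrite ltnNge leq_addr /= addKn.
Qed.

(** A dependent second factor is expressed by the others; the scalars pass to the first factors
    because [rho1] and [rho2] agree on constants. *)
Lemma rep_indep n c : exists n' c', kindep n' c' /\ rep n c `<=` rep n' c'.
Proof.
elim: n c => [|n ih] c; first by exists 0%N, c; split=> [k _ i //|a].
case: (pselect (kindep n.+1 c)) => [h|]; first by exists n.+1, c; split=> [//|a].
move=> /existsNP[k /not_implyP[k0 /existsNP[i /not_implyP[ilt /eqP ki]]]].
pose i0 := Ordinal ilt.
pose c' j := if insub j is Some j' then c (lift i0 j') else 0.
have [n' [c'' [hc'' sub]]] := ih c'; exists n', c''; split=> [//|a [b ->]]; apply: sub.
exists (fun j => if insub j is Some j' then
   b (lift i0 j') - b i * kap ((k i)^-1 * k (lift i0 j')) else 0).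
rewrite (bigD1_ord i0) //=.
have -> : rho2 (c i) = - \sum_(j < n) rho1 (kap ((k i)^-1 * k (lift i0 j))) * rho2 (c (lift i0 j)).
  have := congr1 (fun t => rho2 (kap (k i)^-1 * t)) k0.
  rewrite (bigD1_ord i0) //= mulrDr mulrA -rmorphM mulVf // rmorph1 mul1r mulr0 rmorph0 rmorphD.
  move/eqP; rewrite addr_eq0 => /eqP ->; congr (- _).
  rewrite mulr_sumr rmorph_sum; apply: eq_bigr => j _.
  by rewrite mulrA -rmorphM rho_kap [LHS]rmorphM.
rewrite mulrN mulr_sumr addrC -sumrB; apply: eq_bigr => j _.
by rewrite /c' !valK [rho1 (b _ - _)]rmorphB [rho1 (b i * _)]rmorphM mulrBl mulrA.
Qed.

Lemma tensD a a' : tens a -> tens a' -> tens (a + a').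
Proof.
move=> [n [b [c ->]]] [n' [b' [c' ->]]]; have [c'' [h h']] := rep_cat n c n' c'.
have [|e ->] := h (\sum_(i < n) rho1 (b i) * rho2 (c i)); first by exists b.
have [|e' ->] := h' (\sum_(i < n') rho1 (b' i) * rho2 (c' i)); first by exists b'.
exists (n + n')%N, (fun i => e i + e' i), c''; rewrite -big_split.
by apply: eq_bigr => i _; rewrite rmorphD mulrDl.
Qed.

Lemma tensM a a' : tens a -> tens a' -> tens (a * a').
Proof.
have t0 : tens 0 by exists 0%N, (fun=> 0), (fun=> 0); rewrite big_ord0.
move=> [n [b [c ->]]] [n' [b' [c' ->]]]; rewrite mulr_suml.
elim/big_ind: _ => [//||i _]; first exact: tensD.
rewrite mulr_sumr; elim/big_ind: _ => [//||j _]; first exact: tensD.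
exists 1%N, (fun=> b i * b' j), (fun=> c i * c' j).
by rewrite big_ord1 !rmorphM mulrACA.
Qed.

(** One denominator and one independent family of second factors for finitely many elements, so that
    a relation between them can be read in [B]. *)
Lemma tens_common l (a : nat -> A) : exists h, [/\ tens h, ev (delta h) != 0 &
  exists n c, kindep n c /\ forall i, (i < l)%N -> rep n c (h * a i)].
Proof.
have [h [th h0 ha]] : exists h, [/\ tens h, ev (delta h) != 0 & forall i, (i < l)%N -> tens (h * a i)].
  elim: l => [|l [h [th h0 ha]]].
    exists 1; split=> //; last by rewrite !rmorph1 oner_neq0.
    by exists 1%N, (fun=> 1), (fun=> 1); rewrite big_ord1 !rmorph1 mulr1.
  have [h' [th' h0' ha']] := tens_loc (a l); exists (h * h'); split.
  - exact: tensM.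
  - by rewrite !rmorphM mulf_neq0.
  - move=> i; rewrite ltnS leq_eqVlt => /orP[/eqP ->|/ha ti].
      by rewrite -mulrA; apply: tensM.
    by rewrite mulrAC mulrC; apply: tensM.
exists h; split=> //.
suff [n [c hc]] : exists n c, forall i, (i < l)%N -> rep n c (h * a i).
  have [n' [c' [ic' sub]]] := rep_indep n c; exists n', c'; split=> // i /hc; exact: sub.
elim: l ha => [|l ih] ha; first by exists 0%N, (fun=> 0).
have [n [c hc]] := ih (fun i il => ha i (ltnW il)).
have [n' [b' [c' e]]] := ha l (leqnn _).
have [c'' [s1 s2]] := rep_cat n c n' c'; exists (n + n')%N, c'' => i.
rewrite ltnS leq_eqVlt => /orP[/eqP ->|/hc]; last exact: s1.
by apply: s2; exists b'.
Qed.

Let r1 := fun i => rho1 (x i).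

Lemma idl0_ideal_A (y : nat -> A) k : is_ideal (idl [set 0] y k).
Proof. by apply: idl_ideal; exact: ideal0. Qed.

Lemma rho1_idl k b : idl [set 0] x k b -> idl [set 0] r1 k (rho1 b).
Proof.
move=> [c [_ -> ->]]; exists (fun i => rho1 (c i)), 0; rewrite // !addr0 rmorph_sum.
by apply: eq_bigr => i _; rewrite rmorphM.
Qed.

Lemma unit_cancel (I : set A) h a : is_ideal I -> ev (delta h) != 0 -> I (h * a) -> I a.
Proof.
move=> [_ _ IM] /evd_unit[h' hh'] /(IM h').
by rewrite mulrA [h' * h]mulrC hh' mul1r.
Qed.

(** Flatness of A over its first factor in elementary terms: after clearing denominators the
    relation holds for the coefficients in [B], where the parameters are regular. *)
Lemma rho1_regular k a : (k < d)%N -> idl [set 0] r1 k (a * r1 k) -> idl [set 0] r1 k a.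
Proof.
move=> kd [e [_ -> eqa]]; rewrite addr0 in eqa.
have [h [_ h0 [n [c [ic hrep]]]]] := tens_common k.+1 (fun i => if i == k then a else e i).
apply: (unit_cancel (idl0_ideal_A _ _) h0).
have /choice[b hb] : forall i, exists b : nat -> B, (i < k)%N ->
    h * e i = \sum_(j < n) rho1 (b j) * rho2 (c j).
  move=> i; case: (boolP (i < k)%N) => [ik|_]; last by exists (fun=> 0).
  have [b] := hrep i (ltnW ik); rewrite ltn_eqF // => hb; by exists b.
have [b0] := hrep k (leqnn _); rewrite eqxx => hb0.
have key j : (j < n)%N -> b0 j * x k = \sum_(i < k) b i j * x i.
  move=> jn; apply/eqP; rewrite -subr_eq0; apply/eqP.
  apply: (tens_inj ic (b := fun j => b0 j * x k - \sum_(i < k) b i j * x i)) jn.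
  under eq_bigr do rewrite rmorphB rmorphM mulrBl mulrAC rmorph_sum mulr_suml.
  rewrite sumrB -mulr_suml -hb0 -mulrA eqa mulr_sumr exchange_big /= -sumrB big1 // => i _.
  rewrite mulrA hb // mulr_suml -sumrB big1 // => l _.
  by rewrite rmorphM mulrAC subrr.
rewrite hb0; apply: ideal_sum; first exact: idl0_ideal_A.
move=> j _; apply: (idealMr _ (idl0_ideal_A _ _)); apply: rho1_idl.
apply: (generators_regular (fun i _ => ev_x i) x_gen kd).
by exists (fun i => b i j), 0; rewrite // addr0 key.
Qed.

(** After clearing denominators, replacing each first factor by its value at the point turns the sum
    into [rho2] of [iota (h * a)], which is 0; the differences vanish at the point. *)
Lemma iota_ker a : iota a = 0 -> idl [set 0] r1 d a.
Proof.
move=> ia; have [h [_ h0 [n [b [c e]]]]] := tens_loc a.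
apply: (unit_cancel (idl0_ideal_A _ _) h0).
have h1 : \sum_(i < n) kap (ev (b i)) * c i = 0.
  have := congr1 iota e; rewrite rmorphM ia mulr0 rmorph_sum => /esym h1.
  by apply: etrans h1; apply: eq_bigr => i _; rewrite rmorphM iota_rho1 iota_rho2.
have -> : h * a = \sum_(i < n) rho1 (b i - kap (ev (b i))) * rho2 (c i).
  under eq_bigr do rewrite rmorphB mulrBl.
  rewrite sumrB -e.
  have -> : \sum_(i < n) rho1 (kap (ev (b i))) * rho2 (c i) = rho2 (\sum_(i < n) kap (ev (b i)) * c i).
    by rewrite rmorph_sum; apply: eq_bigr => i _; rewrite rmorphM rho_kap.
  by rewrite h1 rmorph0 subr0.
apply: ideal_sum; first exact: idl0_ideal_A.
move=> j _; apply: (idealMr _ (idl0_ideal_A _ _)); apply: rho1_idl; apply: x_gen.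
exact: (ev_kap_sub evK).
Qed.

Definition mA : set A := [set a | ev (delta a) = 0].

Lemma mA_ideal : is_ideal mA. Proof. exact: (rmorph_ker_ideal (ev \o delta)). Qed.

Lemma mA_jac a : mA a -> exists b, (1 - a) * b = 1.
Proof. by move=> ha; apply: evd_unit; rewrite !rmorphB !rmorph1 ha subr0 oner_neq0. Qed.

Definition gker n : set A := [set a | gam n a = 0].

Lemma gker_ideal n : is_ideal (gker n). Proof. exact: rmorph_ker_ideal. Qed.

Definition dker : set A := [set a | delta a = 0].

Lemma dker_ideal : is_ideal dker. Proof. exact: rmorph_ker_ideal. Qed.

Section Graph.
Variable n : nat.

Definition gt (i : nat) : A := rho2 (x i) - rho1 (psi n (x i)).

Lemma gam_gt i : gam n (gt i) = 0.
Proof. by rewrite rmorphB gam_rho1 gam_rho2 subrr. Qed.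

Lemma iota_gt i : iota (gt i) = x i.
Proof. by rewrite rmorphB iota_rho1 iota_rho2 ev_psi ev_x rmorph0 subr0. Qed.

Lemma mA_gen a : mA a -> idl (idl [set 0] r1 d) gt d a.
Proof.
move=> ma; have hI := idl0_ideal_A r1 d; have hG := @idl_ideal _ (idl [set 0] r1 d) gt d hI.
have [|c [_ -> ic]] := @x_gen (iota a); first by rewrite ev_iota.
have := iota_ker (_ : iota (a - \sum_(i < d) rho2 (c i) * rho2 (x i)) = 0).
move=> /(_ _)/(fun h => idl_base gt d h) => h.
rewrite -[a](subrK (\sum_(i < d) rho2 (c i) * rho2 (x i))); have [_ GD GM] := hG; apply: (GD).
  apply: h; rewrite rmorphB ic addr0 rmorph_sum.
  by under [X in _ - X]eq_bigr do rewrite -rmorphM iota_rho2; rewrite subrr.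
apply: ideal_sum => // i _; apply: (GM).
rewrite -[rho2 _](subrK (rho1 (psi n (x i)))); apply: (GD).
  by apply: idl_gen => //; case: hI.
by apply: idl_base; apply: rho1_idl; apply: x_gen; rewrite ev_psi.
Qed.

(** Modulo the [gt i], an element of the graph ideal is a sum of e_i (x_i (x) 1) with vanishing
    restriction to the graph. Subtracting from e_i the pullback of its restriction does not change
    the sum, which thus lies in m times the graph ideal. *)
Lemma gker_gen : gker n `<=` idl [set 0] gt d.
Proof.
apply: (nakayama_ideal mA_ideal mA_jac noethA (idl0_ideal_A _ _) (gker_ideal n)) => N hN tN mN a ga.
have [|c [_ [e [_ -> ->]] aE]] := @mA_gen a.
  by rewrite /mA /= -(ev_gam n) ga rmorph0.
rewrite addr0 in aE; have [_ ND NM] := hN.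
have eg : \sum_(i < d) gam n (e i) * x i = 0.
  have := ga; rewrite /gker /= aE rmorphD !rmorph_sum big1 ?add0r => [h|i _]; last first.
    by rewrite rmorphM gam_gt mulr0.
  by apply: etrans h; apply: eq_bigr => i _; rewrite rmorphM gam_rho1.
rewrite aE; apply: (ND).
  by apply: ideal_sum => // i _; apply: (NM); apply: tN; exact: idl_gen.
have -> : \sum_(i < d) e i * r1 i = \sum_(i < d) r1 i * (e i - rho1 (gam n (e i))).
  under [RHS]eq_bigr do rewrite mulrBr [_ * e _]mulrC.
  rewrite sumrB.
  have -> : \sum_(i < d) r1 i * rho1 (gam n (e i)) = rho1 (\sum_(i < d) gam n (e i) * x i).
    by rewrite rmorph_sum; apply: eq_bigr => i _; rewrite rmorphM mulrC.
  by rewrite eg rmorph0 subr0.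
apply: ideal_sum => // i _; apply: mN.
  by rewrite /mA /= delta_rho1 ev_x.
by rewrite /gker /= rmorphB gam_rho1 subrr.
Qed.

Section ChangeOfGenerators.
Variables (S : 'M[K]_d) (W : nat -> nat -> B).
Hypothesis S_unit : S \in unitmx.
Hypothesis W_S : forall i l : 'I_d, ev (W i l) = S i l.

(** For suitable [W] these become, modulo the diagonal, the displacements of another iterate; so
    regularity is proved for all [W] with invertible value at the point. *)
Definition gt' (i : nat) : A := \sum_(l < d) rho1 (W i l) * gt l.

Lemma iota_gt' (i : 'I_d) : iota (gt' i) = \sum_(l < d) kap (S i l) * x l.
Proof.
rewrite rmorph_sum; apply: eq_bigr => l _.
by rewrite rmorphM iota_rho1 iota_gt W_S.
Qed.

Lemma invS_gt' (R : comNzRingType) (f : {rmorphism K -> R}) (y : nat -> R) (l : 'I_d) :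
  \sum_(i < d) f (invmx S l i) * (\sum_(j < d) f (S i j) * y j) = y l.
Proof.
under eq_bigr do rewrite mulr_sumr; rewrite exchange_big /= (bigD1 l) //=.
have e (j : 'I_d) : \sum_(i < d) f (invmx S l i) * (f (S i j) * y j) = f ((l == j)%:R) * y j.
  under eq_bigr do rewrite mulrA -rmorphM; rewrite -mulr_suml -rmorph_sum.
  congr (f _ * _); have := mulVmx S_unit => /matrixP/(_ l j); rewrite !mxE => <-.
  by [].
rewrite e eqxx rmorph1 mul1r big1 ?addr0 // => j jl.
by rewrite e eq_sym (negbTE jl) rmorph0 mul0r.
Qed.

(** Nakayama again: the constant inverse of [S] recovers the [gt l] from the [gt' i] up to the
    coefficients [W i j - kap (S i j)], which vanish at the point. *)
Lemma gker_gen' : gker n = idl [set 0] gt' d.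
Proof.
have hI' := idl0_ideal_A gt' d.
apply/seteqP; split; last first.
  apply: idl_min; [exact: gker_ideal|by move=> _ ->; case: (gker_ideal n)|].
  move=> i id; rewrite /gker /= rmorph_sum big1 // => l _.
  by rewrite rmorphM gam_gt mulr0.
apply: (nakayama_ideal mA_ideal mA_jac noethA hI' (gker_ideal n)) => N hN tN mN a /gker_gen.
apply: idl_min => // [_ ->|l ld]; first by case: hN.
have [_ ND NM] := hN; pose l' := Ordinal ld.
pose kA : {rmorphism K -> A} := GRing.RMorphism.clone _ _ (rho1 \o kap) _.
have -> : gt l = \sum_(i < d) kA (invmx S l' i) * gt' i -
    \sum_(i < d) kA (invmx S l' i) * (\sum_(j < d) rho1 (W i j - kap (S i j)) * gt j).
  rewrite -sumrB -[LHS](invS_gt' kA gt l'); apply: eq_bigr => i _.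
  rewrite -mulrBr -sumrB; congr (_ * _); apply: eq_bigr => j _.
  by rewrite rmorphB mulrBl opprB addrC subrK.
apply: idealB => //; apply: ideal_sum => // i _; apply: NM.
  by apply: tN; exact: idl_gen.
apply: ideal_sum => // j _; apply: mN; last exact: gam_gt.
by rewrite /mA /= delta_rho1 rmorphB evK W_S subrr.
Qed.

Lemma gt'_acyclic : acyclic_mod (kdf gt' d) [set 0].
Proof.
(* Modulo the [r1 i] the ring becomes [B] through [iota], and the [gt' i] become the parameters
   transformed by [S], hence again [d] generators of the maximal ideal. *)
have reg k a : (k < d)%N -> idl (idl [set 0] r1 d) gt' k (a * gt' k) ->
    idl (idl [set 0] r1 d) gt' k a.
  move=> kd [c [q [e [_ -> ->]] eqa]].
  pose y i := iota (gt' i).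
  have yE (i : 'I_d) : y i = \sum_(l < d) kap (S i l) * x l by exact: iota_gt'.
  have iy0 : idl [set 0] y k (iota a).
    apply: (@generators_regular y) => //.
    - move=> i id; rewrite (yE (Ordinal id)) rmorph_sum big1 // => l _.
      by rewrite rmorphM ev_x mulr0.
    - move=> b /x_gen[b' [_ -> ->]]; rewrite addr0; apply: ideal_sum => [|l _].
        by apply: idl_ideal; exact: ideal0.
      have hy : is_ideal (idl [set 0] y d) by apply: idl_ideal; exact: ideal0.
      have [_ _ hM] := hy; apply: (hM); rewrite -(invS_gt' kap x l).
      by apply: ideal_sum => // i _; apply: (hM); rewrite -yE; exact: idl_gen.
    - have := congr1 iota eqa; rewrite addr0 rmorphM rmorphD.
      rewrite [X in _ = X + _]rmorph_sum [X in _ = _ + X]rmorph_sum -/(y k) => ->.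
      exists (fun i => iota (c i)), 0 => //; congr (_ + _).
        by apply: eq_bigr => i _; rewrite rmorphM.
      by rewrite big1 // => i _; rewrite rmorphM iota_rho1 ev_x rmorph0 mulr0.
  have [c' [_ -> ic']] := iy0.
  exists (fun i => rho2 (c' i)), (a - \sum_(i < k) rho2 (c' i) * gt' i); last by rewrite addrC subrK.
  apply: iota_ker; rewrite rmorphB ic' addr0 rmorph_sum.
  by under [X in _ - X]eq_bigr do rewrite rmorphM iota_rho2; rewrite subrr.
have ac : acyclic_mod (kdf gt' d) (idl [set 0] r1 d).
  by apply: kdf_acyclic => //; exact: idl0_ideal_A.
(* The [r1 i] are discarded one at a time, the last one first, since each is a nonzerodivisor modulo
   its predecessors. *)
suff main k : (k <= d)%N -> acyclic_mod (kdf gt' d) (idl [set 0] r1 (d - k)).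
  have h := main d (leqnn _); rewrite subnn in h.
  move=> i v hv; have [|w hw] := h i v; first by move=> a b; apply: idl_base; exact: hv.
  by exists w => a b; have [c [q -> ->]] := hw a b; rewrite big_ord0 addr0.
elim: k => [|k ih] kd; first by rewrite subn0.
have lt : (d - k.+1 < d)%N by rewrite ltn_subrL /=; apply: leq_trans kd.
have dE : (d - k = (d - k.+1).+1)%N by rewrite -subSn // subSS.
apply: (acyclic_mod_nakayama mA_ideal mA_jac noethA (y := r1 (d - k.+1)%N)
  (Q' := idl [set 0] r1 (d - k))); last exact: ih (ltnW kd).
- exact: kdf_complex.
- exact: idl0_ideal_A.
- by rewrite /mA /= delta_rho1 ev_x.
- by move=> a; apply: rho1_regular.
- by move=> a h; rewrite dE; apply/idlS; exists 0; rewrite mul0r subr0.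
- by move=> a; rewrite dE => /idlS.
Qed.

End ChangeOfGenerators.
End Graph.

Lemma gt_fin n : (0 < n)%N -> exists (T : finType) (v : T -> A), forall a, exists c : T -> K,
  idl dker (gt n) d (a - \sum_t rho1 (kap (c t)) * v t).
Proof.
move=> n0; have [T [v hv]] := fin_quot n0; exists T, (fun t => rho1 (v t)) => a.
have [c [b [_ -> hb]]] := hv (delta a); exists c.
exists (fun i => rho1 (b i)), (a - \sum_t rho1 (kap (c t)) * rho1 (v t) - \sum_(i < d) rho1 (b i) * gt n i).
  rewrite /dker /= !rmorphB !rmorph_sum /=.
  under eq_bigr do rewrite rmorphM !delta_rho1.
  rewrite hb addr0; apply/eqP; rewrite subr_eq0; apply/eqP/eq_bigr => i _.
  by rewrite rmorphM rmorphB !delta_rho1 delta_rho2.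
by rewrite [RHS]addrC subrK.
Qed.

Theorem core_bound : exists C : nat, forall n, (0 < n)%N -> n%:R != 0 :> K ->
  exists m : int, serre_multiplicity (gker n) dker m /\ `|m| <= C%:Z.
Proof.
pose kA : {rmorphism K -> A} := GRing.RMorphism.clone _ _ (rho1 \o kap) _.
have /choice[mm hmm] : forall k, exists m : int, (0 < k)%N -> forall z',
    (forall i, (i < d)%N -> dker (gt k i - z' i)) ->
    acyclic_mod (kdf z' d) [set 0] -> serre_multiplicity (idl [set 0] z' d) dker m.
  case=> [|k]; first by exists 0.
  have [m hm] := @koszul_serre_multiplicity K A kA noethA (gt k.+1) d dker dker_ideal (gt_fin (ltn0Sn k)).
  by exists m => _.
have [M hM] := endo_linear_part evK ev_x x_gen (ev_psi 1).
have [L L0 hL] := geometric_sum_unitmx M.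
(* Every gcd with [L] is at most [L], so this bounds all the values [mm k] that occur. *)
exists (\sum_(k < L.+1) `|mm k|)%N => n n0 nK.
set k := gcdn n L in hL *.
have k0 : (0 < k)%N by rewrite gcdn_gt0 n0.
have hS := hL n n0 nK; rewrite -/k in hS.
have psi_it b : iter k (psi 1) b = psi k b by rewrite psi_iter.
have hMk : mxin (mpow x d 2) (map_mx (psi k) (\col_i x i) - map_mx kap (M ^+ k) *m (\col_i x i)).
  have := endo_linear_part_iter ev_x x_gen k (psi_kap 1) (ev_psi 1) hM.
  by congr (mxin _ (_ - _)); apply/matrixP => i j; rewrite !mxE psi_it.
have hS' : \sum_(j < n %/ k) (M ^+ k) ^+ j \in unitmx.
  by move: hS; under eq_bigr do rewrite exprM.
(* [W] expresses the displacements of phi^k by those of phi^n; the same coefficients recombine the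
   generators of the graph ideal of phi^n. *)
have [W WS hW] := disp_iter evK ev_unit noethB ev_x x_gen (psi_kap k) (ev_psi k) hMk hS'.
have psi_n b : iter (n %/ k) (psi k) b = psi n b.
  have -> : iter (n %/ k) (psi k) b = iter (n %/ k) (iter k (psi 1)) b.
    by elim: (n %/ k)%N => //= q ->; rewrite psi_it.
  by rewrite -iterM divnK ?dvdn_gcdl // psi_iter.
exists (mm k); split.
  have hinv : invmx (\sum_(j < n %/ k) (M ^+ k) ^+ j) \in unitmx by rewrite unitmx_inv.
  rewrite (gker_gen' n hinv WS); apply: hmm => //; last exact: gt'_acyclic hinv WS.
  move=> i id; rewrite /dker /= rmorphB [delta (gt k i)]rmorphB delta_rho1 delta_rho2.
  apply/eqP; rewrite subr_eq0; apply/eqP; rewrite -[LHS]/(disp x (psi k) (Ordinal id)) hW rmorph_sum.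
  apply: eq_bigr => l _; rewrite rmorphM delta_rho1 rmorphB delta_rho1 delta_rho2.
  by rewrite psi_n.
have kL : (k < L.+1)%N by rewrite ltnS dvdn_leq // dvdn_gcdr.
rewrite -abszE lez_nat (bigD1 (Ordinal kL)) //=; exact: leq_addr.
Qed.

End Core.

(** * The Nullstellensatz *)

Lemma prime_ideal_preim (R S : comPzRingType) (f : {rmorphism R -> S}) (P : set S) :
  is_prime_ideal P -> is_prime_ideal [set a | P (f a)].
Proof.
move=> [[P0 PD PM] P1 Pmul]; split; rewrite /=.
- split; rewrite /= ?rmorph0 //.
    by move=> a b; rewrite rmorphD; exact: PD.
  by move=> c a; rewrite rmorphM; exact: PM.
- by rewrite rmorph1.
- by move=> a b; rewrite rmorphM; exact: Pmul.
Qed.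

Section PolynomialPrimes.
Variables (K : closedFieldType) (R : idomainType) (T : Type) (e : T -> {rmorphism R -> K}).
Hypothesis R_points : forall (p : set R) s, is_prime_ideal p -> ~ p s ->
  exists t, (forall a, p a -> e t a = 0) /\ e t s != 0.
Variable P : set {poly R}.
Hypothesis P_prime : is_prime_ideal P.

Let p : set R := [set a | P a%:P].

Let hP : is_ideal P. Proof. by case: P_prime. Qed.

Lemma contraction_prime : is_prime_ideal p.
Proof. exact: (prime_ideal_preim (@polyC R) P_prime). Qed.

Lemma extension_sub (f : {poly R}) : (forall i, p f`_i) -> P f.
Proof.
move=> h; rewrite -[f]coefK poly_def; apply: ideal_sum => // i _.
by rewrite -mul_polyC; apply: (idealMr _ hP); exact: h.
Qed.

(** A leading term with coefficient in [p] belongs to [P] and may be subtracted; this stands for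
    reduction modulo [p]. *)
Lemma strip_leading (I : set {poly R}) f i : is_ideal I -> P `<=` I -> I f -> ~ p f`_i ->
  exists g, [/\ I g, (size g <= size f)%N & ~ p (lead_coef g)].
Proof.
move=> hI PI; elim: (size f) {-2}f (leqnn (size f)) => [|n ih] {}f sf If fi.
  case: fi; move: sf; rewrite size_poly_leq0 => /eqP ->; rewrite coef0.
  by have [[]] := contraction_prime.
case: (pselect (p (lead_coef f))) => [pl|]; last by exists f.
pose h := f - lead_coef f *: 'X^((size f).-1).
have Ih : I h.
  apply: idealB => //; rewrite -mul_polyC; apply: (idealMr _ hI); exact: PI.
have sh : (size h <= n)%N.
  apply/leq_sizeP => j nj; rewrite coefB coefZ coefXn.
  case: (eqVneq j (size f).-1) => [->|jf]; first by rewrite mulr1 -/(lead_coef f) subrr.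
  rewrite mulr0 subr0 nth_default //; move: jf; rewrite neq_ltn => /orP[jl|]; last first.
    by case: (size f) => //= k; rewrite ltnS.
  have := leq_ltn_trans nj jl; move: sf; case: (size f) => //= k; rewrite ltnS => a b.
  by have := leq_ltn_trans a b; rewrite ltnn.
have [|g [Ig sg lg]] := ih h sh Ih.
  move=> phi; apply: fi.
  have -> : f`_i = h`_i + lead_coef f * ('X^((size f).-1))`_i by rewrite coefB coefZ subrK.
  have [[_ pD pM] _ _] := contraction_prime; apply: pD => //; rewrite mulrC; exact: pM.
exists g; split=> //; apply: leq_trans sg _; apply: leq_trans (size_polyD _ _) _.
rewrite geq_max leqnn size_polyN; apply: leq_trans (size_scale_leq _ _) _.
rewrite size_polyXn prednK // lt0n size_poly_eq0; apply/eqP => f0.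
by apply: fi; rewrite f0 coef0; have [[]] := contraction_prime.
Qed.

(** Such a g plays the role of the generator of [I] over the fraction field of R / p, and
    pseudo-division by it replaces Euclidean division there. *)
Lemma min_leading (I : set {poly R}) f i : is_ideal I -> P `<=` I -> I f -> ~ p f`_i ->
  exists g, [/\ I g, ~ p (lead_coef g) &
    forall h, I h -> (size h < size g)%N -> forall j, p h`_j].
Proof.
move=> hI PI If fi.
have ex : exists n, `[< exists g, [/\ I g, ~ p (lead_coef g) & size g = n] >].
  have [g [Ig _ lg]] := strip_leading hI PI If fi.
  by exists (size g); apply/asboolP; exists g.
case: (ex_minnP ex) => n /asboolP[g [Ig lg <-]] gmin; exists g; split=> // h Ih hg j.
apply: contrapT => hj; have [k [Ik sk lk]] := strip_leading hI PI Ih hj.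
have : (size g <= size k)%N by apply: gmin; apply/asboolP; exists k.
by rewrite leqNgt (leq_ltn_trans sk hg).
Qed.

Lemma closed_field_nonroot (f : {poly K}) : f != 0 -> exists x, f.[x] != 0.
Proof.
move=> f0; case: (leqP (size f) 1) => [/size1_polyC fc|sf].
  by exists 0; rewrite fc hornerC; apply: contra f0; rewrite {2}fc => /eqP ->.
have [|x] := @closed_rootP K (f - 1) _.
  rewrite size_polyDl ?size_polyN ?size_poly1 //; by rewrite neq_ltn sf orbT.
by exists x; move: p0; rewrite rootE hornerD hornerN hornerC subr_eq0 => /eqP ->; rewrite oner_neq0.
Qed.

Lemma poly_points s : ~ P s -> exists t x,
  (forall f, P f -> (map_poly (e t) f).[x] = 0) /\ (map_poly (e t) s).[x] != 0.
Proof.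
move=> Ps; have pp := contraction_prime.
have [[p0 pD pM] p1 pmul] := pp; have [[P0 PD PM] P1 Pmul] := P_prime.
(* If [P] is extended from [p], the variable is free over any zero of [p], and a value at which [s]
   does not vanish can be chosen. *)
case: (pselect (exists2 f, P f & exists i, ~ p f`_i)) => [|h]; last first.
  have inp f : P f -> forall i, p f`_i.
    by move=> Pf i; apply: contrapT => fi; apply: h; exists f => //; exists i.
  have [i si] : exists i, ~ p s`_i by apply/existsNP => h'; apply: Ps; exact: extension_sub.
  have [t [tp ts]] := R_points pp si.
  have [|x sx] := @closed_field_nonroot (map_poly (e t) s).
    by apply: contra ts => /eqP s0; rewrite -coef_map s0 coef0.
  exists t, x; split=> // f Pf; rewrite [map_poly _ _](_ : _ = 0) ?horner0 //.
  by apply/polyP => j; rewrite coef_map coef0 /= tp //; exact: inp.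
move=> [f0 Pf0 [i0 fi0]].
have [f [Pf lf fmin]] := min_leading hP (fun _ h => h) Pf0 fi0.
have sf : (1 < size f)%N.
  rewrite ltnNge; apply/negP => /size1_polyC fc; apply: lf.
  by rewrite fc lead_coefC /p /= -fc.
(* [I2] is P + (s). Its generic generator [g] turns out to be a constant [c], which is a multiple of
   [s] modulo [P]. *)
pose I2 := [set a | exists h, P (a - h * s)].
have hI2 : is_ideal I2.
  split.
  - by exists 0; rewrite mul0r subr0.
  - by move=> a b [h ha] [k hb]; exists (h + k); rewrite mulrDl opprD addrACA; exact: PD.
  - by move=> c a [h ha]; exists (c * h); rewrite -mulrA -mulrBr; exact: PM.
have PI2 : P `<=` I2 by move=> a Pa; exists 0; rewrite mul0r subr0.
have I2s : I2 s by exists 1; rewrite mul1r subrr.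
have [i si] : exists i, ~ p s`_i by apply/existsNP => h'; apply: Ps; exact: extension_sub.
have [g [Ig lg gmin]] := min_leading hI2 PI2 I2s si.
have lexp q k : ~ p (lead_coef q) -> ~ p (lead_coef q ^+ k).
  move=> lq; elim: k => [|k ih]; first by rewrite expr0.
  by rewrite exprS => /pmul[].
have nP c q : ~ p c -> P (c *: q) -> P q.
  by move=> pc; rewrite -mul_polyC => /Pmul[].
have ng q : ~ p (lead_coef q) -> q != 0.
  by move=> lq; apply/eqP => q0; apply: lq; rewrite q0 lead_coef0.
have gP : ~ P g.
  move=> Pg; apply: Ps; apply: (nP _ _ (lexp g (scalp s g) lg)).
  rewrite Pdiv.Idomain.divp_eq; apply: PD; first exact: PM.
  apply: extension_sub; apply: gmin; last by rewrite ltn_modp ng.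
  have -> : s %% g = lead_coef g ^+ scalp s g *: s - s %/ g * g.
    by rewrite Pdiv.Idomain.divp_eq addrAC subrr add0r.
  apply: idealB => //; last by have [_ _ IM] := hI2; exact: IM.
  by rewrite -mul_polyC; have [_ _ IM] := hI2; exact: IM.
(* Generically [g] divides [f]. As [P] is prime and does not contain [g], it contains the quotient,
   and minimality of [f] forces the latter to have full degree. *)
have sg : (size g <= 1)%N.
  have If := PI2 _ Pf.
  have sgf : (size g <= size f)%N.
    rewrite leqNgt; apply/negP => /(gmin _ If)/(_ (size f).-1); exact: lf.
  have dE := Pdiv.Idomain.divp_eq f g; set k := scalp f g in dE *.
  have rI : I2 (f %% g).
    have -> : f %% g = lead_coef g ^+ k *: f - f %/ g * g by rewrite dE addrAC subrr add0r.
    apply: idealB => //; last by have [_ _ IM] := hI2; exact: IM.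
    by rewrite -mul_polyC; have [_ _ IM] := hI2; exact: IM.
  have sr : (size (f %% g)%R < size g)%N by rewrite ltn_modp ng.
  have rp := gmin _ rI sr.
  have /Pmul[Pq|//] : P (f %/ g * g).
    have -> : f %/ g * g = lead_coef g ^+ k *: f - f %% g by rewrite dE addrK.
    apply: idealB => //; last exact: extension_sub.
    by rewrite -mul_polyC; exact: PM.
  case: (ltnP (size (f %/ g)) (size f)) => [/(fmin _ Pq) qp|sq].
    have : p (lead_coef g ^+ k * lead_coef f).
      rewrite -coefZ dE coefD; apply: (pD) => //; rewrite coefM.
      by apply: ideal_sum => // j _; rewrite mulrC; apply: pM; exact: qp.
    by move=> /pmul[/(lexp _ _ lg)|/lf].
  have q0 : f %/ g != 0 by rewrite -size_poly_gt0; apply: leq_trans sq; apply: ltnW.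
  have : (size (f %/ g * g)%R <= size f)%N.
    have -> : f %/ g * g = lead_coef g ^+ k *: f - f %% g by rewrite dE addrK.
    apply: leq_trans (size_polyD _ _) _; rewrite geq_max size_scale_leq size_polyN.
    exact: ltnW (leq_trans sr sgf).
  rewrite size_mul ?(ng _ lg) // => h; have := leq_trans h sq.
  move: q0; rewrite -size_poly_gt0; case: (size _) => // l _.
  by rewrite addSn -[X in (_ <= X)%N]addn1 leq_add2l.
have gc := size1_polyC sg; set c := g`_0 in gc.
have pc : ~ p c by move=> pc; apply: lg; rewrite gc lead_coefC.
(* Where the leading coefficient of [f] does not vanish, [f] keeps its degree and has a root; where
   [c] does not vanish, neither does [s] at that root. *)
have lc : ~ p (lead_coef f * c) by move=> /pmul[].
have [t [tp]] := R_points pp lc; rewrite rmorphM mulf_eq0 negb_or => /andP[tf tc].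
have sF : size (map_poly (e t) f) = size f by rewrite size_map_poly_id0.
have [|x] := @closed_rootP K (map_poly (e t) f) _; first by rewrite sF neq_ltn sf orbT.
move=> fx; have Px h : P h -> (map_poly (e t) h).[x] = 0.
  move=> Ph; have dE := Pdiv.Idomain.divp_eq h f.
  have rP : P (h %% f).
    have -> : h %% f = lead_coef f ^+ scalp h f *: h - h %/ f * f by rewrite dE addrAC subrr add0r.
    apply: idealB => //; last exact: PM.
    by rewrite -mul_polyC; exact: PM.
  have r0 : map_poly (e t) (h %% f) = 0.
    apply/polyP => j; rewrite coef_map coef0 /= tp //; apply: fmin => //.
    by rewrite ltn_modp ng.
  have := congr1 (fun u => (map_poly (e t) u).[x]) dE.
  rewrite /= map_polyZ rmorphD rmorphM /= r0 addr0 hornerZ hornerM (rootP fx) mulr0 rmorphXn.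
  by move/eqP; rewrite mulf_eq0 expf_eq0 (negbTE tf) andbF /= => /eqP.
exists t, x; split=> //; have [h Ph] := Ig.
have := Px _ Ph; rewrite rmorphB rmorphM /= hornerD hornerN hornerM gc map_polyC hornerC.
move/eqP; rewrite subr_eq0 => /eqP ec; apply/eqP => s0; move: tc.
by rewrite [X in X != 0]ec s0 mulr0 eqxx.
Qed.

End PolynomialPrimes.

Lemma meval_mwiden n (R : comNzRingType) (v : 'I_n.+1 -> R) (q : {mpoly R[n]}) :
  (mwiden q).@[v] = q.@[fun i => v (widen_ord (leqnSn n) i)].
Proof.
elim/mpolyind: q => [|c m q _ _ ih]; first by rewrite mwiden0 !meval0.
rewrite mwidenD !mevalD ih mwidenZ !mevalZ mwidenX !mevalX; congr (c * _ + _).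
rewrite big_ord_recr /= mnmwiden_ordmax expr0 mulr1.
by apply: eq_bigr => i _; rewrite mnmwiden_widen.
Qed.

(* Induction on the number of variables: a prime of R[X] lies over a prime of R, and
   it is either extended from R or given generically by one polynomial f of minimal
   degree; a zero is obtained by choosing a root of f over a zero of the prime of R. *)
Lemma nullstellensatz_prime (K : closedFieldType) n (P : set {mpoly K[n]}) s :
  is_prime_ideal P -> ~ P s ->
  exists v : 'I_n -> K, (forall f, P f -> f.@[v] = 0) /\ s.@[v] != 0.
Proof.
elim: n P s => [|n ih] P s hP Ps.
  have [[P0 PD PM] P1 _] := hP; exists (fun=> 0); split=> [f Pf|].
    have fE := nvar0_mpolyC f; set c := f@_0 in fE.
    rewrite fE mevalC; apply/eqP/negPn/negP => c0; apply: P1.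
    by have := PM (c^-1)%:MP _ Pf; rewrite fE -mpolyCM mulVf // mpolyC1.
  apply: contra_not_neq Ps; rewrite [s]nvar0_mpolyC mevalC => ->.
  by rewrite mpolyC0; case: hP => -[].
pose wid : {rmorphism {mpoly K[n]} -> {mpoly K[n.+1]}} := GRing.RMorphism.clone _ _ (@mwiden n K) _.
have cm : commr_rmorph wid 'X_ord_max by move=> a; exact: mulrC.
pose evp : {rmorphism {poly {mpoly K[n]}} -> {mpoly K[n.+1]}} :=
  GRing.RMorphism.clone _ _ (horner_morph cm) _.
pose e (v : 'I_n -> K) : {rmorphism {mpoly K[n]} -> K} := GRing.RMorphism.clone _ _ (meval v) _.
have [s' sE] := mpoly_as_poly s.
have evE f : evp f = (map_poly (@mwiden n K) f).['X_ord_max] by [].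
have [|v [x [hv sv]]] := @poly_points K {mpoly K[n]} _ e ih _ (prime_ideal_preim evp hP) s'.
  by rewrite /= evE -sE.
pose v' (i : 'I_n.+1) := if unlift ord_max i is Some j then v j else x.
have v'w (i : 'I_n) : v' (widen_ord (leqnSn n) i) = v i.
  rewrite /v'; have -> : widen_ord (leqnSn n) i = lift ord_max i.
    by apply: val_inj; rewrite /= /bump leqNgt ltn_ord.
  by rewrite liftK.
have vE f : (evp f).@[v'] = (map_poly (e v) f).[x].
  rewrite evE; have -> : x = ('X_ord_max : {mpoly K[n.+1]}).@[v'].
    by rewrite mevalXU /v' unlift_none.
  pose e' : {rmorphism {mpoly K[n.+1]} -> K} := GRing.RMorphism.clone _ _ (meval v') _.
  rewrite -[LHS]/(e' _) -horner_map /=; congr (_.[_]).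
  apply/polyP => i; rewrite !coef_map /= meval_mwiden; apply: meval_eq => j; exact: v'w.
exists v'; split; last by rewrite sE -evE vE.
move=> f Pf; have [f' fE] := mpoly_as_poly f; rewrite fE -evE vE; apply: hv.
by rewrite /= evE -fE.
Qed.

(** * Regular functions and local rings of projective sets *)

Section ProjectivePoints.
Variables (K : closedFieldType) (n : nat).
Implicit Types (x y : proj K n) (i j : 'I_n) (F G : {mpoly K[n]}).

Notation crd x j := (coords x 0 j).

Lemma coords_neq0 x : coords x != 0.
Proof. by rewrite /coords vpick0 -dimv_eq0 (eqP (svalP x)). Qed.

Lemma exists_crd x : exists i, crd x i != 0.
Proof. by have /rV0Pn[i] := coords_neq0 x; exists i. Qed.

Lemma sval_coords x : sval x = <[coords x]>%VS.
Proof.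
apply/eqP; rewrite eq_sym eqEdim (eqP (svalP x)) dim_vline coords_neq0 leqnn andbT.
by rewrite -memvE /coords memv_pick.
Qed.

Lemma proj_eq x y c : coords x = c *: coords y -> x = y.
Proof.
move=> e; apply: val_inj; rewrite /= !sval_coords e.
have c0 : c != 0 by apply: contraTneq (coords_neq0 x) => c0; rewrite e c0 scale0r eqxx.
apply/eqP; rewrite eqEdim !dim_vline scaler_eq0 (negbTE c0) coords_neq0 /= leqnn andbT.
by rewrite -memvE memvZ // memv_line.
Qed.

Lemma exists_point (v : 'rV[K]_n) : v != 0 ->
  exists x c, c != 0 /\ coords x = c *: v.
Proof.
move=> v0; have dv : \dim <[v]>%VS == 1%N by rewrite dim_vline v0.
pose x : proj K n := exist _ <[v]>%VS dv; exists x.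
have : coords x \in <[v]>%VS by exact: memv_pick.
move=> /vlineP[c e]; exists c; split=> //.
by apply: contraTneq (coords_neq0 x) => c0; rewrite e c0 scale0r eqxx.
Qed.

Lemma meval_homog F d (v : 'I_n -> K) c : F \is d.-homog ->
  F.@[fun i => c * v i] = c ^+ d * F.@[v].
Proof.
move=> /dhomogP hF; rewrite !mevalE mulr_sumr; apply: eq_big_seq => m /hF hm.
rewrite mulrCA; congr (_ * _); rewrite -hm /= mdegE -prodrXr -big_split.
by apply: eq_bigr => i _; rewrite exprMn.
Qed.

(** The affine coordinates in the chart given by [i]. They do not depend on the representative
    picked by [coords], and are 0 outside the chart. *)
Definition rat i x j : K := crd x j / crd x i.

Lemma rat_diag i x : crd x i != 0 -> rat i x i = 1.
Proof. by move=> h; rewrite /rat divff. Qed.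

Lemma rat_inj i x y : crd x i != 0 -> crd y i != 0 -> (forall j, rat i x j = rat i y j) -> x = y.
Proof.
move=> hx hy h; apply: (@proj_eq _ _ (crd x i / crd y i)); apply/rowP => j.
rewrite mxE -[LHS](divfK hx) -/(rat i x j) h /rat; field.
by rewrite hy.
Qed.

Lemma heval_rat F d i x : F \is d.-homog -> crd x i != 0 ->
  heval F x = crd x i ^+ d * F.@[rat i x].
Proof.
move=> hF h; rewrite -(meval_homog _ _ hF); apply: meval_eq => j.
by rewrite /rat mulrCA divff // mulr1.
Qed.

Lemma heval_eq0 F d i x : F \is d.-homog -> crd x i != 0 -> (heval F x == 0) = (F.@[rat i x] == 0).
Proof.
by move=> hF h; rewrite (heval_rat hF h) mulf_eq0 expf_eq0 (negbTE h) andbF.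
Qed.

Lemma dhomog_varX (i : 'I_n) k : ('X_i ^+ k : {mpoly K[n]}) \is k.-homog.
Proof. by have := @dhomogMn n K mdeg 1 'X_i k; rewrite mul1n; apply; rewrite dhomogX /= mdeg1. Qed.

Lemma homogenize i F : exists d G, G \is d.-homog /\ forall v, v i = 1 -> G.@[v] = F.@[v].
Proof.
exists (msize F), (\sum_(m <- msupp F) F@_m *: ('X_[m] * 'X_i ^+ (msize F - mdeg m))); split.
  rewrite big_seq; apply: rpred_sum => m hm; apply: rpredZ.
  have lm : (mdeg m <= msize F)%N by apply: ltnW; exact: msize_mdeg_lt.
  have := @dhomogM n K mdeg (mdeg m) 'X_[m] (msize F - mdeg m) ('X_i ^+ (msize F - mdeg m)).
  rewrite subnKC //; apply; first by rewrite dhomogX.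
  exact: dhomog_varX.
move=> v vi; rewrite [in RHS](mpolyE F) !raddf_sum; apply: eq_bigr => m _ /=.
by rewrite !mevalZ mevalM rmorphXn /= mevalXU vi expr1n mulr1.
Qed.

Lemma zopen_heval F d : F \is d.-homog -> zopen [set x : proj K n | heval F x != 0].
Proof.
move=> hF; exists [set F]; split=> [p ->|]; first by exists d.
apply/seteqP; split=> x /=; first by move=> /negP; rewrite negbK => /eqP h p ->.
by move=> /(_ F erefl) ->; rewrite eqxx.
Qed.

Lemma zopen_crd i : zopen [set x : proj K n | crd x i != 0].
Proof.
have := @zopen_heval 'X_i 1; rewrite /heval => h.
have -> : [set x : proj K n | crd x i != 0] = [set x | ('X_i : {mpoly K[n]}).@[coords x 0] != 0].
  by apply/seteqP; split=> x /=; rewrite mevalXU.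
by apply: h; rewrite dhomogX /= mdeg1.
Qed.

Lemma zopen_rat F i : zopen [set x : proj K n | crd x i != 0 /\ F.@[rat i x] != 0].
Proof.
have [d [G [hG GF]]] := homogenize i F.
have -> : [set x : proj K n | crd x i != 0 /\ F.@[rat i x] != 0] = [set x : proj K n | crd x i != 0] `&` [set x : proj K n | heval G x != 0].
  apply/seteqP; split=> x /= [h]; rewrite (heval_eq0 hG h) GF ?rat_diag //.
by apply: zopenI; [exact: zopen_crd|exact: zopen_heval hG].
Qed.

Lemma zopen_nbhd (V : set (proj K n)) x : zopen V -> V x ->
  exists d F, [/\ F \is d.-homog, heval F x != 0 & forall y, heval F y != 0 -> V y].
Proof.
move=> [S [hS VS]] Vx; have : ~ [set x | forall p, S p -> heval p x = 0] x by rewrite -VS.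
move=> /existsNP[F /not_implyP[SF /eqP Fx]]; have [d hd] := hS _ SF.
exists d, F; split=> // y Fy; apply: contrapT => nV; have : (~` V) y by [].
by rewrite VS => /(_ _ SF)/eqP; rewrite (negbTE Fy).
Qed.

End ProjectivePoints.

Notation crd x j := (coords x 0 j).

Section RegularFunctions.
Variables (K : closedFieldType) (n : nat) (X : set (proj K n)) (x : proj K n).
Hypothesis Xx : X x.

Lemma regular_near f g : eq_near X x f g -> regular_at X x f -> regular_at X x g.
Proof.
move=> [U [oU Ux fg]] [V [oV Vx [d [F [G [hF hG h]]]]]].
exists (U `&` V); split=> //; first exact: zopenI.
exists d, F, G; split=> // y Xy [Uy Vy]; have [G0 fy] := h y Xy Vy.
by rewrite -fg.
Qed.

Lemma regularD f g : regular_at X x f -> regular_at X x g -> regular_at X x (fun y => f y + g y).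
Proof.
move=> /asboolP hf /asboolP hg.
have := @rpredD _ (regular_pred X x) f g hf hg; exact: asboolP.
Qed.

Lemma regularM f g : regular_at X x f -> regular_at X x g -> regular_at X x (fun y => f y * g y).
Proof.
move=> /asboolP hf /asboolP hg.
have := @rpredM _ (regular_pred X x) f g hf hg; exact: asboolP.
Qed.

Lemma regular_sum (I : Type) (r : seq I) (f : I -> proj K n -> K) :
  (forall i, regular_at X x (f i)) -> regular_at X x (fun y => \sum_(i <- r) f i y).
Proof.
move=> h; elim: r => [|i r ih].
  by have -> : (fun y => \sum_(i <- [::]) f i y) = (fun=> 0); [apply/funext => y; rewrite big_nil|exact: regular_cst].
have -> : (fun y => \sum_(j <- i :: r) f j y) = (fun y => f i y + \sum_(j <- r) f j y).
  by apply/funext => y; rewrite big_cons.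
exact: regularD.
Qed.

Lemma regular_prod (I : Type) (r : seq I) (f : I -> proj K n -> K) :
  (forall i, regular_at X x (f i)) -> regular_at X x (fun y => \prod_(i <- r) f i y).
Proof.
move=> h; elim: r => [|i r ih].
  by have -> : (fun y => \prod_(i <- [::]) f i y) = (fun=> 1); [apply/funext => y; rewrite big_nil|exact: regular_cst].
have -> : (fun y => \prod_(j <- i :: r) f j y) = (fun y => f i y * \prod_(j <- r) f j y).
  by apply/funext => y; rewrite big_cons.
exact: regularM.
Qed.

Lemma regular_meval m (F : {mpoly K[m]}) (g : 'I_m -> proj K n -> K) :
  (forall j, regular_at X x (g j)) -> regular_at X x (fun y => F.@[fun j => g j y]).
Proof.
move=> h; have -> : (fun y => F.@[fun j => g j y]) =
    (fun y => \sum_(b <- msupp F) F@_b * \prod_(j < m) \prod_(k < b j) g j y).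
  apply/funext => y; rewrite mevalE; apply: eq_bigr => b _; congr (_ * _).
  by apply: eq_bigr => j _; rewrite prodr_const card_ord.
apply: regular_sum => b; apply: regularM; first exact: regular_cst.
by apply: regular_prod => j; apply: regular_prod.
Qed.

Lemma regular_rat i (F : {mpoly K[n]}) : crd x i != 0 -> regular_at X x (fun y => F.@[rat i y]).
Proof.
move=> xi; have [d [G [hG GF]]] := homogenize i F.
exists [set y : proj K n | crd y i != 0]; split=> //; first exact: zopen_crd.
exists d, G, ('X_i ^+ d); split=> // [|y Xy yi].
  exact: dhomog_varX.
rewrite (heval_rat hG yi) /heval rmorphXn /= mevalXU expf_neq0 //; split=> //.
by rewrite GF ?rat_diag // mulrC mulKf // expf_neq0.
Qed.

Lemma regular_rat_coord i j : crd x i != 0 -> regular_at X x (fun y => rat i y j).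
Proof.
move=> xi; have := @regular_rat i 'X_j xi.
by under eq_fun do rewrite mevalXU.
Qed.

Lemma regular_frac f i : regular_at X x f -> crd x i != 0 ->
  exists F G (U : set (proj K n)), [/\ zopen U, U x & forall y, X y -> U y ->
    [/\ crd y i != 0, G.@[rat i y] != 0 & f y = F.@[rat i y] / G.@[rat i y]]].
Proof.
move=> [U [oU Ux [d [F [G [hF hG h]]]]]] xi; exists F, G, (U `&` [set y : proj K n | crd y i != 0]).
split=> // [|y Xy [Uy /= yi]]; first by apply: zopenI => //; exact: zopen_crd.
have [G0 fy] := h y Xy Uy; split=> //; first by rewrite -(heval_eq0 hG yi).
rewrite fy (heval_rat hF yi) (heval_rat hG yi) invfM mulrACA divff ?mul1r //.
by rewrite expf_neq0.
Qed.

Lemma regular_neq0 f : regular_at X x f -> f x != 0 ->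
  exists U, [/\ zopen U, U x & forall y, X y -> U y -> f y != 0].
Proof.
move=> hf fx; have [i xi] := exists_crd x.
have [F [G [U [oU Ux h]]]] := regular_frac hf xi.
exists (U `&` [set y : proj K n | crd y i != 0 /\ F.@[rat i y] != 0]); split.
- by apply: zopenI => //; exact: zopen_rat.
- split=> //; split=> //; have [_ G0 fE] := h x Xx Ux.
  by move: fx; rewrite fE mulf_eq0 negb_or => /andP[].
- move=> y Xy [Uy /= [yi Fy]]; have [_ G0 ->] := h y Xy Uy.
  by rewrite mulf_neq0 // invr_eq0.
Qed.

Lemma regularV f : regular_at X x f -> f x != 0 -> regular_at X x (fun y => (f y)^-1).
Proof.
move=> hf fx; have [U [oU Ux hU]] := regular_neq0 hf fx.
have [V [oV Vx [d [F [G [hF hG h]]]]]] := hf.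
exists (U `&` V); split=> //; first exact: zopenI.
exists d, G, F; split=> // y Xy [Uy Vy]; have [G0 fy] := h y Xy Vy.
have := hU y Xy Uy; rewrite fy mulf_eq0 negb_or => /andP[F0 _]; split=> //.
by rewrite invf_div.
Qed.

End RegularFunctions.

Section LocalMorphisms.
Variables (K : closedFieldType).

(* psi is given near x, in some affine chart of the target, by regular functions. *)
Definition loc_mor n m (X : set (proj K n)) (Y : set (proj K m)) (x : proj K n)
    (psi : proj K n -> proj K m) : Prop :=
  exists i U, [/\ zopen U, U x,
    forall y, X y -> U y -> Y (psi y) /\ crd (psi y) i != 0 &
    forall j, regular_at X x (fun y => rat i (psi y) j)].

Section One.
Variables (n m : nat) (X : set (proj K n)) (Y : set (proj K m)) (x : proj K n).
Variable psi : proj K n -> proj K m.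
Hypotheses (Xx : X x) (hpsi : loc_mor X Y x psi).

Lemma loc_mor_nbhd V : zopen V -> V (psi x) ->
  exists U, [/\ zopen U, U x & forall y, X y -> U y -> V (psi y)].
Proof.
move=> oV Vx; have [d [F [hF Fx FV]]] := zopen_nbhd oV Vx.
have [i [U [oU Ux hU reg]]] := hpsi; have [_ xi] := hU x Xx Ux.
have [|W [oW Wx hW]] := regular_neq0 Xx (regular_meval F reg).
  by rewrite -(heval_eq0 hF xi).
exists (U `&` W); split=> //; first exact: zopenI.
move=> y Xy [Uy Wy]; apply: FV; have [_ yi] := hU y Xy Uy.
by rewrite (heval_eq0 hF yi); exact: hW.
Qed.

Lemma loc_mor_regular f : regular_at Y (psi x) f -> regular_at X x (fun y => f (psi y)).
Proof.
have [i [U [oU Ux hU reg]]] := hpsi; have [Yx xi] := hU x Xx Ux.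
move=> /regular_frac/(_ xi)[F [G [V [oV Vx h]]]].
have [W [oW Wx hW]] := loc_mor_nbhd oV Vx.
have [_ G0 _] := h _ Yx Vx.
have := regularM (regular_meval F reg) (regularV Xx (regular_meval G reg) G0).
apply: regular_near; exists (U `&` W); split=> //; first exact: zopenI.
move=> y Xy [Uy Wy]; have [Yy _] := hU y Xy Uy.
by have [_ _ ->] := h _ Yy (hW y Xy Wy).
Qed.

Lemma loc_mor_image : Y (psi x).
Proof. by have [i [U [_ Ux h _]]] := hpsi; have [] := h x Xx Ux. Qed.

End One.

Lemma loc_mor_comp n m l (X : set (proj K n)) (Y : set (proj K m)) (Z : set (proj K l)) x psi chi :
  X x -> loc_mor X Y x psi -> loc_mor Y Z (psi x) chi -> loc_mor X Z x (chi \o psi).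
Proof.
move=> Xx hpsi [i [U [oU Ux hU reg]]].
have [V [oV Vx hV]] := loc_mor_nbhd Xx hpsi oU Ux.
have [i' [U' [oU' Ux' hU' _]]] := hpsi.
exists i, (U' `&` V); split=> //; first exact: zopenI.
  by move=> y Xy [U'y Vy]; apply: hU; [case: (hU' y Xy U'y)|exact: hV].
by move=> j; exact: (loc_mor_regular Xx hpsi (reg j)).
Qed.

Lemma loc_mor_id n (X : set (proj K n)) x : X x -> loc_mor X X x id.
Proof.
move=> Xx; have [i xi] := exists_crd x.
exists i, [set y : proj K n | crd y i != 0]; split=> //; first exact: zopen_crd.
by move=> j; exact: regular_rat_coord.
Qed.

Lemma loc_mor_const n m (X : set (proj K n)) (Y : set (proj K m)) x p : Y p -> loc_mor X Y x (fun=> p).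
Proof.
move=> Yp; have [i pi] := exists_crd p.
exists i, setT; split=> //; first exact: zopenT.
by move=> j; exact: regular_cst.
Qed.

Lemma is_morphism_loc_mor n m (X : set (proj K n)) (Y : set (proj K m)) x phi :
  X x -> is_morphism X Y phi -> loc_mor X Y x phi.
Proof.
move=> Xx [hXY hcl hreg]; have [i xi] := exists_crd (phi x).
have oV : zopen [set y : proj K m | crd y i != 0] by exact: zopen_crd.
have [Z clZ eZ] := hcl _ oV.
exists i, (~` Z); split.
- by rewrite /zopen setCK.
- by move=> Zx; have : (X `&` Z) x by []; rewrite -eZ => -[_] /=; apply.
- move=> y Xy nZ; split; first exact: hXY.
  apply: contrapT => yi; apply: nZ.
  suff : (X `&` Z) y by case.
  by rewrite -eZ.
- move=> j; apply: (hreg _ (fun y => rat i y j) oV) => // y Yy yi.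
  exact: regular_rat_coord.
Qed.

Lemma loc_mor_iter n (X : set (proj K n)) phi k x : X x -> is_morphism X X phi ->
  loc_mor X X x (iter k phi) /\ X (iter k phi x).
Proof.
move=> Xx hphi; elim: k => [|k [ih Xk]]; first by split=> //; exact: loc_mor_id.
split; last by case: hphi => h _ _; exact: h.
exact: (loc_mor_comp Xx ih (is_morphism_loc_mor Xk hphi)).
Qed.

End LocalMorphisms.

Lemma exists_rmorph (R S : pzRingType) (h : R -> S) :
  GRing.zmod_morphism h -> GRing.monoid_morphism h -> exists h' : {rmorphism R -> S}, h' =1 h.
Proof.
move=> hB hM; pose mA := GRing.isZmodMorphism.Build _ _ h hB.
pose mM := GRing.isMonoidMorphism.Build _ _ h hM.
by pose h' : {rmorphism R -> S} := HB.pack h mA mM; exists h'.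
Qed.

(** * The local ring at a point and its structure maps *)

Section PointedLocalRing.
Variables (K : closedFieldType) (n : nat) (X : set (proj K n)) (x : proj K n).

Lemma germ_eqP (f g : regfun X x) : germ f = germ g <-> eq_near X x f g.
Proof.
split=> [/eqP|h]; first by rewrite eqmodE => /asboolP.
by apply/eqP; rewrite eqmodE; exact/asboolP.
Qed.

Lemma germP (a : local_ring X x) : exists f : regfun X x, a = germ f.
Proof. by exists (repr a); rewrite /germ reprK. Qed.

Lemma germD (f g : regfun X x) : germ (f + g) = germ f + germ g.
Proof. by rewrite /germ !piE. Qed.

Lemma germM (f g : regfun X x) : germ (f * g) = germ f * germ g.
Proof. by rewrite /germ !piE. Qed.

Lemma germ_one : germ (1 : regfun X x) = 1.
Proof. by rewrite /germ !piE. Qed.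

Lemma germ_zero : germ (0 : regfun X x) = 0.
Proof. by rewrite /germ !piE. Qed.

Lemma exists_regfun f : regular_at X x f -> exists g : regfun X x, g = f :> (proj K n -> K).
Proof. by move=> /asboolP hf; exists (RegFun hf). Qed.

Lemma regfun_regular (f : regfun X x) : regular_at X x f.
Proof. by case: f => f /= /asboolP. Qed.

(** The membership proof is a parameter because the ring of germs may be zero at a point off [X];
    with it, the alias carries the structure of a nonzero ring. *)
Definition lring (Xx : X x) : Type := local_ring X x.

Variable Xx : X x.

HB.instance Definition _ := GRing.ComPzRing.on (lring Xx).

Lemma lring_neq0 : (1 : lring Xx) != 0.
Proof.
apply/eqP; rewrite -[1]germ_one -[0]germ_zero => /germ_eqP[U [_ Ux h]].
by have := h x Xx Ux => /eqP; rewrite oner_eq0.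
Qed.

HB.instance Definition _ := GRing.PzSemiRing_isNonZero.Build (lring Xx) lring_neq0.

Notation L := (lring Xx).

Definition gm (f : regfun X x) : L := germ f.

Lemma gmP (a : L) : exists f, a = gm f. Proof. exact: germP. Qed.
Lemma gmD f g : gm (f + g) = gm f + gm g. Proof. exact: germD. Qed.
Lemma gmM f g : gm (f * g) = gm f * gm g. Proof. exact: germM. Qed.
Lemma gm1 : gm 1 = 1. Proof. exact: germ_one. Qed.
Lemma gm0 : gm 0 = 0. Proof. exact: germ_zero. Qed.
Lemma gm_eqP f g : gm f = gm g <-> eq_near X x f g. Proof. exact: germ_eqP. Qed.

Lemma gm_ext (f g : regfun X x) : f =1 g -> gm f = gm g.
Proof.
by move=> h; apply/gm_eqP; exists setT; split=> //; exact: zopenT.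
Qed.

Lemma gm_sum (I : Type) (r : seq I) (f : I -> regfun X x) :
  gm (\sum_(i <- r) f i) = \sum_(i <- r) gm (f i).
Proof. exact: (big_morph gm gmD gm0). Qed.

Lemma regfun_sum (I : Type) (r : seq I) (f : I -> regfun X x) y :
  (\sum_(i <- r) f i : regfun X x) y = \sum_(i <- r) f i y.
Proof. by elim/big_rec2: _ => // i a b _ <-. Qed.

Lemma gm_unit (f : regfun X x) : f x != 0 -> exists b, gm f * b = 1.
Proof.
move=> fx; have rf := regfun_regular f.
have [g gE] := exists_regfun (regularV Xx rf fx); exists (gm g).
have [U [oU Ux hU]] := regular_neq0 Xx rf fx.
rewrite -gmM -gm1; apply/gm_eqP; exists U; split=> // y Xy Uy.
by rewrite -[LHS]/(f y * g y) gE mulfV // hU.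
Qed.

Lemma exists_pullf m (Y : set (proj K m)) (psi : proj K n -> proj K m) y (f : regfun Y y) :
  loc_mor X Y x psi -> psi x = y -> exists g : regfun X x, forall z, g z = f (psi z).
Proof.
move=> hpsi e; have reg : regular_at Y (psi x) f by rewrite e; apply/asboolP; exact: valP f.
by have [g gE] := exists_regfun (loc_mor_regular Xx hpsi reg); exists g => z; rewrite gE.
Qed.

Lemma exists_ev : exists ev : {rmorphism L -> K}, forall f, ev (gm f) = f x.
Proof.
pose ev (a : L) : K := (repr (a : local_ring X x)) x.
have evE f : ev (gm f) = f x.
  have /asboolP[U [_ Ux h]] := germ_reprP f; exact: h.
have evB : GRing.zmod_morphism ev.
  move=> a b; have [f ->] := gmP a; have [g ->] := gmP b.
  have -> : gm f - gm g = gm (f - g).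
    by apply/eqP; rewrite subr_eq -gmD subrK.
  by rewrite !evE.
have evM : GRing.monoid_morphism ev.
  split; first by rewrite -gm1 evE.
  by move=> a b; have [f ->] := gmP a; have [g ->] := gmP b; rewrite -gmM !evE.
by have [ev' e] := exists_rmorph evB evM; exists ev' => f; rewrite e.
Qed.

Lemma exists_const : exists kap : {rmorphism K -> L}, forall c (f : regfun X x),
  (forall y, f y = c) -> kap c = gm f.
Proof.
have /choice[cf hcf] : forall c : K, exists f : regfun X x, forall y, f y = c.
  by move=> c; have [f fE] := exists_regfun (regular_cst X x c); exists f => y; rewrite fE.
pose kap c := gm (cf c).
have kE c (f : regfun X x) : (forall y, f y = c) -> kap c = gm f.
  by move=> h; apply: gm_ext => y; rewrite h hcf.
have kB : GRing.zmod_morphism kap.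
  move=> a b; apply/eqP; rewrite eq_sym subr_eq -gmD; apply/eqP/gm_ext => y.
  by rewrite hcf -[RHS]/(cf (a - b) y + cf b y) !hcf subrK.
have kM : GRing.monoid_morphism kap.
  split; first by rewrite -gm1; apply: gm_ext => y; rewrite hcf.
  by move=> a b; rewrite -gmM; apply: gm_ext => y; rewrite hcf -[RHS]/(cf a y * cf b y) !hcf.
by have [kap' e] := exists_rmorph kB kM; exists kap' => c f /kE; rewrite e.
Qed.

Variable i : 'I_n.
Hypothesis xi : crd x i != 0.

(** With [th_unit] and [th_frac] this presents the local ring as a localization of a quotient of a
    polynomial ring. *)
Lemma exists_theta : exists th : {rmorphism {mpoly K[n]} -> L}, forall F (f : regfun X x),
  (forall y, f y = F.@[rat i y]) -> th F = gm f.
Proof.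
have /choice[tf htf] : forall F : {mpoly K[n]}, exists f : regfun X x, forall y, f y = F.@[rat i y].
  by move=> F; have [f fE] := exists_regfun (@regular_rat K n X x i F xi); exists f => y; rewrite fE.
pose th F := gm (tf F).
have tE F (f : regfun X x) : (forall y, f y = F.@[rat i y]) -> th F = gm f.
  by move=> h; apply: gm_ext => y; rewrite h htf.
have tB : GRing.zmod_morphism th.
  move=> a b; apply/eqP; rewrite eq_sym subr_eq -gmD; apply/eqP/gm_ext => y.
  by rewrite htf -[RHS]/(tf (a - b) y + tf b y) !htf mevalB subrK.
have tM : GRing.monoid_morphism th.
  split; first by rewrite -gm1; apply: gm_ext => y; rewrite htf meval1.
  by move=> a b; rewrite -gmM; apply: gm_ext => y; rewrite htf -[RHS]/(tf a y * tf b y) !htf mevalM.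
by have [th' e] := exists_rmorph tB tM; exists th' => F f /tE; rewrite e.
Qed.

Variable th : {rmorphism {mpoly K[n]} -> L}.
Hypothesis thE : forall F (f : regfun X x), (forall y, f y = F.@[rat i y]) -> th F = gm f.

Lemma th_unit F : F.@[rat i x] != 0 -> exists b, th F * b = 1.
Proof.
move=> Fx; have [f fE] := exists_regfun (regular_rat X F xi).
rewrite (@thE F f) => [|y]; last by rewrite fE.
by apply: gm_unit; rewrite fE.
Qed.

Lemma th_frac a : exists F G, G.@[rat i x] != 0 /\ a * th G = th F.
Proof.
have [f ->] := gmP a; have [F [G [U [oU Ux h]]]] := regular_frac (regfun_regular f) xi.
exists F, G; split; first by have [] := h x Xx Ux.
have [g gE] := exists_regfun (regular_rat X G xi).
have [k kE] := exists_regfun (regular_rat X F xi).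
rewrite (@thE G g) => [|y]; last by rewrite gE.
rewrite (@thE F k) => [|y]; last by rewrite kE.
rewrite -gmM; apply/gm_eqP; exists U; split=> // y Xy Uy.
have [_ G0 fy] := h y Xy Uy.
by rewrite -[LHS]/(f y * g y) fy gE kE mulfVK.
Qed.

Lemma noetherian_field : noetherian K.
Proof.
apply: fg_noetherian => I hI; case: (pselect (exists2 a, I a & a != 0)) => [[a Ia a0]|h].
  exists 1%N, (fun=> a); split=> // b Ib; exists (fun=> b / a), 0 => //.
  by rewrite big_ord1 addr0 divfK.
exists 0%N, (fun=> 0); split=> // b Ib; exists (fun=> 0), 0 => //.
rewrite big_ord0 addr0; apply/eqP/negPn/negP => b0; apply: h; by exists b.
Qed.

Lemma noetherian_lring : noetherian L.
Proof.
apply: fg_noetherian => I hI; have [_ _ IM] := hI.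
have [k [z [hz Hz]]] := noetherian_gens [set F | I (th F)] (@noetherian_mpoly n _ noetherian_field).
exists k, (fun j => th (z j)); split=> // a Ia.
have [F [G [G0 aE]]] := th_frac a; have [b hb] := th_unit G0.
have -> : a = b * th F by rewrite -aE mulrCA [b * _]mulrC hb mulr1.
have hE := @idl_ideal _ [set 0] (fun j => th (z j)) k (@ideal0 L).
have [_ _ EM] := hE; apply: EM.
have /Hz[c [_ -> ->]] : I (th F) by rewrite -aE mulrC; exact: IM.
exists (fun j => th (c j)), 0; rewrite // !addr0 rmorph_sum.
by apply: eq_bigr => j _; rewrite rmorphM.
Qed.

End PointedLocalRing.

Section PullBack.
Variables (K : closedFieldType) (n m : nat) (X : set (proj K n)) (Y : set (proj K m)).
Variables (x : proj K n) (y : proj K m) (psi : proj K n -> proj K m).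
Hypotheses (Xx : X x) (Yy : Y y) (hpsi : loc_mor X Y x psi) (psix : psi x = y).

Lemma exists_pull : exists h : {rmorphism lring Yy -> lring Xx},
  forall (f : regfun Y y) (g : regfun X x), (forall z, g z = f (psi z)) -> h (gm Yy f) = gm Xx g.
Proof.
have /choice[pf hpf] : forall f : regfun Y y, exists g : regfun X x, forall z, g z = f (psi z).
  by move=> f; exact: (exists_pullf Xx f hpsi psix).
pose h (a : lring Yy) : lring Xx := gm Xx (pf (repr (a : local_ring Y y))).
have hE (f : regfun Y y) (g : regfun X x) : (forall z, g z = f (psi z)) -> h (gm Yy f) = gm Xx g.
  move=> gE; apply/gm_eqP; have /asboolP[V [oV Vy e]] := germ_reprP f.
  rewrite -psix in Vy; have [U [oU Ux hU]] := loc_mor_nbhd Xx hpsi oV Vy.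
  have [i [W [oW Wx hW _]]] := hpsi.
  exists (U `&` W); split=> //; first exact: zopenI.
  move=> z Xz [Uz Wz]; rewrite hpf gE; apply: e; last exact: hU.
  by case: (hW z Xz Wz).
have hB : GRing.zmod_morphism h.
  move=> a b; have [f ->] := gmP a; have [g ->] := gmP b.
  have -> : gm Yy f - gm Yy g = gm Yy (f - g).
    by apply/eqP; rewrite subr_eq -gmD subrK.
  rewrite (hE f (pf f)) // (hE g (pf g)) // (hE (f - g) (pf f - pf g)).
    by apply/eqP; rewrite eq_sym subr_eq -gmD subrK.
  by move=> z; rewrite -[LHS]/(pf f z - pf g z) !hpf.
have hM : GRing.monoid_morphism h.
  split; first by rewrite -gm1 (hE 1 1) ?gm1.
  move=> a b; have [f ->] := gmP a; have [g ->] := gmP b.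
  rewrite -gmM (hE f (pf f)) // (hE g (pf g)) // (hE (f * g) (pf f * pf g)) ?gmM //.
  by move=> z; rewrite -[LHS]/(pf f z * pf g z) !hpf.
by have [h' e] := exists_rmorph hB hM; exists h' => f g /hE; rewrite e.
Qed.

End PullBack.

(** * The Zariski topology, products and graphs *)

Section ZariskiTopology.
Variables (K : closedFieldType) (n : nat).
Implicit Types (X Z F G : set (proj K n)) (x : proj K n).

(** [Z] is cut out by all forms vanishing on it: at another point of [X], a basic open set inside
    the given neighbourhood supplies a form that vanishes on [Z] but not at the point. *)
Lemma zclosed_local X Z : zclosed X -> Z `<=` X ->
  (forall x, X x -> ~ Z x -> exists U, [/\ zopen U, U x & forall y, X y -> U y -> ~ Z y]) ->
  zclosed Z.
Proof.
move=> [S [hS XS]] ZX h.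
exists [set p | (exists d, p \is d.-homog) /\ forall y, Z y -> heval p y = 0]; split; first by move=> p [].
apply/seteqP; split=> x /=; first by move=> Zx p [_]; apply.
move=> hx; have Xx : X x.
  rewrite XS => p Sp; apply: hx; split; first exact: hS.
  by move=> y /ZX; rewrite XS; apply.
apply: contrapT => Zx; have [U [oU Ux hU]] := h x Xx Zx.
have [d [F [hF Fx FU]]] := zopen_nbhd oU Ux.
have : heval F x = 0.
  apply: hx; split; first by exists d.
  move=> y Zy; apply/eqP/negPn/negP => Fy; exact: (hU y (ZX _ Zy) (FU y Fy)).
by move/eqP; rewrite (negbTE Fx).
Qed.

Lemma zclosed_bigcap (T : Type) (C : T -> set (proj K n)) : (forall t, zclosed (C t)) ->
  zclosed [set x | forall t, C t x].
Proof.
move=> h; have /choice[S hS] := h.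
exists [set p | exists t, S t p]; split; first by move=> p [t]; case: (hS t) => + _; apply.
apply/seteqP; split=> x /=.
  by move=> hx p [t Sp]; have := hx t; have [_ ->] := hS t; apply.
by move=> hx t; have [_ ->] := hS t => p Sp; apply: hx; exists t.
Qed.

Lemma zclosedI F G : zclosed F -> zclosed G -> zclosed (F `&` G).
Proof.
move=> hF hG; have := @zclosed_bigcap bool (fun b => if b then F else G).
have -> : [set x | forall t : bool, (if t then F else G) x] = F `&` G.
  by apply/seteqP; split=> x /= h; [split; [exact: (h true)|exact: (h false)]|case; case: h].
by apply; case.
Qed.

Lemma zopenC F : zclosed F -> zopen (~` F).
Proof. by rewrite /zopen setCK. Qed.

Lemma zclosed_point x : zclosed [set x].
Proof.
have [i xi] := exists_crd x.
exists [set p | exists j, p = crd x i *: 'X_j - crd x j *: 'X_i]; split.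
  move=> _ [j ->]; exists 1%N; apply: rpredB; apply: rpredZ; rewrite dhomogX /= mdeg1 //.
apply/seteqP; split=> y /=.
  move=> -> p [j ->]; rewrite /heval mevalB !mevalZ !mevalXU mulrC subrr //.
move=> h; apply: (@proj_eq _ _ y x (crd y i / crd x i)); apply/rowP => j.
have := h _ (ex_intro _ j erefl); rewrite /heval mevalB !mevalZ !mevalXU => /eqP.
by rewrite subr_eq0 mxE => /eqP e; rewrite mulrAC -[crd y i * _]mulrC -e mulrC mulKf.
Qed.

Lemma irreducible_point x : irreducible [set x].
Proof.
split; first by exists x.
by move=> F G _ _ h; have [Fx|Gx] := h x erefl; [left|right] => y ->.
Qed.

Lemma irreducible_image m (X : set (proj K n)) (psi : proj K n -> proj K m) :
  irreducible X ->
  (forall F : set (proj K m), zclosed F -> exists2 F', zclosed F' & forall x, X x -> (F' x <-> F (psi x))) ->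
  irreducible [set psi x | x in X].
Proof.
move=> [[x0 Xx0] irr] cont; split; first by exists (psi x0), x0.
move=> F G cF cG sub; have [F' cF' hF'] := cont F cF; have [G' cG' hG'] := cont G cG.
have [|h|h] := irr F' G' cF' cG'.
- move=> x Xx; have [|Fx|Gx] := sub (psi x); first by exists x.
    by left; apply/hF'.
  by right; apply/hG'.
- by left=> _ [x Xx <-]; apply/hF' => //; exact: h.
- by right=> _ [x Xx <-]; apply/hG' => //; exact: h.
Qed.

(** Zorn's lemma; the bound of a chain is the closure of its union, which is irreducible because two
    members violating the two inclusions can be replaced by the larger one. *)
Lemma exists_irreducible_component (D Z : set (proj K n)) : zclosed D -> zclosed Z -> irreducible Z ->
  Z `<=` D -> exists2 C, irreducible_component D C & Z `<=` C.
Proof.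
move=> cD cZ iZ ZD.
pose T := {C : set (proj K n) | [/\ zclosed C, irreducible C, Z `<=` C & C `<=` D]}.
pose le (s t : T) := sval s `<=` sval t.
have sval_inj (s t : T) : sval s = sval t -> s = t.
  by case: s t => [s hs] [t ht] /= e; subst t; congr exist; exact: Prop_irrelevance.
have [||||[C [cC iC ZC CD]] Cmax] := @Zorn T (fun s t => `[< le s t >]).
- by move=> s; apply/asboolP.
- by move=> r s t /asboolP rs /asboolP st; apply/asboolP => x /rs /st.
- by move=> s t /asboolP st /asboolP ts; apply: sval_inj; apply/seteqP.
- move=> A totA; case: (pselect (exists t, A t)) => [[t0 At0]|nA]; last first.
    have hZ : [/\ zclosed Z, irreducible Z, Z `<=` Z & Z `<=` D] by split.
    by exists (exist _ Z hZ) => s As; case: nA; exists s.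
  pose U := [set x | exists2 t, A t & sval t x].
  pose Ucl := [set x | forall p, (exists d, p \is d.-homog) /\ (forall y, U y -> heval p y = 0) -> heval p x = 0].
  have cU : zclosed Ucl.
    by exists [set p | (exists d, p \is d.-homog) /\ (forall y, U y -> heval p y = 0)]; split=> // p [].
  have UUcl : U `<=` Ucl by move=> x Ux p [_]; apply.
  have Ucl_min F : zclosed F -> U `<=` F -> Ucl `<=` F.
    move=> [S [hS ->]] UF x hx p Sp; apply: hx; split; first exact: hS.
    by move=> y /UF; apply.
  have hU : [/\ zclosed Ucl, irreducible Ucl, Z `<=` Ucl & Ucl `<=` D].
    split=> //.
    - split.
        have [_ [[x0 x0t] _] _ _] := svalP t0; exists x0; apply: UUcl; by exists t0.
      move=> F G cF cG UFG; apply: contrapT => /not_orP[nF nG].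
      have [s As nsF] : exists2 s, A s & ~ (sval s `<=` F).
        apply: contrapT => h; apply: nF; apply: Ucl_min => // x [t At tx].
        by apply: contrapT => nFx; apply: h; exists t => // sub; apply: nFx; exact: sub.
      have [t At ntG] : exists2 t, A t & ~ (sval t `<=` G).
        apply: contrapT => h; apply: nG; apply: Ucl_min => // x [t At tx].
        by apply: contrapT => nGx; apply: h; exists t => // sub; apply: nGx; exact: sub.
      have [r [Ar nrF nrG]] : exists r, [/\ A r, ~ (sval r `<=` F) & ~ (sval r `<=` G)].
        have [/asboolP st|/asboolP ts] := totA s t As At.
          by exists t; split=> // tF; apply: nsF => x /st /tF.
        by exists s; split=> // sG; apply: ntG => x /ts /sG.
      have [_ [_ irr] _ _] := svalP r.
      have [|//|//] := irr F G cF cG.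
      by move=> x rx; apply: UFG; apply: UUcl; exists r.
    - by move=> x Zx; apply: UUcl; exists t0 => //; have [_ _ h _] := svalP t0; exact: h.
    - apply: Ucl_min => // x [t At tx]; have [_ _ _ h] := svalP t; exact: h.
  exists (exist _ Ucl hU) => s As; apply/asboolP => x sx /=.
  by apply: UUcl; exists s.
exists C => //; split=> // C' cC' iC' C'D CC'.
have hC' : [/\ zclosed C', irreducible C', Z `<=` C' & C' `<=` D] by split=> // x /ZC /CC'.
have := Cmax (exist _ C' hC'); have lCC' : `[< le (exist _ C (And4 cC iC ZC CD)) (exist _ C' hC') >].
  exact/asboolP.
by move=> /(_ lCC') /(congr1 sval).
Qed.

Lemma comp_mpoly_homog m (lin : n.-tuple {mpoly K[m]}) (p : {mpoly K[n]}) d :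
  (forall i, tnth lin i \is 1.-homog) -> p \is d.-homog -> p \mPo lin \is d.-homog.
Proof.
move=> hl /dhomogP hp; rewrite comp_mpolyEX big_seq; apply: rpred_sum => b /hp hb.
apply: rpredZ; rewrite comp_mpolyX -hb /= mdegE.
elim/big_rec2: _ => [|i k q _ hq]; first exact: dhomog1.
apply: dhomogM => //.
by have := dhomogMn (b i) (hl i); rewrite mul1n.
Qed.

(** The linear forms may vanish together, with [c] = 0, and then only one implication survives.
    [zclosed_factor] therefore intersects several such preimages, one of which has [c] nonzero at
    any given point. *)
Lemma zclosed_linear m (F : set (proj K n)) (lin : 'I_n -> {mpoly K[m]}) :
  (forall i, lin i \is 1.-homog) -> zclosed F ->
  exists2 F' : set (proj K m), zclosed F' & forall (y : proj K m) (x : proj K n) c,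
    (forall i, (lin i).@[coords y 0] = c * crd x i) -> (F x -> F' y) /\ (c != 0 -> F' y -> F x).
Proof.
move=> hl [S [hS FS]].
pose l := [tuple lin i | i < n].
have hl' i : tnth l i \is 1.-homog by rewrite tnth_mktuple.
exists [set y | forall p, (exists2 q, S q & p = q \mPo l) -> heval p y = 0].
  exists [set p | exists2 q, S q & p = q \mPo l]; split=> // p [q Sq ->].
  by have [d hd] := hS q Sq; exists d; exact: comp_mpoly_homog.
move=> y x c xE; rewrite FS /=.
have e q d : q \is d.-homog -> heval (q \mPo l) y = c ^+ d * heval q x.
  move=> hq; rewrite /heval comp_mpoly_meval -(meval_homog _ _ hq).
  by apply: meval_eq => i; rewrite -xE tnth_mktuple.
split=> [h p [q Sq ->]|c0 h q Sq]; have [d hd] := hS q Sq.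
  by rewrite (e _ _ hd) h ?mulr0.
have : heval (q \mPo l) y = 0 by apply: h; exists q.
rewrite (e _ _ hd) => /eqP; rewrite mulf_eq0 expf_eq0 (negbTE c0) andbF.
by move/eqP.
Qed.

End ZariskiTopology.

Notation cchain Z := (has_chain (fun C => [/\ zclosed C, irreducible C & C `<=` Z])).

(** * Products through the Segre embedding *)

Section Segre.
Variables (K : closedFieldType) (n m : nat).
Implicit Types (x : proj K n) (y : proj K m) (z : proj K (n * m)).

Lemma crd_segre x y : exists2 c, c != 0 & forall i j,
  crd (segre x y) (mxvec_index i j) = c * (crd x i * crd y j).
Proof.
have : coords (segre x y) \in <[mxvec ((coords x)^T *m coords y)]>%VS by exact: memv_pick.
move=> /vlineP[c e]; exists c.
  by apply: contraTneq (coords_neq0 (segre x y)) => c0; rewrite e c0 scale0r eqxx.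
by move=> i j; rewrite e mxE mxvecE !mxE big_ord1 !mxE.
Qed.

Lemma crd_segre_neq0 x y i j :
  (crd (segre x y) (mxvec_index i j) != 0) = (crd x i != 0) && (crd y j != 0).
Proof. by have [c c0 ->] := crd_segre x y; rewrite !mulf_eq0 (negbTE c0) /= negb_or. Qed.

Lemma rat_segre x y i j k l :
  rat (mxvec_index i j) (segre x y) (mxvec_index k l) = rat i x k * rat j y l.
Proof.
have [c c0 e] := crd_segre x y; rewrite /rat !e !invfM.
by rewrite mulrACA divff // mul1r mulrACA.
Qed.

Lemma segre_inj x y x' y' : segre x y = segre x' y' -> x = x' /\ y = y'.
Proof.
move=> e; have [i xi] := exists_crd x; have [j yj] := exists_crd y.
have : crd (segre x y) (mxvec_index i j) != 0 by rewrite crd_segre_neq0 xi.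
rewrite e crd_segre_neq0 => /andP[x'i y'j]; split.
  apply: (rat_inj xi x'i) => k; have := rat_segre x y i j k j.
  by rewrite e rat_segre !(rat_diag yj, rat_diag y'j) !mulr1.
apply: (rat_inj yj y'j) => k; have := rat_segre x y i j i k.
by rewrite e rat_segre !(rat_diag xi, rat_diag x'i) !mul1r.
Qed.

Lemma exists_projections x0 y0 : exists (pr1 : proj K (n * m) -> proj K n) (pr2 : proj K (n * m) -> proj K m),
  (forall x y, pr1 (segre x y) = x) /\ (forall x y, pr2 (segre x y) = y).
Proof.
have /choice[pr hpr] : forall z, exists p : proj K n * proj K m,
    forall x y, z = segre x y -> p = (x, y).
  move=> z; case: (pselect (exists p : proj K n * proj K m, z = segre p.1 p.2)) => [[p ->]|h].
    by exists p => x y /segre_inj[<- <-]; case: p.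
  by exists (x0, y0) => x y e; case: h; exists (x, y).
exists (fst \o pr), (snd \o pr).
by split=> x y /=; rewrite (hpr _ x y).
Qed.

Lemma loc_mor_segre l (X : set (proj K l)) (Y1 : set (proj K n)) (Y2 : set (proj K m)) a psi1 psi2 :
  X a ->
  loc_mor X Y1 a psi1 -> loc_mor X Y2 a psi2 ->
  loc_mor X (product Y1 Y2) a (fun b => segre (psi1 b) (psi2 b)).
Proof.
move=> Xa [i [U [oU Ua hU regi]]] [j [V [oV Va hV regj]]].
exists (mxvec_index i j), (U `&` V); split=> //; first exact: zopenI.
  move=> b Xb [Ub Vb]; have [Y1b b1] := hU b Xb Ub; have [Y2b b2] := hV b Xb Vb.
  split; last by rewrite crd_segre_neq0 b1.
  by exists (psi1 b), (psi2 b).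
move=> kl; case/mxvec_indexP: kl => k l'.
under eq_fun do rewrite rat_segre.
exact: regularM.
Qed.

Section Projections.
Variables (pr1 : proj K (n * m) -> proj K n) (pr2 : proj K (n * m) -> proj K m).
Hypotheses (pr1E : forall x y, pr1 (segre x y) = x) (pr2E : forall x y, pr2 (segre x y) = y).
Variables (X : set (proj K n)) (Y : set (proj K m)).

Lemma product_nbhd x y i j : crd x i != 0 -> crd y j != 0 ->
  exists U : set (proj K (n * m)), [/\ zopen U, U (segre x y) &
    forall a b, U (segre a b) -> crd a i != 0 /\ crd b j != 0].
Proof.
move=> xi yj; exists [set z : proj K (n * m) | crd z (mxvec_index i j) != 0].
by split=> [||a b]; rewrite /= ?crd_segre_neq0 ?xi //; [exact: zopen_crd|move/andP].
Qed.

Lemma loc_mor_pr1 x y : X x -> Y y -> loc_mor (product X Y) X (segre x y) pr1.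
Proof.
move=> Xx Yy; have [i xi] := exists_crd x; have [j yj] := exists_crd y.
have [U [oU Uxy hU]] := product_nbhd xi yj.
have ij : crd (segre x y) (mxvec_index i j) != 0 by rewrite crd_segre_neq0 xi.
exists i, U; split=> // [_ [a [b [Xa Yb ->]]] /hU[ai bj]|k]; first by rewrite pr1E.
apply: (regular_near _ (regular_rat_coord _ (mxvec_index k j) ij)).
exists U; split=> // _ [a [b [Xa Yb ->]]] /hU[ai bj].
by rewrite rat_segre pr1E (rat_diag bj) mulr1.
Qed.

Lemma loc_mor_pr2 x y : X x -> Y y -> loc_mor (product X Y) Y (segre x y) pr2.
Proof.
move=> Xx Yy; have [i xi] := exists_crd x; have [j yj] := exists_crd y.
have [U [oU Uxy hU]] := product_nbhd xi yj.
have ij : crd (segre x y) (mxvec_index i j) != 0 by rewrite crd_segre_neq0 xi.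
exists j, U; split=> // [_ [a [b [Xa Yb ->]]] /hU[ai bj]|k]; first by rewrite pr2E.
apply: (regular_near _ (regular_rat_coord _ (mxvec_index i k) ij)).
exists U; split=> // _ [a [b [Xa Yb ->]]] /hU[ai bj].
by rewrite rat_segre pr2E (rat_diag ai) mul1r.
Qed.

End Projections.

Lemma zclosed_slice q (F : set (proj K (n * m))) (s : proj K q -> proj K (n * m))
    (a : 'I_n -> 'I_m -> K) (k : 'I_n -> 'I_m -> 'I_q) : zclosed F ->
  (forall p : proj K q, exists2 c, c != 0 & forall i j,
     a i j * crd p (k i j) = c * crd (s p) (mxvec_index i j)) ->
  zclosed [set p | F (s p)].
Proof.
move=> cF hs; pose lin (kl : 'I_(n * m)) : {mpoly K[q]} :=
  let ij := enum_val (cast_ord (esym (mxvec_cast n m)) kl) in a ij.1 ij.2 *: 'X_(k ij.1 ij.2).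
have linE i j : lin (mxvec_index i j) = a i j *: 'X_(k i j).
  by rewrite /lin /mxvec_index cast_ordK enum_rankK.
have [|F' cF' hF'] := @zclosed_linear K (n * m) q F lin _ cF.
  by case/mxvec_indexP => i j; rewrite linE; apply: rpredZ; rewrite dhomogX /= mdeg1.
suff -> : [set p | F (s p)] = F' by [].
have h p : (F (s p) -> F' p) /\ (F' p -> F (s p)).
  have [c c0 e] := hs p; have [|h1 h2] := hF' p (s p) c; last by split=> //; exact: h2.
  by case/mxvec_indexP => i j; rewrite linE mevalZ mevalXU.
by apply/seteqP; split=> p /=; case: (h p).
Qed.

Lemma zclosed_slice1 (F : set (proj K (n * m))) y : zclosed F -> zclosed [set x | F (segre x y)].
Proof.
move=> cF; apply: (zclosed_slice (a := fun _ j => crd y j) (k := fun i _ => i) cF) => x.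
have [c c0 e] := crd_segre x y; exists c^-1; first by rewrite invr_eq0.
by move=> i j; rewrite e mulKf // mulrC.
Qed.

Lemma zclosed_slice2 (F : set (proj K (n * m))) x : zclosed F -> zclosed [set y | F (segre x y)].
Proof.
move=> cF; apply: (zclosed_slice (a := fun i _ => crd x i) (k := fun _ j => j) cF) => y.
have [c c0 e] := crd_segre x y; exists c^-1; first by rewrite invr_eq0.
by move=> i j; rewrite e mulKf.
Qed.

Lemma zclosed_factor (q r : nat) (F : set (proj K q)) (idx : 'I_r -> 'I_q -> 'I_(n * m)) :
  zclosed F -> exists2 F' : set (proj K (n * m)), zclosed F' & forall z (x : proj K q) (c : 'I_r -> K),
    (forall k i, crd z (idx k i) = c k * crd x i) -> (exists k, c k != 0) -> (F' z <-> F x).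
Proof.
move=> cF; pose lin k i : {mpoly K[n * m]} := 'X_(idx k i).
have /choice[C hC] : forall k, exists C : set (proj K (n * m)), zclosed C /\
    forall z (x : proj K q) c, (forall i, (lin k i).@[coords z 0] = c * crd x i) ->
    (F x -> C z) /\ (c != 0 -> C z -> F x).
  move=> k; have [|C cC h] := @zclosed_linear K q (n * m) F (lin k) _ cF.
    by move=> i; rewrite dhomogX /= mdeg1.
  by exists C.
exists [set z | forall k, C k z]; first by apply: zclosed_bigcap => k; case: (hC k).
move=> z x c zE [k ck]; have linE l i : (lin l i).@[coords z 0] = c l * crd x i by rewrite mevalXU.
split=> [h|Fx l]; last by have [_ /(_ _ _ _ (linE l))[h1 _]] := hC l; exact: h1.
by have [_ /(_ _ _ _ (linE k))[_ h2]] := hC k; exact: h2.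
Qed.

Lemma zclosed_factor1 (F : set (proj K n)) : zclosed F ->
  exists2 F' : set (proj K (n * m)), zclosed F' & forall x y, F' (segre x y) <-> F x.
Proof.
move=> /(zclosed_factor (fun k i => mxvec_index i k))[F' cF' hF']; exists F' => // x y.
have [c c0 e] := crd_segre x y; apply: (hF' _ _ (fun k => c * crd y k)).
  by move=> k i; rewrite e mulrAC -mulrA.
by have [k yk] := exists_crd y; exists k; rewrite mulf_neq0.
Qed.

Lemma zclosed_factor2 (F : set (proj K m)) : zclosed F ->
  exists2 F' : set (proj K (n * m)), zclosed F' & forall x y, F' (segre x y) <-> F y.
Proof.
move=> /(zclosed_factor (fun k j => mxvec_index k j))[F' cF' hF']; exists F' => // x y.
have [c c0 e] := crd_segre x y; apply: (hF' _ _ (fun k => c * crd x k)).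
  by move=> k i; rewrite e mulrA.
by have [k xk] := exists_crd x; exists k; rewrite mulf_neq0.
Qed.

(* The Segre variety is cut out by the 2 x 2 minors. *)
Lemma segre_image : exists2 R : set (proj K (n * m)), zclosed R &
  (forall x y, R (segre x y)) /\ (forall z, R z -> exists x y, z = segre x y).
Proof.
pose minor (q : ('I_n * 'I_m) * ('I_n * 'I_m)) : {mpoly K[n * m]} :=
  'X_(mxvec_index q.1.1 q.1.2) * 'X_(mxvec_index q.2.1 q.2.2) -
  'X_(mxvec_index q.1.1 q.2.2) * 'X_(mxvec_index q.2.1 q.1.2).
have minorE q z : heval (minor q) z =
    crd z (mxvec_index q.1.1 q.1.2) * crd z (mxvec_index q.2.1 q.2.2) -
    crd z (mxvec_index q.1.1 q.2.2) * crd z (mxvec_index q.2.1 q.1.2).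
  by rewrite /heval mevalB !mevalM !mevalXU.
exists [set z | forall p, (exists q, p = minor q) -> heval p z = 0].
  exists [set p | exists q, p = minor q]; split=> // p [q ->]; exists 2%N.
  by apply: rpredB; rewrite -[2%N]/(1 + 1)%N; apply: dhomogM; rewrite dhomogX /= mdeg1.
split=> [x y _ [q ->]|z h].
  by have [c c0 e] := crd_segre x y; rewrite minorE !e; ring.
have [ij] := exists_crd z; case/mxvec_indexP: ij => i j zij.
(* In a matrix of rank one, the column and the row through a nonzero entry are proportional to the
   two factors. *)
pose v : 'rV[K]_n := \row_k crd z (mxvec_index k j).
pose w : 'rV[K]_m := \row_l crd z (mxvec_index i l).
have v0 : v != 0 by apply/rV0Pn; exists i; rewrite mxE.
have w0 : w != 0 by apply/rV0Pn; exists j; rewrite mxE.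
have [x [a [a0 xE]]] := exists_point v0; have [y [b [b0 yE]]] := exists_point w0.
exists x, y; have [c c0 e] := crd_segre x y.
apply/esym/(@proj_eq _ _ _ _ (c * a * b * crd z (mxvec_index i j))).
apply/rowP => kl; case/mxvec_indexP: kl => k l.
have /eqP : heval (minor ((k, j), (i, l))) z = 0 by apply: h; exists ((k, j), (i, l)).
rewrite minorE subr_eq0 /= => /eqP hm.
rewrite e xE yE !mxE; rewrite [LHS](_ : _ = c * a * b *
  (crd z (mxvec_index k j) * crd z (mxvec_index i l))); last by ring.
by rewrite hm; ring.
Qed.

Lemma zclosed_product (X : set (proj K n)) (Y : set (proj K m)) :
  zclosed X -> zclosed Y -> zclosed (product X Y).
Proof.
move=> /zclosed_factor1[X' cX' hX'] /zclosed_factor2[Y' cY' hY'].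
have [R cR [hR Rs]] := segre_image.
have -> : product X Y = R `&` (X' `&` Y').
  apply/seteqP; split=> z.
    by move=> [x [y [Xx Yy ->]]]; split; [|split; [exact/hX'|exact/hY']].
  by move=> [/Rs[x [y ->]] [/hX' Xx /hY' Yy]]; exists x, y.
by apply: zclosedI => //; exact: zclosedI.
Qed.

(** Each slice {x} x Y is irreducible, hence inside F or inside G; the x with slice inside F form a
    closed set, likewise for G, and irreducibility of [X] decides. *)
Lemma irreducible_product (X : set (proj K n)) (Y : set (proj K m)) :
  irreducible X -> irreducible Y -> irreducible (product X Y).
Proof.
move=> [[x0 Xx0] iX] [[y0 Yy0] iY]; split; first by exists (segre x0 y0), x0, y0.
move=> F G cF cG sub.
have key x : X x -> (forall y, Y y -> F (segre x y)) \/ (forall y, Y y -> G (segre x y)).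
  move=> Xx; have [|h|h] := iY _ _ (zclosed_slice2 x cF) (zclosed_slice2 x cG).
  - by move=> y Yy; apply: sub; exists x, y.
  - by left.
  - by right.
pose cl (H : set (proj K (n * m))) := [set x | forall y : {y | Y y}, H (segre x (sval y))].
have ccl H : zclosed H -> zclosed (cl H).
  by move=> cH; apply: zclosed_bigcap => y; exact: zclosed_slice1.
have [|h|h] := iX _ _ (ccl F cF) (ccl G cG).
- by move=> x Xx; have [h|h] := key x Xx; [left|right] => -[y Yy] /=; exact: h.
- by left=> _ [x [y [Xx Yy ->]]]; exact: (h x Xx (exist _ y Yy)).
- by right=> _ [x [y [Xx Yy ->]]]; exact: (h x Xx (exist _ y Yy)).
Qed.

(** Climb in the first factor above the least member of the second chain, then in the second factor;
    [minn] and truncated subtraction keep the indices in range. *)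
Lemma product_chain (X : set (proj K n)) (Y : set (proj K m)) a b :
  cchain X a -> cchain Y b -> cchain (product X Y) (a + b).
Proof.
move=> [C [hC ltC]] [D [hD ltD]].
exists (fun i => product (C (minn i a)) (D (i - a)%N)); split=> [i iab|i iab].
  have [cC iC CX] := hC (minn i a) (geq_minr _ _).
  have [|cD iD DY] := hD (i - a)%N; first by rewrite leq_subLR.
  split; [exact: zclosed_product|exact: irreducible_product|].
  by move=> _ [x [y [Cx Dy ->]]]; exists x, y; split=> //; [exact: CX|exact: DY].
rewrite /=; case: (ltnP i a) => ia.
  rewrite (minn_idPl ia).
  have -> : (i - a = 0)%N by apply/eqP; rewrite subn_eq0 ltnW.
  have -> : (i.+1 - a = 0)%N by apply/eqP; rewrite subn_eq0.
  have [sub /nonsubset[x [Cx nCx]]] := ltC i ia.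
  have [_ [[y Dy] _] _] := hD 0%N isT.
  split=> [_ [u [v [Cu Dv ->]]]|sub'].
    by exists u, v; split=> //; exact: sub.
  have [|u [v [Cu _ /segre_inj[xu _]]]] := sub' (segre x y); first by exists x, y.
  by apply: nCx; rewrite xu.
rewrite (minn_idPr (leqW ia)) subSn //.
have [|sub /nonsubset[y [Dy nDy]]] := ltD (i - a)%N; first by rewrite ltn_subLR.
have [_ [[x Cx] _] _] := hC a (leqnn _).
split=> [_ [u [v [Cu Dv ->]]]|sub'].
  by exists u, v; split=> //; exact: sub.
have [|u [v [_ Dv /segre_inj[_ yv]]]] := sub' (segre x y); first by exists x, y.
by apply: nDy; rewrite yv.
Qed.

End Segre.

Section Graphs.
Variables (K : closedFieldType) (n : nat) (X : set (proj K n)) (psi : proj K n -> proj K n).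
Hypotheses (cX : zclosed X) (hpsi : forall x, X x -> loc_mor X X x psi).

Lemma graph_embedding_closed (F : set (proj K (n * n))) : zclosed F ->
  exists2 F' : set (proj K n), zclosed F' & forall x, X x -> (F' x <-> F (segre x (psi x))).
Proof.
move=> cF; exists [set x | X x /\ F (segre x (psi x))]; last by move=> x Xx; split=> // -[].
apply: (zclosed_local cX) => [x []//|x Xx nF].
have hg := loc_mor_segre Xx (loc_mor_id Xx) (hpsi Xx).
have [|U [oU Ux hU]] := loc_mor_nbhd Xx hg (zopenC cF).
  by move=> Fx; apply: nF.
by exists U; split=> // y Xy Uy [_]; exact: (hU y Xy Uy).
Qed.

Lemma graph_sub_product (Z : set (proj K n)) : Z `<=` X -> graph Z psi `<=` product X X.
Proof.
by move=> ZX _ [x /ZX Xx <-]; exists x, (psi x); split=> //; exact: (loc_mor_image Xx (hpsi Xx)).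
Qed.

(** Off the graph some regular function separates y from psi(x). The difficulty is that these two
    points need not lie in a common coordinate chart. *)
Lemma zclosed_graph (Z : set (proj K n)) : zclosed Z -> Z `<=` X -> zclosed (graph Z psi).
Proof.
move=> cZ ZX; apply: (zclosed_local (zclosed_product cX cX) (graph_sub_product ZX)).
move=> z [x [y [Xx Xy ->]]] nz.
have [pr1 [pr2 [p1 p2]]] := exists_projections x y.
have Xz : product X X (segre x y) by exists x, y.
case: (pselect (Z x)) => [Zx|nZx]; last first.
  have [F cF hF] := @zclosed_factor1 K n n Z cZ.
  exists (~` F); split; [exact: zopenC|by move=> /hF|].
  by move=> w _ nF [u Zu e]; apply: nF; rewrite -e; apply/hF.
have xy : y <> psi x by move=> e; apply: nz; exists x => //; rewrite e.
have l1 := loc_mor_pr1 p1 Xx Xy; have l2 := loc_mor_pr2 p2 Xx Xy.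
have lpsi : loc_mor (product X X) X (segre x y) (psi \o pr1).
  have h : loc_mor X X (pr1 (segre x y)) psi by rewrite p1; exact: hpsi.
  exact: (loc_mor_comp Xz l1 h).
have [i yi] := exists_crd y.
have reg2 k : regular_at (product X X) (segre x y) (fun w => rat i (pr2 w) k).
  by apply: (loc_mor_regular (f := fun u => rat i u k) Xz l2); rewrite p2; exact: regular_rat_coord.
have regpsi j k : crd (psi x) j != 0 ->
    regular_at (product X X) (segre x y) (fun w => rat j (psi (pr1 w)) k).
  move=> h; apply: (loc_mor_regular (f := fun u => rat j u k) Xz lpsi); rewrite /= p1; exact: regular_rat_coord.
have regN f : regular_at (product X X) (segre x y) f ->
    regular_at (product X X) (segre x y) (fun w => (-1) * f w).
  by apply: regularM; exact: regular_cst.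
case: (boolP (crd (psi x) i == 0)) => [/eqP pi0|pi0]; last first.
  have [k hk] : exists k, rat i y k != rat i (psi x) k.
    apply: contrapT => /forallNP h; apply: xy; apply: (rat_inj yi pi0) => k.
    by apply/eqP/negPn/negP; exact: h.
  have [|U [oU Uz hU]] := regular_neq0 Xz (regularD (reg2 k) (regN _ (regpsi i k pi0))).
    by rewrite p1 p2 mulN1r subr_eq0.
  exists U; split=> // w Xw Uw [u Zu e]; have := hU w Xw Uw.
  by rewrite -e p1 p2 mulN1r subrr eqxx.
(* Without the common chart [i]: 1 - (y_j / y_i) (psi(x)_i / psi(x)_j) is 1 at the point and
   vanishes on the graph wherever both denominators are nonzero. *)
have [j pj] := exists_crd (psi x).
have [|U [oU Uz hU]] := regular_neq0 Xz (regularD (regular_cst _ _ 1)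
    (regN _ (regularM (reg2 j) (regpsi j i pj)))).
  by rewrite p1 p2 [rat j (psi x) i]/rat pi0 mul0r mulr0 mulr0 addr0 oner_neq0.
have [|V [oV Vz hV]] := loc_mor_nbhd Xz l2 (zopen_crd K i); first by rewrite /= p2.
have [|W [oW Wz hW]] := loc_mor_nbhd Xz lpsi (zopen_crd K j); first by rewrite /= p1.
exists (U `&` (V `&` W)); split=> //; first by apply: zopenI => //; exact: zopenI.
move=> w Xw [Uw [Vw Ww]] [u Zu e]; have := hU w Xw Uw.
move: (hV w Xw Vw) (hW w Xw Ww); rewrite /= -e p1 p2 => hi hj.
rewrite /rat mulN1r -[X in _ - X]mulrA mulKf // divff // subrr eqxx //.
Qed.

Lemma irreducible_graph (Z : set (proj K n)) : Z `<=` X -> irreducible Z -> irreducible (graph Z psi).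
Proof.
move=> ZX iZ; apply: irreducible_image => // F /graph_embedding_closed[F' cF' hF'].
by exists F' => // x /ZX; exact: hF'.
Qed.

(** The chain is pulled back along x |-> (x, psi x); irreducibility is preserved because closed
    subsets of [X] are in turn pulled back along the first projection. *)
Lemma graph_chain l : cchain (graph X psi) l -> cchain X l.
Proof.
move=> [C [hC ltC]]; exists (fun i => [set x | X x /\ C i (segre x (psi x))]).
split=> [i il|i il].
  have [cC iC CG] := hC i il; split.
  - have [F cF hF] := graph_embedding_closed cC.
    have -> : [set x | X x /\ C i (segre x (psi x))] = X `&` F.
      by apply/seteqP; split=> x [Xx h]; split=> //; exact/(hF x Xx).
    exact: zclosedI.
  - have [[z Cz] irr] := iC; split.
      by have [x Xx e] := CG _ Cz; exists x; split=> //; rewrite e.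
    move=> F G cF cG sub.
    have [F' cF' hF'] := @zclosed_factor1 K n n F cF; have [G' cG' hG'] := @zclosed_factor1 K n n G cG.
    have [|h|h] := irr F' G' cF' cG'.
    + move=> w Cw; have [x Xx e] := CG _ Cw; rewrite -e in Cw *.
      by have [|Fx|Gx] := sub x; [|left; exact/hF'|right; exact/hG'].
    + by left=> x [Xx Cx]; apply/(hF' x (psi x)); exact: h.
    + by right=> x [Xx Cx]; apply/(hG' x (psi x)); exact: h.
  - by move=> x [].
have [sub /nonsubset[z [Cz nCz]]] := ltC i il.
split=> [x [Xx Cx]|sub']; first by split=> //; exact: sub.
have [_ _ CG] := hC i.+1 il; have [x Xx e] := CG _ Cz.
by have [|_] := sub' x; rewrite ?e //; split=> //; rewrite e.
Qed.

End Graphs.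

(** * The fixed locus *)

Section FiniteQuotient.
Variables (K : closedFieldType) (B : comNzRingType).
Variables (kap : {rmorphism K -> B}) (ev : {rmorphism B -> K}).
Hypothesis evK : forall c, ev (kap c) = c.
Variables (x : nat -> B) (d : nat).
Hypothesis x_gen : forall b, ev b = 0 -> idl [set 0] x d b.

Lemma fin_mod_mpow s : exists (T : finType) (v : T -> B), forall b, exists c : T -> K,
  mpow x d s (b - \sum_t kap (c t) * v t).
Proof.
elim: s => [|s [T [v hv]]]; first by exists unit, (fun=> 0) => b; exists (fun=> 0).
exists (option ('I_d * T)), (fun o : option ('I_d * T) => if o is Some p then x p.1 * v p.2 else 1) => b.
have [a [_ -> ha]] := x_gen (ev_kap_sub evK b).
have /choice[c hc] : forall i : nat, exists c : T -> K, mpow x d s (a i - \sum_t kap (c t) * v t).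
  by move=> i; exact: hv.
exists (fun o : option ('I_d * T) => if o is Some p then c p.1 p.2 else ev b).
exists (fun i => a i - \sum_t kap (c i t) * v t) => //.
rewrite (bigD1 None) //= mulr1 opprD addrA ha addr0.
have -> : \sum_(o : option ('I_d * T) | o != None) kap (if o is Some p then c p.1 p.2 else ev b) *
      (if o is Some p then x p.1 * v p.2 else 1) =
    \sum_(i < d) \sum_t kap (c i t) * (x i * v t).
  rewrite pair_bigA /= (reindex_omap (fun p : 'I_d * T => Some p) id) /=; last by case.
  by apply: eq_bigl => p; rewrite eqxx.
rewrite -sumrB; apply: eq_bigr => i _; rewrite mulrBr mulr_sumr mulrC; congr (_ - _).
by apply: eq_bigr => t _; rewrite mulrCA.
Qed.

Lemma mpow_prod_min s t (p : set B) : is_ideal p ->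
  (forall u v, mpow x d s u -> mpow x d t v -> p (u * v)) -> mpow x d (s + t) `<=` p.
Proof.
elim: s p => [|s ih] p hp h c; first by move=> hc; rewrite -[c]mul1r; exact: h.
move=> [a ha ->]; apply: ideal_sum => // i _; have [p0 pD pM] := hp.
have := ih [set a | p (x i * a)] _ _ _ (ha i (ltn_ord i)); apply.
  split; rewrite /=.
  - by rewrite mulr0.
  - by move=> u v hu hv; rewrite mulrDr; exact: pD.
  - by move=> e u hu; rewrite mulrCA; exact: pM.
move=> u v hu hv; rewrite /= mulrA; apply: h => //.
by rewrite -add1n; apply: mpowM => //; exact: mpow1.
Qed.

(* An ideal maximal among those containing I and no power of the maximal ideal is prime. *)
Lemma exists_prime_not_primary (I : set B) : noetherian B -> is_ideal I ->
  (forall s, ~ (mpow x d s `<=` I)) ->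
  exists p, [/\ is_prime_ideal p, I `<=` p & exists2 i, (i < d)%N & ~ p (x i)].
Proof.
move=> nB hI hs.
pose F : set (set B) := [set E | [/\ is_ideal E, I `<=` E & forall s, ~ (mpow x d s `<=` E)]].
have [||p [hp Ip ps] pmax] := @noetherian_max B F nB.
- by move=> E [].
- by exists I; split=> // a.
have [p0 pD pM] := hp; exists p; split=> //; last first.
  apply: contrapT => h; apply: (ps 1%N) => _ [a _ ->]; apply: ideal_sum => // i _.
  apply: (idealMr _ hp); apply: contrapT => nx; apply: h; by exists i.
split=> // [p1|a b pab].
  by apply: (ps 0%N) => a _; rewrite -[a]mulr1; exact: pM.
apply: contrapT => /not_orP[na nb].
have big c : ~ p c -> exists s, mpow x d s `<=` idl p (fun=> c) 1.
  move=> nc; apply: contrapT => /forallNP h; apply: nc.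
  have hE := @idl_ideal _ p (fun=> c) 1 hp.
  apply: (pmax (idl p (fun=> c) 1)).
  - split=> //; by move=> u /Ip; exact: idl_base.
  - exact: idl_base.
  - exact: (@idl_gen _ p (fun=> c) 1 0 p0).
have [s hsa] := big a na; have [t htb] := big b nb.
apply: (ps (s + t)%N); apply: mpow_prod_min => // u v /hsa[c [q pq ->]] /htb[c' [q' pq' ->]].
rewrite !big_ord1.
have -> : (c 0%N * a + q) * (c' 0%N * b + q') = c 0%N * c' 0%N * (a * b) + (c 0%N * a + q) * q' + c' 0%N * b * q.
  by ring.
by apply: (pD); [apply: (pD)|]; exact: pM.
Qed.

End FiniteQuotient.

Lemma max_chain_uniq (T : Type) (Q : set T -> Prop) a b : max_chain Q a -> max_chain Q b -> a = b.
Proof. by move=> [ha Ha] [hb Hb]; apply/eqP; rewrite eqn_leq Ha ?Hb. Qed.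

Lemma zopen_bigcap (K : closedFieldType) n m (U : 'I_m -> set (proj K n)) :
  (forall i, zopen (U i)) -> zopen [set x | forall i, U i x].
Proof.
elim: m U => [|m ih] U h.
  by rewrite (_ : [set x | _] = setT); [exact: zopenT|apply/seteqP; split=> // x _ []].
have -> : [set x | forall i, U i x] = U ord_max `&` [set x | forall i, U (lift ord_max i) x].
  apply/seteqP; split=> x /= hx; first by split.
  by move=> i; case: hx => h1 h2; case: (unliftP ord_max i) => [j ->|->].
by apply: zopenI => //; apply: ih => i; exact: h.
Qed.

(** [c] is v + w - y, the expected dimension of a proper intersection. *)
Lemma proper_arith (a b c v w y : nat) :
  y = (a + v)%N -> y = (b + w)%N -> y = (a + b + c)%N -> (v + w <= y)%N -> c = 0%N.
Proof.
move=> e1 e2 e3 lev; have := leq_add lev (leqnn (a + b)).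
have -> : (v + w + (a + b) = y + y)%N by rewrite {1}e1 {1}e2 addnACA [(v + a)%N]addnC [(w + b)%N]addnC.
by rewrite leq_add2l e3 -[X in (_ <= X)%N]addn0 leq_add2l leqn0 => /eqP.
Qed.

(** * Isolation of the fixed point and finiteness of the quotient by the displacements *)

Section FixedPoint.
Variables (K : closedFieldType) (N : nat) (X : set (proj K N)) (phi : proj K N -> proj K N).
Variable P : proj K N.
Hypotheses (cX : zclosed X) (mphi : is_morphism X X phi).
Hypotheses (XP : X P) (phiP : phi P = P).

Lemma iterP n : iter n phi P = P.
Proof. by elim: n => //= n ->. Qed.

Lemma loc_iter n x : X x -> loc_mor X X x (iter n phi).
Proof. by move=> Xx; case: (loc_mor_iter n Xx mphi). Qed.

Let D n := graph X (iter n phi) `&` Defs.diagonal X.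

Lemma zclosed_fixed n : zclosed (D n).
Proof.
apply: zclosedI; first exact: (zclosed_graph cX (loc_iter n)).
exact: (zclosed_graph cX (fun x (Xx : X x) => loc_mor_id Xx)).
Qed.

(* Gamma_n and the diagonal both have the dimension of X, and X x X has at least twice
   this dimension, so that proper intersections are points. *)
Lemma fixed_locus_points n (Z : set (proj K N)) : nondegenerate_map X (iter n phi) ->
  zclosed Z -> irreducible Z -> (forall x, Z x -> X x /\ iter n phi x = x) ->
  Z P -> Z `<=` [set P].
Proof.
move=> nd cZ iZ hZ ZP y Zy; apply: contrapT => yP.
have lid x (Xx : X x) := loc_mor_id Xx.
have ZX : Z `<=` X by move=> x /hZ[].
have [|C hC ZC] := exists_irreducible_component (zclosed_fixed n)
    (zclosed_graph cX lid cZ ZX) (irreducible_graph cX lid ZX iZ).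
  move=> _ [x Zx <-]; have [Xx fx] := hZ x Zx.
  by split; exists x => //; rewrite /= fx.
have [cC iC _ _] := hC.
have [a [b [[ya [v [hya hv e1]]] [yb [w [hyb hw e2]]] [yc [c [hyc hc e3]]]]]] := nd C hC.
have eab := max_chain_uniq hya hyb; have eac := max_chain_uniq hya hyc.
have cv := graph_chain cX (loc_iter n) hv.1.
have cw := graph_chain cX lid hw.1.
have lev := hya.2 _ (product_chain cv cw).
(* A second point of [Z] makes {(P, P)} < C a chain in the component, against its dimension 0. *)
have lec : (1 <= c)%N.
  apply: hc.2; exists (fun i => if i is 0 then [set segre P P] else C); split=> [[|i] _|[|i] //= _].
  - split; [exact: zclosed_point|exact: irreducible_point|].
    by move=> _ ->; apply: ZC; exists P.
  - by split.
  - split; first by move=> _ ->; apply: ZC; exists P.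
    move=> sub; have /sub/segre_inj[] : C (segre y y) by apply: ZC; exists y.
    by move=> e; case: yP.
have := proper_arith e1 (etrans eab e2) (etrans eac e3) lev.
by move=> c0; rewrite c0 in lec.
Qed.

Local Notation B := (lring XP).
Variables (kap : {rmorphism K -> B}) (ev : {rmorphism B -> K}).
Hypothesis evE : forall f : regfun X P, ev (gm XP f) = f P.
Hypothesis kapE : forall c (f : regfun X P), (forall y, f y = c) -> kap c = gm XP f.

Lemma ev_kap c : ev (kap c) = c.
Proof.
have [f fE] := exists_regfun (regular_cst X P c).
by rewrite (@kapE c f) ?evE fE.
Qed.

Lemma ev_unitP b : ev b != 0 -> exists b', b * b' = 1.
Proof. by have [f ->] := gmP b; rewrite evE; exact: gm_unit. Qed.

Lemma nonunits_ev (b : B) : nonunits b <-> ev b = 0.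
Proof.
split=> [h|h [b' e]]; first by apply/eqP/negPn/negP => /ev_unitP.
have := congr1 ev e; rewrite rmorphM h mul0r rmorph1 => /eqP.
by rewrite eq_sym oner_eq0.
Qed.

(** Nakayama lifts a basis of the cotangent space to generators of the maximal ideal; regularity
    makes their number equal to the length of a chain of primes. *)
Lemma exists_generators : noetherian B -> regular_local_ring (local_ring X P) ->
  exists (x : nat -> B) d, [/\ forall i, ev (x i) = 0,
    forall b, ev b = 0 -> idl [set 0] x d b & has_chain (@is_prime_ideal B) d].
Proof.
move=> nB [_ _ [d [[hd _] [t [tm tgen _]]]]].
exists (fun i => if insub i is Some j then t j else 0), d; split=> //.
  by move=> i; case: insubP => [j _ _|_]; [apply/nonunits_ev; exact: tm|exact: rmorph0].
set x := fun i : nat => _.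
have hI : is_ideal (idl [set 0] x d) by apply: idl_ideal; exact: ideal0.
move=> b0; have := nakayama_ideal (evker_ideal ev) (evker_jac ev_unitP) nB hI (evker_ideal ev).
apply=> M hM xM mM b hb.
have [_ MD _] := hM.
have [|c [k [u [v [huv e]]]]] := tgen (b : local_ring X P); first exact/nonunits_ev.
rewrite -[b](subrK (\sum_(i < d) c i * t i : B)); apply: MD.
  rewrite [X in M X]e; apply: (@ideal_sum B) => // i _; apply: mM; apply/nonunits_ev.
    by case: (huv i).
  by case: (huv i).
apply: xM; exists (fun i => if insub i is Some j then c j else 0), 0 => //.
by rewrite addr0; apply: eq_bigr => i _; rewrite /x !valK.
Qed.

Variable i : 'I_N.
Hypothesis Pi : crd P i != 0.
Variable th : {rmorphism {mpoly K[N]} -> B}.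
Hypothesis thE : forall F (f : regfun X P), (forall y, f y = F.@[rat i y]) -> th F = gm XP f.

Lemma th_eq0 F (U : set (proj K N)) : zopen U -> U P ->
  (forall y, X y -> U y -> F.@[rat i y] = 0) -> th F = 0.
Proof.
move=> oU UP h; have [f fE] := exists_regfun (regular_rat X F Pi).
rewrite (@thE F f) => [|y]; last by rewrite fE.
by rewrite -gm0; apply/gm_eqP; exists U; split=> // y Xy Uy; rewrite fE; exact: h.
Qed.

Lemma ev_th F : ev (th F) = F.@[rat i P].
Proof.
have [f fE] := exists_regfun (regular_rat X F Pi).
by rewrite (@thE F f) ?evE => [|y]; rewrite fE.
Qed.

Section PrimeLocus.
Variable p : set B.
Hypothesis pp : is_prime_ideal p.

Let Q : set {mpoly K[N]} := [set F | p (th F)].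

(** The projective closure of the subvariety through [P] that [p] defines near [P]; for a form [F],
    [th F] is the germ of its dehomogenization in the chart [i]. *)
Definition prime_locus : set (proj K N) :=
  [set y | forall F, Q F /\ (exists d, F \is d.-homog) -> heval F y = 0].
Local Notation Z := prime_locus.

Lemma prime_sub_evker b : p b -> ev b = 0.
Proof.
move=> pb; apply/eqP/negPn/negP => /ev_unitP[b' e].
by have [hp p1 _] := pp; apply: p1; rewrite -e; exact: (idealMr _ hp).
Qed.

Lemma zclosed_prime_locus : zclosed Z.
Proof. by exists [set F | Q F /\ exists d, F \is d.-homog]; split=> // F []. Qed.

Lemma prime_locus_rat y F : Z y -> crd y i != 0 -> Q F -> F.@[rat i y] = 0.
Proof.
move=> Zy yi QF; have [d [G [hG GF]]] := homogenize i F.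
apply/eqP; rewrite -GF ?rat_diag // -(heval_eq0 hG yi); apply/eqP; apply: Zy.
split; last by exists d.
suff : th (G - F) = 0.
  by move=> /eqP; rewrite rmorphB subr_eq0 /Q /= => /eqP ->.
apply: (@th_eq0 _ [set z : proj K N | crd z i != 0]) => //; first exact: zopen_crd.
by move=> z _ zi; rewrite mevalB GF ?rat_diag // subrr.
Qed.

(** [Q] is a prime of the polynomial ring containing X_i - 1, so that a zero given by the
    Nullstellensatz is the vector of affine coordinates of a point in the chart. *)
Lemma prime_locus_point F : ~ Q F -> exists y, [/\ Z y, crd y i != 0 & F.@[rat i y] != 0].
Proof.
move=> QF; have [v [hv Fv]] := nullstellensatz_prime (prime_ideal_preim th pp) QF.
have vi : v i = 1.
  have : ('X_i - 1 : {mpoly K[N]}).@[v] = 0.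
    apply: hv; rewrite /= (_ : th _ = 0); first by have [[]] := pp.
    apply: (@th_eq0 _ [set z : proj K N | crd z i != 0]) => //; first exact: zopen_crd.
    by move=> z _ zi; rewrite mevalB mevalXU meval1 rat_diag // subrr.
  by rewrite mevalB mevalXU meval1 => /eqP; rewrite subr_eq0 => /eqP.
pose w : 'rV[K]_N := \row_j v j.
have w0 : w != 0 by apply/rV0Pn; exists i; rewrite mxE vi oner_neq0.
have [y [c [c0 yE]]] := exists_point w0.
have yj j : crd y j = c * v j by rewrite yE !mxE.
have ry : rat i y =1 v by move=> j; rewrite /rat !yj vi mulr1 mulrC mulKf.
exists y; split; last by rewrite (meval_eq _ ry).
  move=> G [QG [d hG]]; rewrite /heval (meval_eq _ (yj)) (meval_homog _ _ hG).
  by rewrite hv ?mulr0.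
by rewrite yj vi mulr1.
Qed.

Lemma prime_locus_P : Z P.
Proof.
move=> F [QF [d hF]]; apply/eqP; rewrite (heval_eq0 hF Pi) -ev_th; apply/eqP.
exact: prime_sub_evker.
Qed.

Lemma prime_locus_sub : Z `<=` X.
Proof.
move=> y Zy; have [S [hS XS]] := cX; rewrite XS => F SF; apply: Zy; split; last exact: hS.
rewrite /Q /= (@th_eq0 F [set z : proj K N | crd z i != 0]) //; first by have [[]] := pp.
  exact: zopen_crd.
move=> z Xz zi; have [d hd] := hS F SF; apply/eqP; rewrite -(heval_eq0 hd zi).
by move: Xz; rewrite XS => /(_ F SF) ->.
Qed.

Lemma irreducible_prime_locus : irreducible Z.
Proof.
split; first by exists P; exact: prime_locus_P.
have key (F : set (proj K N)) : zclosed F -> ~ (Z `<=` F) -> exists2 f, ~ Q f &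
    forall y, F y -> crd y i != 0 -> f.@[rat i y] = 0.
  move=> [S [hS FS]] /nonsubset[y [Zy]]; rewrite FS => /existsNP[f /not_implyP[Sf fy]].
  have [d hf] := hS f Sf; exists f; first by move=> Qf; apply: fy; apply: Zy; split=> //; exists d.
  by move=> z Fz zi; apply/eqP; rewrite -(heval_eq0 hf zi); apply/eqP; exact: Fz.
move=> F G cF cG sub; apply: contrapT => /not_orP[nF nG].
have [f Qf hf] := key F cF nF; have [g Qg hg] := key G cG nG.
have [|y [Zy yi]] := @prime_locus_point (f * g).
  by rewrite /Q /= rmorphM; have [_ _ h] := pp => /h[].
rewrite mevalM mulf_eq0 negb_or => /andP[fy gy].
by have [/hf e|/hg e] := sub y Zy; [move: fy|move: gy]; rewrite e ?eqxx.
Qed.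

Lemma prime_locus_nontrivial b : ev b = 0 -> ~ p b -> ~ (Z `<=` [set P]).
Proof.
move=> b0 pb sub; have [F [G [G0 bG]]] := th_frac Pi thE b.
have QF : ~ Q F.
  rewrite /Q /= -bG; have [_ _ h] := pp => /h[//|/prime_sub_evker].
  by rewrite ev_th => /eqP; rewrite (negbTE G0).
have [y [Zy yi Fy]] := prime_locus_point QF.
move: Fy; rewrite (sub y Zy) -ev_th -bG rmorphM b0 mul0r eqxx //.
Qed.

Lemma prime_locus_germ (f : regfun X P) : p (gm XP f) ->
  exists U, [/\ zopen U, U P & forall y, Z y -> U y -> f y = 0].
Proof.
move=> pf; have [F [G [G0 bG]]] := th_frac Pi thE (gm XP f).
have QF : Q F by rewrite /Q /= -bG; have [hp _ _] := pp; exact: (idealMr _ hp).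
have [g gE] := exists_regfun (regular_rat X G Pi).
have [k kE] := exists_regfun (regular_rat X F Pi).
move: bG; rewrite (@thE G g) => [|y]; last by rewrite gE.
rewrite (@thE F k) => [|y]; last by rewrite kE.
rewrite -gmM => /gm_eqP[U [oU UP hU]].
exists (U `&` [set y | crd y i != 0 /\ G.@[rat i y] != 0]); split=> //.
  by apply: zopenI => //; exact: zopen_rat.
move=> y Zy [Uy [/= yi Gy]]; have := hU y (prime_locus_sub Zy) Uy.
rewrite -[(f * g) y]/(f y * g y) gE kE (prime_locus_rat Zy yi QF) => /eqP.
by rewrite mulf_eq0 (negbTE Gy) orbF => /eqP.
Qed.

End PrimeLocus.

Variables (n : nat) (psi : {rmorphism B -> B}).
Hypothesis psiE : forall f g : regfun X P, (forall z, g z = f (iter n phi z)) -> psi (gm XP f) = gm XP g.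
Hypothesis nd : nondegenerate_map X (iter n phi).
Variables (x : nat -> B) (d : nat).
Hypothesis ev_x : forall j, ev (x j) = 0.
Hypothesis x_gen : forall b, ev b = 0 -> idl [set 0] x d b.
Hypothesis noethB : noetherian B.

Lemma psi_kapP c : psi (kap c) = kap c.
Proof.
have [f fE] := exists_regfun (regular_cst X P c).
have kf : kap c = gm XP f by apply: kapE => y; rewrite fE.
by rewrite kf; apply: psiE => y; rewrite fE.
Qed.

Lemma ev_psiP b : ev (psi b) = ev b.
Proof.
have [f ->] := gmP b; have [g gE] := exists_pullf XP f (loc_iter n XP) (iterP n).
by rewrite (psiE gE) !evE gE iterP.
Qed.

(** If the displacements generated no ideal containing a power of m, some prime over them would miss
    a parameter. Its locus would be an irreducible closed set of fixed points of phi^n through [P],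
    larger than a point. *)
Lemma fixed_finite_quotient : exists (T : finType) (v : T -> B), forall b, exists c : T -> K,
  idl [set 0] (fun j => x j - psi (x j)) d (b - \sum_t kap (c t) * v t).
Proof.
set I := idl _ _ _; have hI : is_ideal I by apply: idl_ideal; exact: ideal0.
suff [s sI] : exists s, mpow x d s `<=` I.
  have [T [v hv]] := fin_mod_mpow ev_kap x_gen s; exists T, v => b.
  by have [c hc] := hv b; exists c; exact: sI.
apply: contrapT => /forallNP hs.
have [p [pp Ip [j jd pxj]]] := exists_prime_not_primary noethB hI hs.
have [] := prime_locus_nontrivial pp (ev_x j) pxj.
have cZ := zclosed_prime_locus p.
have iZ := irreducible_prime_locus pp.
have ZX := prime_locus_sub pp.
apply: (fixed_locus_points nd cZ iZ _ (prime_locus_P pp)) => y Zy.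
split; first exact: ZX.
have [W [oW WP hW]] : exists W, [/\ zopen W, W P & forall z, prime_locus p z -> W z -> iter n phi z = z].
  (* By [sub_endo_idl], [p] contains the displacements of all germs, in particular of the affine
     coordinates, which therefore vanish on the locus near [P]. *)
  have /choice[U hU] : forall k : 'I_N, exists U, [/\ zopen U, U P & forall z, prime_locus p z -> U z ->
      rat i z k - rat i (iter n phi z) k = 0].
    move=> k; have [f fE] := exists_regfun (regular_rat_coord X k Pi).
    have [g gE] := exists_pullf XP f (loc_iter n XP) (iterP n).
    have [|U [oU UP h]] := @prime_locus_germ p pp (f - g).
      have := Ip _ (sub_endo_idl ev_kap ev_unitP noethB ev_x x_gen psi_kapP ev_psiP (gm XP f)).
      rewrite (psiE gE); congr (p _); apply/eqP; by rewrite subr_eq -gmD subrK.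
    exists U; split=> // z Zz Uz; have := h z Zz Uz.
    by rewrite -[(f - g) z]/(f z - g z) gE fE.
  have [|V [oV VP hV]] := loc_mor_nbhd XP (loc_iter n XP) (zopen_crd K i); first by rewrite /= iterP.
  exists ([set z | forall k, U k z] `&` ([set z : proj K N | crd z i != 0] `&` V)); split.
  - apply: zopenI; first by apply: zopen_bigcap => k; case: (hU k).
    by apply: zopenI => //; exact: zopen_crd.
  - by split; [move=> k; case: (hU k)|split].
  - move=> z Zz [Uz [/= zi Vz]]; apply/esym; apply: (rat_inj zi) => [|k].
      exact: (hV z (ZX _ Zz) Vz).
    by have [_ _ h] := hU k; apply/eqP; rewrite -subr_eq0; apply/eqP; apply: h.
(* From near [P] to everywhere: the fixed points are closed, so the irreducible locus consists of
   fixed points or misses [W], and it contains [P]. *)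
have [F cF hF] := graph_embedding_closed cX (fun z (Xz : X z) => loc_mor_id Xz) (zclosed_fixed n).
have [|h|h] := iZ.2 F (~` W) cF oW.
- move=> z Zz; case: (pselect (W z)) => [Wz|]; [left|by right].
  apply/(hF z (ZX _ Zz)); split; exists z; rewrite ?(hW z) //; exact: ZX.
- have /(hF y (ZX _ Zy))[[u Xu /segre_inj[-> ->]] _] := h y Zy.
  by [].
- by case: (h P (prime_locus_P pp)).
Qed.

End FixedPoint.

Section GraphIdeal.
Variables (K : closedFieldType) (N : nat) (X : set (proj K N)) (P : proj K N).
Variable psi : proj K N -> proj K N.
Hypotheses (XP : X P) (hpsi : forall x, X x -> loc_mor X X x psi) (psiP : psi P = P).
Let XXP : product X X (segre P P). Proof. by exists P, P. Qed.
Variable h : {rmorphism lring XXP -> lring XP}.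
Hypothesis hE : forall (f : regfun (product X X) (segre P P)) (g : regfun X P), (forall z, g z = f (segre z (psi z))) -> h (gm XXP f) = gm XP g.

(** Restriction to the graph is pullback along x |-> (x, psi x); an open set of [X] on which the
    pullback vanishes extends to the product through the first projection. *)
Lemma local_ideal_graph :
  @local_ideal K (N * N) (product X X) (segre P P) (graph X psi) = [set a | h a = 0].
Proof.
have lg : loc_mor X (product X X) P (fun z => segre z (psi z)).
  exact: (loc_mor_segre XP (loc_mor_id XP) (hpsi XP)).
have gP : segre P (psi P) = segre P P by rewrite psiP.
apply/seteqP; split=> [a [f -> [U [oU UP hU]]]|a] /=.
  have [g gE] := exists_pullf XP f lg gP.
  rewrite -[germ f]/(gm XXP f) (hE gE) -gm0; apply/gm_eqP.
  have [|V [oV VP hV]] := loc_mor_nbhd XP lg oU; first by rewrite /= gP.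
  exists V; split=> // z Xz Vz; rewrite gE; apply: hU; last exact: hV.
  by exists z.
have [f ->] := gmP a; have [g gE] := exists_pullf XP f lg gP.
rewrite (hE gE) -(gm0 XP) => /gm_eqP[U [oU UP hU]].
exists f => //; have [F cF hF] := @zclosed_factor1 K N N _ oU.
exists (~` F); split; [exact: zopenC|by move=> /hF|].
move=> _ [z Xz <-] nF; rewrite -gE; apply: hU => //.
by apply: contrapT => nU; apply: nF; apply/hF.
Qed.

End GraphIdeal.

Theorem theorem4p12 (K : closedFieldType) (N : nat) (X : set (proj K N))
    (phi : proj K N -> proj K N) (P : proj K N) :
  projective_variety X -> nonsingular X -> is_morphism X X phi ->
  (forall n : nat, (1 <= n)%N -> nondegenerate_map X (iter n phi)) ->
  X P -> phi P = P ->
  exists C : nat, forall n : nat, (1 <= n)%N -> n%:R != 0 :> K ->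
    exists m : int, fixed_point_multiplicity X phi P n m /\ `|m| <= C%:Z.
Proof.
move=> [cX _] nsX mphi nd XP phiP.
have XXP : product X X (segre P P) by exists P, P.
have liter n x (Xx : X x) : loc_mor X X x (iter n phi) by case: (loc_mor_iter n Xx mphi).
have iterPP n : iter n phi P = P by exact: iterP.
have [i Pi] := exists_crd P.
have Pii : crd (segre P P) (mxvec_index i i) != 0 by rewrite crd_segre_neq0 Pi.
have [pr1 [pr2 [p1 p2]]] := exists_projections P P.
have [ev evE] := exists_ev XP; have [kap kapE] := exists_const XP.
have [thB thBE] := exists_theta XP Pi; have [thA thAE] := exists_theta XXP Pii.
have l1 := loc_mor_pr1 p1 XP XP; have l2 := loc_mor_pr2 p2 XP XP.
have [rho1 r1E] := exists_pull XXP XP l1 (p1 P P).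
have [rho2 r2E] := exists_pull XXP XP l2 (p2 P P).
have lsl x (Xx : X x) : loc_mor X (product X X) P (fun y => segre x y).
  exact: (loc_mor_segre XP (loc_mor_const X P Xx) (loc_mor_id XP)).
have lsr : loc_mor X (product X X) P (fun y => segre y P).
  exact: (loc_mor_segre XP (loc_mor_id XP) (loc_mor_const X P XP)).
have ldel : loc_mor X (product X X) P (fun y => segre y y).
  exact: (loc_mor_segre XP (loc_mor_id XP) (loc_mor_id XP)).
have lgam n : loc_mor X (product X X) P (fun y => segre y (iter n phi y)).
  exact: (loc_mor_segre XP (loc_mor_id XP) (liter n P XP)).
have [iota iE] := exists_pull XP XXP (lsl P XP) erefl.
have [delta dE] := exists_pull XP XXP ldel erefl.
have gamP n : segre P (iter n phi P) = segre P P by rewrite iterPP.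
have /choice[gam gE] := fun n => exists_pull XP XXP (lgam n) (gamP n).
have /choice[psi psiE] := fun n => exists_pull XP XP (liter n P XP) (iterPP n).
have evK := ev_kap evE kapE; have evU := ev_unitP evE.
have noethB := noetherian_lring Pi thBE; have noethA := noetherian_lring Pii thAE.
have [x [d [ev_x x_gen chB]]] := exists_generators evE noethB (nsX P XP).
have pf1 f := exists_pullf XXP f l1 (p1 P P); have pf2 f := exists_pullf XXP f l2 (p2 P P).
have kapf c : exists2 f : regfun X P, kap c = gm XP f & forall y, f y = c.
  by have [f fE] := exists_regfun (regular_cst X P c); exists f; [apply: kapE => y|move=> y]; rewrite fE.
have ev_delta a (f : regfun (product X X) (segre P P)) : a = gm XXP f -> ev (delta a) = f (segre P P).
  move=> ->; have [g gf] := exists_pullf XP f ldel erefl.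
  by rewrite (dE _ _ gf) evE gf.
have rho_kap c : rho1 (kap c) = rho2 (kap c).
  have [f -> fc] := kapf c; have [g gf] := pf1 f; have [h hf] := pf2 f.
  by rewrite (r1E _ _ gf) (r2E _ _ hf); apply: gm_ext => z; rewrite gf hf !fc.
(* In the chart (i, i) of the Segre embedding, the coordinate (j, l) is the product of the affine
   coordinates j and l of the two factors. *)
have tens_th F : tens rho1 rho2 (thA F).
  have t_kap c : tens rho1 rho2 (rho1 (kap c)).
    by exists 1%N, (fun=> kap c), (fun=> 1); rewrite big_ord1 rmorph1 mulr1.
  have th_const c : thA c%:MP = rho1 (kap c).
    have [f -> fc] := kapf c; have [g gf] := pf1 f.
    by rewrite (r1E _ _ gf); apply: thAE => z; rewrite gf fc mevalC.
  elim/mpolyind: F => [|c m F _ _ ih].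
    by rewrite rmorph0 -(rmorph0 rho1) -(rmorph0 kap); exact: t_kap.
  rewrite rmorphD; apply: tensD ih; rewrite -mul_mpolyC rmorphM th_const; apply: tensM => //.
  rewrite mpolyXE_id rmorph_prod; elim/big_ind: _ => [|a b|jk _].
  - by rewrite -(rmorph1 rho1) -(rmorph1 kap); exact: t_kap.
  - exact: tensM.
  rewrite rmorphXn; elim: (m jk) => [|k ihk].
    by rewrite expr0 -(rmorph1 rho1) -(rmorph1 kap); exact: t_kap.
  rewrite exprS; apply: tensM => //; case/mxvec_indexP: jk {ihk} => j l.
  exists 1%N, (fun=> thB 'X_j), (fun=> thB 'X_l); rewrite big_ord1.
  have [f fE] := exists_regfun (regular_rat_coord X j Pi).
  have [g gE'] := exists_regfun (regular_rat_coord X l Pi).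
  rewrite (@thBE _ f) => [|y]; last by rewrite mevalXU fE.
  rewrite (@thBE _ g) => [|y]; last by rewrite mevalXU gE'.
  have [f' ff'] := pf1 f; have [g' gg'] := pf2 g.
  rewrite (r1E _ _ ff') (r2E _ _ gg') -gmM.
  have [h hE] := exists_regfun (regular_rat_coord (product X X) (mxvec_index j l) Pii).
  rewrite (@thAE _ h) => [|y]; last by rewrite mevalXU hE.
  apply/gm_eqP; exists setT; split=> //; first exact: zopenT.
  move=> _ [u [v [Xu Xv ->]]] _; rewrite -[(f' * g') _]/(f' _ * g' _) ff' gg' p1 p2 fE gE' hE.
  exact: rat_segre.
have evd_unit a : ev (delta a) != 0 -> exists a', a * a' = 1.
  have [f ->] := gmP a; rewrite (ev_delta _ f erefl) => h; exact: gm_unit.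
have iota_rho1 b : iota (rho1 b) = kap (ev b).
  have [f ->] := gmP b; have [g gf] := pf1 f; have [h -> hc] := kapf (ev (gm XP f)).
  by rewrite (r1E _ _ gf); apply: iE => z; rewrite hc evE gf p1.
have iota_rho2 b : iota (rho2 b) = b.
  have [f ->] := gmP b; have [g gf] := pf2 f.
  by rewrite (r2E _ _ gf); apply: iE => z; rewrite gf p2.
have delta_rho1 b : delta (rho1 b) = b.
  have [f ->] := gmP b; have [g gf] := pf1 f.
  by rewrite (r1E _ _ gf); apply: dE => z; rewrite gf p1.
have delta_rho2 b : delta (rho2 b) = b.
  have [f ->] := gmP b; have [g gf] := pf2 f.
  by rewrite (r2E _ _ gf); apply: dE => z; rewrite gf p2.
have gam_rho1 n b : gam n (rho1 b) = b.
  have [f ->] := gmP b; have [g gf] := pf1 f.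
  by rewrite (r1E _ _ gf); apply: gE => z; rewrite gf p1.
have gam_rho2 n b : gam n (rho2 b) = psi n b.
  have [f ->] := gmP b; have [g gf] := pf2 f.
  have [h hf] := exists_pullf XP f (liter n P XP) (iterPP n).
  by rewrite (r2E _ _ gf) (psiE n _ _ hf); apply: gE => z; rewrite gf p2 hf.
have ev_iota a : ev (iota a) = ev (delta a).
  have [f ->] := gmP a; rewrite (ev_delta _ f erefl).
  have [g gf] := exists_pullf XP f (lsl P XP) erefl.
  by rewrite (iE _ _ gf) evE gf.
have ev_gam n a : ev (gam n a) = ev (delta a).
  have [f ->] := gmP a; rewrite (ev_delta _ f erefl).
  have [g gf] := exists_pullf XP f (lgam n) (gamP n).
  by rewrite (gE n _ _ gf) evE gf iterPP.
have psi_kap n c : psi n (kap c) = kap c.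
  by have [f -> fc] := kapf c; apply: psiE => z; rewrite !fc.
have psi_iter n b : psi n b = iter n (psi 1%N) b.
  elim: n b => [|n ih] b.
    by have [f ->] := gmP b; apply: psiE.
  have [f ->] := gmP b; have [g gf] := exists_pullf XP f (liter 1%N P XP) (iterPP 1%N).
  rewrite iterSr (psiE 1%N _ _ gf) -ih.
  have [h hg] := exists_pullf XP g (liter n P XP) (iterPP n).
  by rewrite (psiE n _ _ hg); apply: psiE => z; rewrite hg gf.
have tens_loc a : exists h, [/\ tens rho1 rho2 h, ev (delta h) != 0 & tens rho1 rho2 (h * a)].
  have [F [G [G0 aG]]] := th_frac Pii thAE a; exists (thA G); split; first exact: tens_th.
    have [f fE] := exists_regfun (regular_rat (product X X) G Pii).
    by rewrite (ev_delta _ f) ?fE //; apply: thAE => y; rewrite fE.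
  by rewrite mulrC aG; exact: tens_th.
have tens_inj n (b c : nat -> lring XP) : kindep kap n c ->
    \sum_(j < n) rho1 (b j) * rho2 (c j) = 0 -> forall j, (j < n)%N -> b j = 0.
  move=> ic h0.
  have /choice[bf bfE] : forall j, exists f, b j = gm XP f by move=> j; exact: gmP.
  have /choice[cf cfE] : forall j, exists f, c j = gm XP f by move=> j; exact: gmP.
  have /choice[bf' bfE'] : forall j, exists g : regfun (product X X) (segre P P), forall z, g z = bf j (pr1 z).
    by move=> j; exact: pf1.
  have /choice[cf' cfE'] : forall j, exists g : regfun (product X X) (segre P P), forall z, g z = cf j (pr2 z).
    by move=> j; exact: pf2.
  have : gm XXP (\sum_(j < n) bf' j * cf' j) = gm XXP 0.
    rewrite gm0 -h0 gm_sum; apply: eq_bigr => j _.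
    by rewrite gmM bfE cfE (r1E _ _ (bfE' j)) (r2E _ _ (cfE' j)).
  move=> /gm_eqP[U [oU UP hU]].
  (* For y near [P] the point (y, P) stays in [U], so the relation holds on the slice {y} x X near
     [P]. There the first factors are constants, and independence of the [c j] makes them vanish. *)
  have [V [oV VP hV]] := loc_mor_nbhd XP lsr oU UP.
  move=> j jn; rewrite bfE -(gm0 XP); apply/gm_eqP; exists V; split=> // y Xy Vy.
  have [W [oW WP hW]] := loc_mor_nbhd XP (lsl y Xy) oU (hV y Xy Vy).
  apply: (ic (fun l => bf l y)) jn.
  have /choice[kf kfE] : forall l, exists f : regfun X P, kap (bf l y) = gm XP f /\ forall z, f z = bf l y.
    by move=> l; have [f h1 h2] := kapf (bf l y); exists f.
  have -> : \sum_(l < n) kap (bf l y) * c l = gm XP (\sum_(l < n) kf l * cf l).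
    by rewrite gm_sum; apply: eq_bigr => l _; rewrite gmM cfE; have [-> _] := kfE l.
  rewrite -(gm0 XP); apply/gm_eqP; exists W; split=> // z Xz Wz.
  have := hU (segre y z) _ (hW z Xz Wz); rewrite !regfun_sum => h.
  have {}h : \sum_(l < n) (bf' l * cf' l : regfun _ _) (segre y z) = 0 by apply: h; exists y, z.
  rewrite -[RHS]h; apply: eq_bigr => l _.
  rewrite -[LHS]/(kf l z * cf l z) -[RHS]/(bf' l (segre y z) * cf' l (segre y z)).
  by rewrite bfE' cfE' p1 p2; have [_ ->] := kfE l.
have fin_quot n : (0 < n)%N -> exists (T : finType) (v : T -> lring XP), forall b, exists c : T -> K,
    idl [set 0] (fun j => x j - psi n (x j)) d (b - \sum_t kap (c t) * v t).
  move=> n0.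
  exact: (fixed_finite_quotient cX mphi phiP evE kapE Pi thBE (psiE n) (nd n n0) ev_x x_gen noethB).
have [C hC] := core_bound evK evU evd_unit rho_kap iota_rho1 iota_rho2 delta_rho1 delta_rho2
  gam_rho1 gam_rho2 ev_iota ev_gam psi_kap psi_iter noethA noethB tens_loc tens_inj
  ev_x x_gen chB fin_quot.
exists C => n n1 nK; have [m [hm mC]] := hC n n1 nK; exists m; split=> //.
rewrite /fixed_point_multiplicity /intersection_multiplicity.
have -> := local_ideal_graph (XP := XP) (liter n) (iterPP n) (h := gam n) (gE n).
(* The diagonal is the graph of the identity. *)
have -> := local_ideal_graph (XP := XP) (fun y Xy => loc_mor_id Xy) (erefl P) (h := delta) dE.
exact: hm.
Qed.
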